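(* Let $\alpha>0$, $s>0$ and $p>0$ satisfy $s+p\alpha>1$. Then $M_0(F(p,p\alpha-2,s))=\{0\}$; that is, for $g\in H(D)$, the multiplication operator $M_g$ is compact on $F(p,p\alpha-2,s)$ if and only if $g=0$.
   Context: $D$ is the open unit disk of the complex plane, $H(D)$ the space of analytic functions on $D$, $dA$ the normalized area measure on $D$, and $\varphi_a(z)=(a-z)/(1-\bar a z)$ for $a\in D$. For $0<p<\infty$, $-2<q<\infty$, $0\le s<\infty$, $F(p,q,s)$ is the space of $f\in H(D)$ with $$\|f\|_{F(p,q,s)}^p=\sup_{a\in D}\int_D|f'(z)|^p(1-|z|^2)^q(1-|\varphi_a(z)|^2)^s\,dA(z)<\infty,$$ with norm (quasi-norm if $p<1$) $|||f|||_{F(p,q,s)}=|f(0)|+\|f\|_{F(p,q,s)}$. For $g\in H(D)$, $M_gf=fg$. $M_0(X)=\{g\in H(D): M_g\text{ is compact on }X\}$, where compact on $X$ means that $M_g$ maps $X$ into $X$ and every bounded sequence in $X$ to a sequence having a convergent subsequence in $X$. *)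

(* Defs.v *)
From HB Require Import structures.
From mathcomp Require Import all_boot all_order all_algebra.
From mathcomp Require Import complex.
From mathcomp Require Import all_classical all_reals all_analysis.

Set Implicit Arguments.
Unset Strict Implicit.
Unset Printing Implicit Defensive.

Import Order.TTheory GRing.Theory Num.Theory.
Import numFieldNormedType.Exports.

Local Open Scope classical_set_scope.
Local Open Scope ring_scope.

(* R-valued modulus: the norm `|z| of R[i] is (modulus z)%:C. *)
Definition modulus (R : realType) (z : R[i]) : R := ComplexField.Normc.normc z.

Definition disk (R : realType) : set R[i] := [set z | modulus z < 1].

(* Elements of H(D) are represented by total functions on R[i], of which only
   the values on the disk matter; derivability is over the field R[i]. *)
Definition analytic_disk (R : realType) : set (R[i] -> R[i]) :=
  [set f | forall z, disk z -> derivable (f : R[i]^o -> R[i]^o) z 1].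

Definition cderiv (R : realType) (f : R[i] -> R[i]) (z : R[i]) : R[i] :=
  derive1 (f : R[i]^o -> R[i]^o) z.

Definition mobius (R : realType) (a z : R[i]) : R[i] :=
  (a - z) / (1 - a^* * z).

(* The factor 1/pi normalizes the area measure of the disk to 1. *)
Definition disk_integral (R : realType) (u : R[i] -> R) : \bar R :=
  ((pi^-1)%:E * \int[(@lebesgue_measure R \x @lebesgue_measure R)%E]_(w in
     [set w : R * R | disk (Complex w.1 w.2)]) (u (Complex w.1 w.2))%:E)%E.

Definition Fseminorm (R : realType) (p q s : R) (f : R[i] -> R[i]) : \bar R :=
  poweR (ereal_sup [set disk_integral (fun z =>
      modulus (cderiv f z) `^ p * (1 - modulus z ^+ 2) `^ q
      * (1 - modulus (mobius a z) ^+ 2) `^ s) | a in @disk R]) p^-1.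

Definition Fnorm (R : realType) (p q s : R) (f : R[i] -> R[i]) : \bar R :=
  ((modulus (f 0))%:E + Fseminorm p q s f)%E.

Definition Fspace (R : realType) (p q s : R) : set (R[i] -> R[i]) :=
  [set f | analytic_disk f /\ (Fseminorm p q s f < +oo)%E].

(* X is a space of functions and N its (quasi-)norm. *)
Definition compact_on (R : realType) (X : set (R[i] -> R[i]))
    (N : (R[i] -> R[i]) -> \bar R)
    (T : (R[i] -> R[i]) -> R[i] -> R[i]) : Prop :=
  (forall f, X f -> X (T f)) /\
  (forall f : nat -> R[i] -> R[i], (forall n, X (f n)) ->
    (exists M : R, forall n, (N (f n) <= M%:E)%E) ->
    exists (k : nat -> nat) (h : R[i] -> R[i]),
      [/\ {homo k : m n / (m < n)%N}, X h &
          N (T (f (k n)) - h) @[n --> \oo] --> 0%E]).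

Definition mulop (R : realType) (g f : R[i] -> R[i]) : R[i] -> R[i] :=
  fun z => f z * g z.

Definition M0 (R : realType) (X : set (R[i] -> R[i]))
    (N : (R[i] -> R[i]) -> \bar R) : set (R[i] -> R[i]) :=
  [set g | analytic_disk g /\ compact_on X N (mulop g)].

(* Main.v *)
Require Import Defs.
From HB Require Import structures.
From mathcomp Require Import all_boot all_order all_algebra.
From mathcomp Require Import complex.
From mathcomp Require Import all_classical all_reals all_analysis.
From mathcomp Require Import measurable_realfun.
From mathcomp Require Import ring lra.

(** If M_g is compact and g z0 <> 0, F. Riesz's argument on compact operators gives
a contradiction. Near z0 there are distinct points b_0, b_1, ... with
|g (b_n)| >= delta > 0. The functions of the space vanishing at b_0, ..., b_(n-1)
form a decreasing sequence Y_n of subspaces, invariant under M_g, and M_g - g(b_n)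
maps Y_n into Y_(n+1). Riesz's lemma (riesz_vanishing) provides unit vectors y_n of
Y_n at distance at least 1/2 from Y_(n+1); then M_g y_n and M_g y_m stay at distance
at least delta / 2 for n <> m, and no subsequence of M_g y_n can converge
(compact_multiplier_eq0). This works for quasi-norms, hence for p < 1.

Two facts about the space are needed.

Point evaluations are bounded (point_evaluation), which makes each Y_(n+1) closed.
For p < 1 this rests on a mean value inequality for |f'|^p. A function that is
merely differentiable on the disk satisfies Goursat's theorem on rectangles (goursat)
and Cauchy's formula (cauchy_formula), so its derivative is again differentiable
(holo_cderiv); averaging Cauchy's formula for f' over rectangles bounds |f'| by its
area means (mean_value_inequality), and a maximal argument lowers the exponent to any
p in ]0, 1] (power_mean_value).

Polynomials belong to the space, so that the Y_n decrease strictly. As their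
derivatives are bounded on the disk, this is the uniform bound over a of the integral
of the weight alone (integral_Fweight), and the place where s + p alpha > 1 enters,
through integrability of (1 - |z|^2)^(p alpha - 2 + s). With sigma < 1, sigma <= s and
tau < 1 such that -tau <= q + sigma, for q = p alpha - 2, the weight is at most
2 (1 - |z|^2)^(-tau) |1 - conj(a) z|^(-sigma), and this is integrated by Tonelli
against explicit one-dimensional majorants (dyadic_kernel). *)

Import Order.TTheory GRing.Theory Num.Theory.
Import numFieldNormedType.Exports.

Local Open Scope classical_set_scope.
Local Open Scope ring_scope.

Set Implicit Arguments.
Unset Strict Implicit.
Unset Printing Implicit Defensive.

Local Notation Re := (@complex.Re _).
Local Notation Im := (@complex.Im _).
Local Notation mu := lebesgue_measure.
Local Notation mu2 := (lebesgue_measure \x lebesgue_measure)%E.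

(** * The modulus and complex differentiability *)

Section Modulus.
Variable R : realType.
Implicit Types z w : R[i].

Lemma modulus_ge0 z : 0 <= modulus z.
Proof. by case: z => x y; rewrite /modulus /= sqrtr_ge0. Qed.

Lemma modulus0 : modulus (0 : R[i]) = 0.
Proof. exact: ComplexField.Normc.normc0. Qed.

Lemma modulus1 : modulus (1 : R[i]) = 1.
Proof. exact: ComplexField.Normc.normc1. Qed.

Lemma modulus0_eq z : modulus z = 0 -> z = 0.
Proof. exact: ComplexField.Normc.eq0_normc. Qed.

Lemma modulus_gt0 z : z != 0 -> 0 < modulus z.
Proof.
move=> z0; rewrite lt_neqAle modulus_ge0 andbT eq_sym.
by apply: contra z0 => /eqP /modulus0_eq ->.
Qed.

Lemma modulusM z w : modulus (z * w) = modulus z * modulus w.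
Proof. exact: ComplexField.Normc.normcM. Qed.

Lemma modulusV z : modulus z^-1 = (modulus z)^-1.
Proof. exact: ComplexField.Normc.normcV. Qed.

Lemma modulusX z n : modulus (z ^+ n) = modulus z ^+ n.
Proof.
by elim: n => [|n IH]; rewrite ?expr0 ?modulus1// !exprS modulusM IH.
Qed.

Lemma modulusN z : modulus (- z) = modulus z.
Proof. exact: normcN. Qed.

Lemma modulusBC z w : modulus (z - w) = modulus (w - z).
Proof. by rewrite -opprB modulusN. Qed.

Lemma ler_modulusD z w : modulus (z + w) <= modulus z + modulus w.
Proof. exact: le_normcD. Qed.

Lemma ler_modulusB z w : modulus (z - w) <= modulus z + modulus w.
Proof. by rewrite -(modulusN w) ler_modulusD. Qed.

Lemma lerB_modulus z w : modulus z - modulus w <= modulus (z - w).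
Proof. by rewrite lerBlDr -{1}(subrK w z) ler_modulusD. Qed.

Lemma normc_modulus z : `|z| = (modulus z)%:C%C.
Proof. by []. Qed.

Lemma sqr_modulus z : modulus z ^+ 2 = Re z ^+ 2 + Im z ^+ 2.
Proof. by case: z => x y; rewrite /modulus /= sqr_sqrtr// addr_ge0// sqr_ge0. Qed.

Lemma Re_le_modulus z : `|Re z| <= modulus z.
Proof.
rewrite -(ler_pXn2r (n:=2))// ?nnegrE ?modulus_ge0// sqr_modulus.
by rewrite real_normK ?num_real// lerDl sqr_ge0.
Qed.

Lemma Im_le_modulus z : `|Im z| <= modulus z.
Proof.
rewrite -(ler_pXn2r (n:=2))// ?nnegrE ?modulus_ge0// sqr_modulus.
by rewrite real_normK ?num_real// lerDr sqr_ge0.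
Qed.

Lemma modulus_le_ReIm z : modulus z <= `|Re z| + `|Im z|.
Proof.
rewrite -(ler_pXn2r (n:=2))// ?nnegrE ?modulus_ge0// ?addr_ge0// sqr_modulus.
rewrite sqrrD !real_normK ?num_real// lerD2r lerDl mulrn_wge0// mulr_ge0.
Qed.

Lemma modulus_real (x : R) : modulus x%:C%C = `|x|.
Proof. by rewrite /modulus /= expr0n /= addr0 sqrtr_sqr. Qed.

Lemma modulus_i : modulus ('i%C : R[i]) = 1.
Proof. by rewrite /modulus /= expr0n /= add0r expr1n sqrtr1. Qed.

End Modulus.

(** Complex differentiability at a point, written with the real-valued modulus
so that the estimates below stay in the ordered field of reals. *)
Definition cdiff (R : realType) (f : R[i] -> R[i]) (z l : R[i]) : Prop :=
  forall e : R, 0 < e -> exists2 d : R, 0 < d & forall h, modulus h < d ->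
    modulus (f (z + h) - f z - l * h) <= e * modulus h.

Definition ccont (R : realType) (f : R[i] -> R[i]) (z : R[i]) : Prop :=
  forall e : R, 0 < e -> exists2 d : R, 0 < d & forall h, modulus h < d ->
    modulus (f (z + h) - f z) < e.

Section Differentiability.
Variable R : realType.
Implicit Types (f g : R[i] -> R[i]) (z l : R[i]).

Lemma gt0_complexP (e : R[i]) : 0 < e -> exists2 e' : R, 0 < e' & e = e'%:C%C.
Proof.
case: e => a b; rewrite ltcE /= => /andP[/eqP -> a0]; by exists a.
Qed.

Lemma derivable_cdiff f z :
  derivable (f : R[i]^o -> R[i]^o) z 1 -> cdiff f z (cderiv f z).
Proof.
move=> df e e0.
have E : (fun h : R[i] => h^-1 *: (((f : R[i]^o -> R[i]^o) \o shift z) (h *: (1 : R[i]^o)) - f z))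
   = (fun h => h^-1 * (f (h + z) - f z)).
  by apply/funext => h /=; rewrite [h%:A]mulr1.
have : h^-1 * (f (h + z) - f z) @[h --> (0 : R[i]^o)^'] --> (cderiv f z : R[i]^o).
  rewrite /cderiv derive1E /derive E; move: df; rewrite /derivable E.
  exact.
move/(@cvgrPdist_le _ (R[i]^o : pseudoMetricNormedZmodType R[i])) => /(_ e%:C%C).
rewrite ltcR => /(_ e0) /nbhs_ballP[d' /= /gt0_complexP[d d0 ->]] H.
exists d => // h hd.
have [->|h0] := eqVneq h 0; first by rewrite addr0 subrr mulr0 subr0 modulus0 mulr0.
have := H h; rewrite -ball_normE /ball_ /= sub0r normrN normc_modulus ltcR => /(_ hd h0).
rewrite normc_modulus lecR modulusBC => H'.
have -> : f (z + h) - f z - cderiv f z * h =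
   (h^-1 * (f (h + z) - f z) - cderiv f z) * h.
  by rewrite mulrBl mulrAC mulVf// mul1r addrC [z + h]addrC addrC.
by rewrite modulusM ler_wpM2r// modulus_ge0.
Qed.

Lemma cdiff_derivable f z l : cdiff f z l ->
  derivable (f : R[i]^o -> R[i]^o) z 1 /\ cderiv f z = l.
Proof.
move=> df.
have E : (fun h : R[i] => h^-1 *: (((f : R[i]^o -> R[i]^o) \o shift z) (h *: (1 : R[i]^o)) - f z))
   = (fun h => h^-1 * (f (h + z) - f z)).
  by apply/funext => h /=; rewrite [h%:A]mulr1.
have K : h^-1 * (f (h + z) - f z) @[h --> (0 : R[i]^o)^'] --> (l : R[i]^o).
  apply/(@cvgrPdist_le _ (R[i]^o : pseudoMetricNormedZmodType R[i])) => _ /gt0_complexP[e e0 ->].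
  have [d d0 H] := df e e0.
  apply/nbhs_ballP; exists d%:C%C; first by rewrite /= ltcR.
  move=> h; rewrite -ball_normE /ball_ /= sub0r normrN normc_modulus ltcR => hd h0.
  rewrite normc_modulus lecR modulusBC.
  have := H h hd.
  have -> : f (z + h) - f z - l * h =
     (h^-1 * (f (h + z) - f z) - l) * h.
    by rewrite mulrBl mulrAC mulVf// mul1r addrC [z + h]addrC addrC.
  by rewrite modulusM ler_pM2r// modulus_gt0.
split; first by rewrite /derivable E; apply/cvg_ex; exists l.
rewrite /cderiv derive1E /derive E. apply: (@cvg_lim _ (@norm_hausdorff _ (R[i]^o : normedModType R[i])) _ _ _ _ _ K).
Qed.

Lemma cdiff_ccont f z l : cdiff f z l -> ccont f z.
Proof.
move=> df e e0; have [d d0 H] := df 1 ltr01.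
have l0 := modulus_ge0 l.
have L0 : 0 < modulus l + 1 by rewrite ltr_wpDl.
exists (Num.min d (e / (2 * (modulus l + 1)))); first by rewrite lt_min d0 divr_gt0// mulr_gt0.
move=> h; rewrite lt_min => /andP[hd he].
have -> : f (z + h) - f z = (f (z + h) - f z - l * h) + l * h by rewrite subrK.
apply: le_lt_trans (ler_modulusD _ _) _.
rewrite modulusM; have := H h hd.
move: he; rewrite ltr_pdivlMr ?mulr_gt0//.
by move: (modulus_ge0 h); nra.
Qed.

Lemma eq_cdiff f g z l (d : R) : 0 < d -> (forall h, modulus h < d -> f (z + h) = g (z + h)) ->
  cdiff f z l -> cdiff g z l.
Proof.
move=> d0 fg df e e0; have [d' d'0 H] := df e e0.
exists (Num.min d d'); first by rewrite lt_min d0.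
move=> h; rewrite lt_min => /andP[hd hd'].
rewrite -fg// -{2}(addr0 z) -(fg 0) ?modulus0// addr0; exact: H.
Qed.

Lemma cdiff_cst c z : cdiff (fun=> c) z 0.
Proof.
move=> e e0; exists 1 => // h _.
by rewrite subrr mul0r subr0 modulus0 mulr_ge0 ?modulus_ge0 ?ltW.
Qed.

Lemma cdiff_id z : cdiff (fun w => w) z 1.
Proof.
move=> e e0; exists 1 => // h _.
by rewrite mul1r [z + h]addrC addrK subrr modulus0 mulr_ge0 ?modulus_ge0 ?ltW.
Qed.

Lemma cdiffD f g z l m : cdiff f z l -> cdiff g z m ->
  cdiff (fun w => f w + g w) z (l + m).
Proof.
move=> df dg e e0; have e20 : 0 < e / 2 by rewrite divr_gt0.
have [d d0 H] := df _ e20; have [d' d'0 H'] := dg _ e20.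
exists (Num.min d d'); first by rewrite lt_min d0.
move=> h; rewrite lt_min => /andP[hd hd'].
have -> : f (z + h) + g (z + h) - (f z + g z) - (l + m) * h =
  (f (z + h) - f z - l * h) + (g (z + h) - g z - m * h) by ring.
apply: le_trans (ler_modulusD _ _) _.
by have := H h hd; have := H' h hd'; lra.
Qed.

Lemma cdiffM f g z l m : cdiff f z l -> cdiff g z m ->
  cdiff (fun w => f w * g w) z (l * g z + f z * m).
Proof.
move=> df dg e e0.
have := cdiff_ccont df; move=> cf.
pose K := modulus (g z) + modulus (f z) + modulus m + 1.
have K0 : 0 < K by rewrite /K ltr_wpDl// !addr_ge0// modulus_ge0.
pose e' := Num.min (e / (4 * K)) 1.
have e'0 : 0 < e' by rewrite lt_min ltr01 divr_gt0// mulr_gt0.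
have e'1 : e' <= 1 by rewrite ge_min lexx orbT.
have e'K : e' * (4 * K) <= e by rewrite -ler_pdivlMr ?mulr_gt0// ge_min lexx.
have [d d0 H] := df _ e'0; have [d' d'0 H'] := dg _ e'0.
have [d'' d''0 H''] := cf _ e'0.
exists (Num.min d (Num.min d' d'')); first by rewrite !lt_min d0 d'0.
move=> h; rewrite !lt_min => /and3P[hd hd' hd''].
have -> : f (z + h) * g (z + h) - f z * g z - (l * g z + f z * m) * h =
  (f (z + h) - f z - l * h) * g z + f z * (g (z + h) - g z - m * h)
  + (f (z + h) - f z) * (g (z + h) - g z - m * h)
  + (f (z + h) - f z) * (m * h) by ring.
apply: le_trans (ler_modulusD _ _) _.
apply: le_trans (lerD (ler_modulusD _ _) (lexx _)) _.
apply: le_trans (lerD (lerD (ler_modulusD _ _) (lexx _)) (lexx _)) _.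
rewrite !modulusM.
have h0 := modulus_ge0 h.
have A := H h hd; have B := H' h hd'; have D := ltW (H'' h hd'').
have g0 := modulus_ge0 (g z); have f0 := modulus_ge0 (f z); have m0 := modulus_ge0 m.
set a := modulus (f (z + h) - f z - l * h) in A *.
set b := modulus (g (z + h) - g z - m * h) in B *.
set c := modulus (f (z + h) - f z) in D *.
have a0 : 0 <= a := modulus_ge0 _.
have b0 : 0 <= b := modulus_ge0 _.
have c0 : 0 <= c := modulus_ge0 _.
set t := modulus h in h0 A B *.
have T1 : a * modulus (g z) <= (e' * t) * K by apply: ler_pM => //; rewrite /K; lra.
have T2 : modulus (f z) * b <= K * (e' * t) by apply: ler_pM => //; rewrite /K; lra.
have T3 : c * b <= K * (e' * t).
  by apply: ler_pM => //; rewrite /K; lra.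
have T4 : c * (modulus m * t) <= e' * (K * t).
  by apply: ler_pM => //; rewrite ?mulr_ge0// ler_wpM2r// /K; lra.
have := ler_wpM2r h0 e'K; lra.
Qed.

Lemma cdiffZ f z l c : cdiff f z l -> cdiff (fun w => c * f w) z (c * l).
Proof.
move=> df; have := cdiffM (cdiff_cst c z) df; by rewrite mul0r add0r.
Qed.

Lemma cdiffN f z l : cdiff f z l -> cdiff (fun w => - f w) z (- l).
Proof.
by move=> /(cdiffZ (-1)) H e /H[d d0 {}H]; exists d => // h /H; rewrite !mulN1r.
Qed.

Lemma cdiffB f g z l m : cdiff f z l -> cdiff g z m ->
  cdiff (fun w => f w - g w) z (l - m).
Proof. by move=> df dg; apply: cdiffD => //; apply: cdiffN. Qed.

Lemma cdiff_inv z : z != 0 -> cdiff (fun w : R[i] => w^-1) z (- z ^- 2).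
Proof.
move=> z0 e e0; have m0 := modulus_gt0 z0.
pose m := modulus z.
exists (Num.min (m / 2) (e * m ^+ 3 / 2)).
  by rewrite lt_min !divr_gt0// mulr_gt0// exprn_gt0.
move=> h; rewrite lt_min => /andP[h1 h2].
have hz : m / 2 <= modulus (z + h).
  by have := lerB_modulus z (- h); rewrite opprK modulusN -/m; lra.
have zh0 : z + h != 0.
  by apply/eqP => E; move: hz; rewrite E modulus0 /m; lra.
have -> : (z + h)^-1 - z^-1 - - z ^- 2 * h = h ^+ 2 * (z + h)^-1 * z ^- 2.
  by field; rewrite z0 zh0.
rewrite !modulusM !modulusV !modulusX -/m -mulrA -invfM.
have r0 : 0 < modulus (z + h) by rewrite modulus_gt0.
rewrite ler_pdivrMr; last by rewrite mulr_gt0// exprn_gt0.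
have t0 := modulus_ge0 h; move: h2 hz r0; set t := modulus h in t0 *.
set r := modulus (z + h) => h2 hz r0.
have -> : e * t * (r * m ^+ 2) = t * (e * (r * m ^+ 2)) by ring.
rewrite expr2 ler_wpM2l// (le_trans (ltW h2))// -mulrA ler_wpM2l ?(ltW e0)//.
by rewrite exprS mulrAC ler_wpM2r// sqr_ge0.
Qed.
End Differentiability.

(** * Integrals of complex functions over segments *)

Definition cint (R : realType) (a b : R) (u : R -> R[i]) : R[i] :=
  Complex (\int[mu]_(x in `[a, b]) Re (u x)) (\int[mu]_(x in `[a, b]) Im (u x)).

(** Continuity is two-sided, also at the end points: the segments of interest
are edges of rectangles inside an open set where the integrand is continuous. *)
Definition pcont (R : realType) (a b : R) (u : R -> R[i]) : Prop :=
  forall x, a <= x <= b -> forall e : R, 0 < e ->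
  exists2 d : R, 0 < d & forall k, `|k| < d -> modulus (u (x + k) - u x) < e.

Section SegmentIntegral.
Variable R : realType.
Implicit Types (a b c : R) (u v : R -> R[i]).

Lemma ReD (z w : R[i]) : Re (z + w) = Re z + Re w.
Proof. by case: z w => ? ? []. Qed.

Lemma ImD (z w : R[i]) : Im (z + w) = Im z + Im w.
Proof. by case: z w => ? ? []. Qed.

Lemma ReB (z w : R[i]) : Re (z - w) = Re z - Re w.
Proof. by case: z w => ? ? []. Qed.

Lemma ImB (z w : R[i]) : Im (z - w) = Im z - Im w.
Proof. by case: z w => ? ? []. Qed.

Lemma continuous_at_epsdelta (u : R -> R) x :
  (forall e, 0 < e -> exists2 d, 0 < d & forall k, `|k| < d -> `|u (x + k) - u x| < e) ->
  {for x, continuous u}.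
Proof.
move=> H; apply/cvgrPdist_lt => e /H[d d0 {}H]; near=> y.
rewrite distrC -{1}(subrK x y) [_ + x]addrC; apply: H.
by near: y; apply/nbhs_ballP; exists d => //= y; rewrite /ball /= distrC.
Unshelve. all: by end_near. Qed.

Lemma pcontRe a b u : pcont a b u -> {in `[a, b], continuous (fun x => Re (u x))}.
Proof.
move=> cu x; rewrite in_itv /= => xab; apply: continuous_at_epsdelta => e e0.
have [d d0 H] := cu x xab e e0; exists d => // k /H; apply: le_lt_trans.
by rewrite -ReB Re_le_modulus.
Qed.

Lemma pcontIm a b u : pcont a b u -> {in `[a, b], continuous (fun x => Im (u x))}.
Proof.
move=> cu x; rewrite in_itv /= => xab; apply: continuous_at_epsdelta => e e0.
have [d d0 H] := cu x xab e e0; exists d => // k /H; apply: le_lt_trans.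
by rewrite -ImB Im_le_modulus.
Qed.

Lemma in_continuous_within a b (w : R -> R) :
  {in `[a, b], continuous w} -> {within `[a, b], continuous w}.
Proof. by move=> cw; apply: continuous_in_subspaceT => x /set_mem; exact: cw. Qed.

Lemma continuous_integrable a b (w : R -> R) :
  {in `[a, b], continuous w} -> (@mu R).-integrable `[a, b] (EFin \o w).
Proof.
move=> cw; apply: continuous_compact_integrable; first exact: segment_compact.
exact: in_continuous_within.
Qed.

Lemma pcontZ a b (c : R[i]) u : pcont a b u -> pcont a b (fun x => c * u x).
Proof.
move=> cu x xab e e0; have c0 := modulus_ge0 c.
have K0 : 0 < modulus c + 1 by lra.
have [d d0 H] := cu x xab (e / (modulus c + 1)) (divr_gt0 e0 K0).
exists d => // k /H {}H; rewrite -mulrBr modulusM.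
move: H; rewrite ltr_pdivlMr//; have := modulus_ge0 (u (x + k) - u x); nra.
Qed.

Lemma cintD a b u v : pcont a b u -> pcont a b v ->
  cint a b (fun x => u x + v x) = cint a b u + cint a b v.
Proof.
move=> cu cv; rewrite /cint; apply/eqP; rewrite eq_complex; apply/andP; split => /=; apply/eqP.
- under eq_Rintegral do rewrite ReD.
  by rewrite RintegralD//; apply: continuous_integrable; exact: pcontRe.
- under eq_Rintegral do rewrite ImD.
  by rewrite RintegralD//; apply: continuous_integrable; exact: pcontIm.
Qed.

Lemma cintZ a b (c : R[i]) u : pcont a b u -> cint a b (fun x => c * u x) = c * cint a b u.
Proof.
move=> cu; have iR := continuous_integrable (pcontRe cu).
have iI := continuous_integrable (pcontIm cu).
have intZ k (w : R -> R) : (@mu R).-integrable `[a, b] (EFin \o w) ->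
    (@mu R).-integrable `[a, b] (EFin \o (fun x => k * w x)).
  by move=> iw; apply: (integrableZl _ k iw).
case: c => p q; rewrite /cint; apply/eqP; rewrite eq_complex; apply/andP; split => /=; apply/eqP.
- rewrite -!RintegralZl// -RintegralB//; try exact: intZ.
  by apply: eq_Rintegral => x _; case: (u x).
- rewrite -!RintegralZl// -RintegralD//; try exact: intZ.
  by apply: eq_Rintegral => x _; case: (u x).
Qed.

Lemma eq_cint a b u v : (forall x, a <= x <= b -> u x = v x) -> cint a b u = cint a b v.
Proof.
by move=> uv; rewrite /cint; congr Complex; apply: eq_Rintegral => x;
  rewrite inE /= in_itv /= => /uv ->.
Qed.

Lemma cint_split a b c u : pcont a b u -> a <= c <= b ->
  cint a b u = cint a c u + cint c b u.
Proof.
move=> cu /andP[ac cb].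
have S (w : R -> R) : (@mu R).-integrable `[a, b] (EFin \o w) ->
  \int[mu]_(x in `[a, b]) w x = \int[mu]_(x in `[a, c]) w x + \int[mu]_(x in `[c, b]) w x.
  move=> iw; have := @Rintegral_itvB R w (BLeft a) (BRight b) c iw.
  rewrite !bnd_simp => /(_ ac cb) E.
  have iw' : (@mu R).-integrable `]c, b] (EFin \o w).
    by apply: integrableS iw => //; apply: subset_itvr; rewrite bnd_simp.
  have := Rintegral_itv_obnd_cbnd iw'; rewrite -E => <-.
  by rewrite addrC subrK.
by rewrite /cint /= !S//; apply: continuous_integrable; [exact: pcontIm|exact: pcontRe].
Qed.

Lemma pcont_modulus a b u : pcont a b u ->
  {in `[a, b], continuous (fun x => modulus (u x))}.
Proof.
move=> cu x; rewrite in_itv /= => xab; apply: continuous_at_epsdelta => e e0.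
have [d d0 H] := cu x xab e e0; exists d => // k /H; apply: le_lt_trans.
rewrite ler_norml lerB_modulus andbT.
by rewrite lerNl opprB modulusBC lerB_modulus.
Qed.

Lemma continuous_measurable_itv a b (w : R -> R) :
  {in `[a, b], continuous w} -> measurable_fun `[a, b] w.
Proof.
move=> cw; apply: subspace_continuous_measurable_fun => //.
exact: in_continuous_within.
Qed.

Lemma cint_le_int a b u : pcont a b u ->
  ((modulus (cint a b u))%:E <= 2%:E * \int[mu]_(x in `[a, b]) (modulus (u x))%:E)%E.
Proof.
move=> cu; have mm := continuous_measurable_itv (pcont_modulus cu).
have S (w : R -> R) : {in `[a, b], continuous w} -> (forall x, `|w x| <= modulus (u x)) ->
  ((`|\int[mu]_(x in `[a, b]) w x|)%:E <= \int[mu]_(x in `[a, b]) (modulus (u x))%:E)%E.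
  move=> cw wu; have iw := continuous_integrable cw.
  rewrite EFin_normr_Rintegral//; apply: le_trans; first by apply: le_abse_integral => //; apply: measurable_int iw.
  apply: ge0_le_integral => //.
  - by apply: measurableT_comp => //; apply: measurable_int iw.
  - exact/measurable_EFinP.
  - by move=> x _ /=; rewrite lee_fin.
rewrite mule_natl mule2n.
apply: le_trans (leeD (S _ (pcontRe cu) (fun x => Re_le_modulus _))
  (S _ (pcontIm cu) (fun x => Im_le_modulus _))).
by rewrite -EFinD lee_fin; apply: modulus_le_ReIm.
Qed.

Lemma cint_bound a b u M : a <= b -> pcont a b u ->
  (forall x, a <= x <= b -> modulus (u x) <= M) -> modulus (cint a b u) <= 2 * M * (b - a).
Proof.
move=> ab cu uM; rewrite -lee_fin; apply: le_trans (cint_le_int cu) _.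
have mm := continuous_measurable_itv (pcont_modulus cu).
rewrite -mulrA EFinM lee_pmul2l//.
apply: (@le_trans _ _ (\int[mu]_(x in `[a, b]) M%:E)%E).
  apply: ge0_le_integral => //.
    by move=> x _; rewrite lee_fin modulus_ge0.
  exact/measurable_EFinP.
rewrite integral_cst//= lebesgue_measure_itv/= lte_fin.
case: ifPn => [ab'|]; first by rewrite -EFinD -EFinM.
rewrite mule0 lee_fin -leNgt => ba; apply: mulr_ge0; last by rewrite subr_ge0.
by apply: le_trans (uM a _); rewrite ?modulus_ge0// lexx.
Qed.

Lemma real_FTC a b (f F : R -> R) : a <= b -> {in `[a, b], continuous f} ->
  (forall x, a <= x <= b -> forall e, 0 < e -> exists2 d, 0 < d & forall k, `|k| < d ->
      `|F (x + k) - F x - f x * k| <= e * `|k|) ->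
  \int[mu]_(x in `[a, b]) f x = F b - F a.
Proof.
rewrite le_eqVlt => /predU1P[<-|ab] cf dF.
  by rewrite set_itv1 Rintegral_set1 subrr.
have D x : a <= x <= b -> derivable F x 1 /\ derive1 F x = f x.
  move=> xab.
  have E : (fun h : R => h^-1 *: ((F \o shift x) (h *: 1) - F x))
    = (fun h => h^-1 * (F (h + x) - F x)).
    by apply/funext => h /=; rewrite [h%:A]mulr1.
  have K : h^-1 * (F (h + x) - F x) @[h --> 0^'] --> f x.
    apply/cvgrPdist_le => e e0; have [d d0 H] := dF x xab e e0.
    apply/nbhs_ballP; exists d => // h; rewrite /ball /= sub0r normrN => hd h0.
    rewrite distrC; have := H h hd.
    have -> : F (x + h) - F x - f x * h = (h^-1 * (F (h + x) - F x) - f x) * h.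
      by rewrite mulrBl mulrAC mulVf// mul1r addrC [x + h]addrC addrC.
    by rewrite normrM ler_pM2r// normr_gt0.
  split; first by rewrite /derivable E; apply/cvg_ex; exists (f x).
  by rewrite derive1E /derive E; apply/cvg_lim.
have C x : a <= x <= b -> {for x, continuous F}.
  by move=> /D[/derivable1_diffP/differentiable_continuous + _].
rewrite /Rintegral (@continuous_FTC2 _ f F)//.
- exact: in_continuous_within.
- split.
  + by move=> x; rewrite in_itv /= => /andP[/ltW ax /ltW xb]; apply: (D x _).1; rewrite ax.
  + by apply: cvg_at_right_filter; apply: C; rewrite lexx ltW.
  + by apply: cvg_at_left_filter; apply: C; rewrite lexx ltW.
- by move=> x; rewrite in_itv /= => /andP[/ltW ax /ltW xb]; apply: (D x _).2; rewrite ax.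
Qed.

Lemma cint_FTC a b u v : a <= b -> pcont a b u ->
  (forall x, a <= x <= b -> forall e, 0 < e -> exists2 d, 0 < d & forall k, `|k| < d ->
      modulus (v (x + k) - v x - u x * k%:C%C) <= e * `|k|) ->
  cint a b u = v b - v a.
Proof.
move=> ab cu dv; rewrite /cint (@real_FTC _ _ _ (fun x => Re (v x)))//; first last.
- move=> x xab e e0; have [d d0 H] := dv x xab e e0; exists d => // k /H.
  apply: le_trans; apply: le_trans (Re_le_modulus _).
  by rewrite !ReB; case: (u x) => p q /=; rewrite mulr0 subr0.
- exact: pcontRe.
rewrite (@real_FTC _ _ _ (fun x => Im (v x)))//; first last.
- move=> x xab e e0; have [d d0 H] := dv x xab e e0; exists d => // k /H.
  apply: le_trans; apply: le_trans (Im_le_modulus _).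
  by rewrite !ImB; case: (u x) => p q /=; rewrite mulr0 add0r.
- exact: pcontIm.
by rewrite -ReB -ImB; case: (v b - v a).
Qed.

End SegmentIntegral.

(** * Contour integrals over rectangles *)

Local Open Scope complex_scope.

Definition box (R : realType) (x1 x2 y1 y2 : R) : set R[i] :=
  [set z | x1 <= Re z <= x2 /\ y1 <= Im z <= y2].

Definition frame (R : realType) (x1 x2 y1 y2 : R) : set R[i] :=
  [set z | box x1 x2 y1 y2 z /\
     [\/ Re z = x1, Re z = x2, Im z = y1 | Im z = y2]].

(** The contour integral over the counterclockwise boundary of a rectangle. *)
Definition frame_int (R : realType) (f : R[i] -> R[i]) (x1 x2 y1 y2 : R) : R[i] :=
  cint x1 x2 (fun x => f (x +i* y1)) + 'i * cint y1 y2 (fun y => f (x2 +i* y))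
  - cint x1 x2 (fun x => f (x +i* y2)) - 'i * cint y1 y2 (fun y => f (x1 +i* y)).

Section Frames.
Variable R : realType.
Implicit Types (f g : R[i] -> R[i]) (z l : R[i]).

Lemma frame_box (x1 x2 y1 y2 : R) z : frame x1 x2 y1 y2 z -> box x1 x2 y1 y2 z.
Proof. by case. Qed.

Lemma ccont_pcont_horizontal f (y x1 x2 : R) :
  (forall x, x1 <= x <= x2 -> ccont f (x +i* y)) -> pcont x1 x2 (fun x => f (x +i* y)).
Proof.
move=> cf x xab e e0; have [d d0 H] := cf x xab e e0; exists d => // k kd.
have -> : (x + k) +i* y = x +i* y + k%:C by congr Complex; rewrite addr0.
by apply: H; rewrite modulus_real.
Qed.

Lemma ccont_pcont_vertical f (x y1 y2 : R) :
  (forall y, y1 <= y <= y2 -> ccont f (x +i* y)) -> pcont y1 y2 (fun y => f (x +i* y)).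
Proof.
move=> cf y yab e e0; have [d d0 H] := cf y yab e e0; exists d => // k kd.
have -> : x +i* (y + k) = x +i* y + 'i * k%:C.
  by apply/eqP; rewrite eq_complex /= !mul0r !mul1r subr0 !addr0 add0r !eqxx.
by apply: H; rewrite modulusM modulus_i mul1r modulus_real.
Qed.

Section OneFrame.
Variables x1 x2 y1 y2 : R.
Hypotheses (x12 : x1 <= x2) (y12 : y1 <= y2).
Let F := frame x1 x2 y1 y2.

Lemma frame_bottom (x : R) : x1 <= x <= x2 -> F (x +i* y1).
Proof. by move=> xx; split; [split; rewrite //= lexx|apply: Or43]. Qed.

Lemma frame_top (x : R) : x1 <= x <= x2 -> F (x +i* y2).
Proof. by move=> xx; split; [split; rewrite //= lexx andbT|apply: Or44]. Qed.

Lemma frame_left (y : R) : y1 <= y <= y2 -> F (x1 +i* y).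
Proof. by move=> xx; split; [split; rewrite //= lexx|apply: Or41]. Qed.

Lemma frame_right (y : R) : y1 <= y <= y2 -> F (x2 +i* y).
Proof. by move=> xx; split; [split; rewrite //= lexx andbT|apply: Or42]. Qed.

Lemma frame_pcont f : (forall z, F z -> ccont f z) ->
  [/\ pcont x1 x2 (fun x => f (x +i* y1)), pcont y1 y2 (fun y => f (x2 +i* y)),
      pcont x1 x2 (fun x => f (x +i* y2)) & pcont y1 y2 (fun y => f (x1 +i* y))].
Proof.
move=> cf; split.
- by apply: ccont_pcont_horizontal => x /frame_bottom /cf.
- by apply: ccont_pcont_vertical => x /frame_right /cf.
- by apply: ccont_pcont_horizontal => x /frame_top /cf.
- by apply: ccont_pcont_vertical => x /frame_left /cf.
Qed.

Lemma frame_intZ f c : (forall z, F z -> ccont f z) ->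
  frame_int (fun z => c * f z) x1 x2 y1 y2 = c * frame_int f x1 x2 y1 y2.
Proof.
by move=> /frame_pcont[? ? ? ?]; rewrite /frame_int !cintZ//; ring.
Qed.

Lemma frame_intB f g : (forall z, F z -> ccont f z) -> (forall z, F z -> ccont g z) ->
  frame_int (fun z => f z - g z) x1 x2 y1 y2 =
  frame_int f x1 x2 y1 y2 - frame_int g x1 x2 y1 y2.
Proof.
move=> /frame_pcont[? ? ? ?] /frame_pcont[? ? ? ?]; rewrite /frame_int.
have B a b u v : pcont a b u -> pcont a b v ->
    cint a b (fun x => u x - v x) = cint a b u - cint a b v.
  move=> cu cv; rewrite -mulN1r -cintZ// -cintD//; last exact: pcontZ.
  by apply: eq_cint => x _; rewrite mulN1r.
by rewrite !B//; ring.
Qed.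

Lemma eq_frame_int f g : (forall z, F z -> f z = g z) ->
  frame_int f x1 x2 y1 y2 = frame_int g x1 x2 y1 y2.
Proof.
move=> fg; rewrite /frame_int; congr (_ + 'i * _ - _ - 'i * _); apply: eq_cint => t tt; apply: fg.
- exact: frame_bottom.
- exact: frame_right.
- exact: frame_top.
- exact: frame_left.
Qed.

Lemma frame_int_bound f M : (forall z, F z -> ccont f z) ->
  (forall z, F z -> modulus (f z) <= M) ->
  modulus (frame_int f x1 x2 y1 y2) <= 4 * M * ((x2 - x1) + (y2 - y1)).
Proof.
move=> /frame_pcont[c1 c2 c3 c4] fM; rewrite /frame_int.
apply: le_trans (ler_modulusB _ _) _.
apply: le_trans (lerD (ler_modulusB _ _) (lexx _)) _.
apply: le_trans (lerD (lerD (ler_modulusD _ _) (lexx _)) (lexx _)) _.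
rewrite !modulusM !modulus_i !mul1r.
have := cint_bound x12 c1 (fun x hx => fM _ (frame_bottom hx)).
have := cint_bound y12 c2 (fun x hx => fM _ (frame_right hx)).
have := cint_bound x12 c3 (fun x hx => fM _ (frame_top hx)).
have := cint_bound y12 c4 (fun x hx => fM _ (frame_left hx)).
lra.
Qed.

Lemma frame_int_primitive f g : (forall z, F z -> ccont g z) ->
  (forall z, F z -> cdiff f z (g z)) -> frame_int g x1 x2 y1 y2 = 0.
Proof.
move=> cg dg; have [c1 c2 c3 c4] := frame_pcont cg.
have horizontal (y : R) : (forall x, x1 <= x <= x2 -> F (x +i* y)) ->
    pcont x1 x2 (fun x => g (x +i* y)) ->
    cint x1 x2 (fun x => g (x +i* y)) = f (x2 +i* y) - f (x1 +i* y).
  move=> Fy cy; apply: (@cint_FTC _ _ _ _ (fun x => f (x +i* y))) => //.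
  move=> x /Fy /dg dx e e0; have [d d0 H] := dx e e0; exists d => // k kd.
  have -> : (x + k) +i* y = x +i* y + k%:C by congr Complex; rewrite addr0.
  by rewrite -[in leRHS](modulus_real k); apply: H; rewrite modulus_real.
have vertical (x : R) : (forall y, y1 <= y <= y2 -> F (x +i* y)) ->
    pcont y1 y2 (fun y => g (x +i* y)) ->
    'i * cint y1 y2 (fun y => g (x +i* y)) = f (x +i* y2) - f (x +i* y1).
  move=> Fy cy; rewrite -cintZ//.
  apply: (@cint_FTC _ _ _ _ (fun y => f (x +i* y))) => //; first exact: pcontZ.
  move=> y /Fy /dg dx e e0; have [d d0 H] := dx e e0; exists d => // k kd.
  have -> : x +i* (y + k) = x +i* y + 'i * k%:C.
    by apply/eqP; rewrite eq_complex /= !mul0r !mul1r subr0 !addr0 add0r !eqxx.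
  have M : modulus ('i * k%:C) = `|k| by rewrite modulusM modulus_i mul1r modulus_real.
  have -> : 'i * g (x +i* y) * k%:C = g (x +i* y) * ('i * k%:C) by ring.
  by rewrite -[in leRHS]M; apply: H; rewrite M.
rewrite /frame_int !horizontal ?vertical//; first by ring.
all: by [exact: frame_left|exact: frame_right|exact: frame_top|exact: frame_bottom].
Qed.

End OneFrame.

Lemma frame_int_splitx f (x1 c x2 y1 y2 : R) : x1 <= c <= x2 -> y1 <= y2 ->
  (forall z, frame x1 x2 y1 y2 z -> ccont f z) ->
  frame_int f x1 x2 y1 y2 = frame_int f x1 c y1 y2 + frame_int f c x2 y1 y2.
Proof.
move=> /andP[x1c cx2] y12 cf; have x12 := le_trans x1c cx2.
have [? ? ? ?] := frame_pcont x12 y12 cf.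
rewrite /frame_int (@cint_split _ x1 x2 c (fun x => f (x +i* y1)))// ?x1c//.
by rewrite (@cint_split _ x1 x2 c (fun x => f (x +i* y2)))// ?x1c//; ring.
Qed.

Lemma frame_int_splity f (x1 x2 y1 c y2 : R) : x1 <= x2 -> y1 <= c <= y2 ->
  (forall z, frame x1 x2 y1 y2 z -> ccont f z) ->
  frame_int f x1 x2 y1 y2 = frame_int f x1 x2 y1 c + frame_int f x1 x2 c y2.
Proof.
move=> x12 /andP[y1c cy2] cf; have y12 := le_trans y1c cy2.
have [? ? ? ?] := frame_pcont x12 y12 cf.
rewrite /frame_int (@cint_split _ y1 y2 c (fun y => f (x1 +i* y)))// ?y1c//.
by rewrite (@cint_split _ y1 y2 c (fun y => f (x2 +i* y)))// ?y1c//; ring.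
Qed.

End Frames.

(** * Goursat's theorem *)

Section Bisection.
Variable R : realType.

Lemma nested_segments (a b : nat -> R) : (forall n, a n <= a n.+1) ->
  (forall n, b n.+1 <= b n) -> (forall n, a n <= b n) ->
  exists p, forall n, a n <= p <= b n.
Proof.
move=> ia db ab.
have ha n m : (n <= m)%N -> a n <= a m.
  move=> /subnKC <-; elim: (m - n)%N => [|k IH]; first by rewrite addn0.
  by rewrite addnS (le_trans IH).
have hb n m : (n <= m)%N -> b m <= b n.
  move=> /subnKC <-; elim: (m - n)%N => [|k IH]; first by rewrite addn0.
  by rewrite addnS (le_trans (db _)).
have abnm n m : a n <= b m.
  apply: le_trans (ha _ _ (leq_maxl n m)) _; apply: le_trans (ab _) _.
  exact: hb (leq_maxr n m).
exists (sup (range a)) => n; apply/andP; split.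
  apply: ub_le_sup; last by exists n.
  by exists (b 0%N) => _ [m _ <-].
apply: ge_sup; first by exists (a 0%N); exists 0%N.
by move=> _ [m _ <-].
Qed.

Lemma exists_small_half_power (w d : R) : 0 < d -> exists n, w / 2 ^+ n < d.
Proof.
move=> d0; exists (Num.bound (`|w| / d)).
rewrite ltr_pdivrMr ?exprn_gt0// mulrC -ltr_pdivrMr//.
apply: (@le_lt_trans _ _ (`|w| / d)); first by rewrite ler_wpM2r ?ler_norm// invr_ge0 ltW.
apply: lt_le_trans (archi_boundP _) _; first by rewrite divr_ge0// ltW.
by rewrite -natrX ler_nat ltnW// ltn_expl.
Qed.

Lemma midpointP (a b : R) : a <= b -> [/\ a <= (a + b) / 2, (a + b) / 2 <= b,
  (a + b) / 2 - a = (b - a) / 2 & b - (a + b) / 2 = (b - a) / 2].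
Proof. by move=> ab; split; lra. Qed.

(** If a rectangle is not good, some quarter of it is not good either, and
repeating this gives nested rectangles that are not good and shrink to a point,
against goodness of the small rectangles around that point. *)
Lemma rectangle_bisection (good : R -> R -> R -> R -> Prop) (X1 X2 Y1 Y2 : R) :
  X1 <= X2 -> Y1 <= Y2 ->
  (forall x1 x2 y1 y2, X1 <= x1 -> x1 <= x2 -> x2 <= X2 ->
     Y1 <= y1 -> y1 <= y2 -> y2 <= Y2 ->
     good x1 ((x1 + x2) / 2) y1 ((y1 + y2) / 2) ->
     good ((x1 + x2) / 2) x2 y1 ((y1 + y2) / 2) ->
     good x1 ((x1 + x2) / 2) ((y1 + y2) / 2) y2 ->
     good ((x1 + x2) / 2) x2 ((y1 + y2) / 2) y2 -> good x1 x2 y1 y2) ->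
  (forall p, box X1 X2 Y1 Y2 p -> exists2 d : R, 0 < d & forall x1 x2 y1 y2,
     X1 <= x1 -> x2 <= X2 -> Y1 <= y1 -> y2 <= Y2 ->
     box x1 x2 y1 y2 p -> x2 - x1 < d -> y2 - y1 < d -> good x1 x2 y1 y2) ->
  good X1 X2 Y1 Y2.
Proof.
move=> X12 Y12 step loc; apply: contrapT => bad0.
pose T : Type := ((R * R) * (R * R))%type.
pose G (t : T) := good t.1.1 t.1.2 t.2.1 t.2.2.
pose I (t : T) := [/\ X1 <= t.1.1, t.1.1 <= t.1.2 & t.1.2 <= X2] /\
                  [/\ Y1 <= t.2.1, t.2.1 <= t.2.2 & t.2.2 <= Y2].
pose N (t t' : T) := [/\ I t', ~ G t', t.1.1 <= t'.1.1 /\ t'.1.2 <= t.1.2,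
  t.2.1 <= t'.2.1 /\ t'.2.2 <= t.2.2 &
  t'.1.2 - t'.1.1 = (t.1.2 - t.1.1) / 2 /\ t'.2.2 - t'.2.1 = (t.2.2 - t.2.1) / 2].
have next (t : T) : exists t', I t -> ~ G t -> N t t'.
  case: (pselect (I t /\ ~ G t)) => [[It Gt]|n]; last by exists t => It Gt; case: n.
  apply: contrapT => nt; apply: Gt.
  case: t It nt => [[x1 x2] [y1 y2]] It nt; case: (It) => -[/= xa xb xc] [ya yb yc].
  have [m1 m2 m3 m4] := midpointP xb; have [n1 n2 n3 n4] := midpointP yb.
  have [xc1 xc2] := (le_trans xa m1, le_trans m2 xc).
  have [yc1 yc2] := (le_trans ya n1, le_trans n2 yc).
  apply: step => //; apply: contrapT => bad; apply: nt.
  - by exists ((x1, (x1 + x2) / 2), (y1, (y1 + y2) / 2)).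
  - by exists (((x1 + x2) / 2, x2), (y1, (y1 + y2) / 2)).
  - by exists ((x1, (x1 + x2) / 2), ((y1 + y2) / 2, y2)).
  - by exists (((x1 + x2) / 2, x2), ((y1 + y2) / 2, y2)).
have [nx nxP] := choice next.
pose u n := iter n nx ((X1, X2), (Y1, Y2)).
have uI n : I (u n) /\ ~ G (u n).
  elim: n => [|n [h1 h2]]; first by split=> //; split; split => /=.
  by have [] := nxP _ h1 h2.
have uN n : N (u n) (u n.+1) by have [h1 h2] := uI n; exact: nxP.
have [px pxP] : exists p, forall n, (u n).1.1 <= p <= (u n).1.2.
  apply: nested_segments => n; last by have [[[]]] := uI n.
  - by have [_ _ []] := uN n.
  - by have [_ _ []] := uN n.
have [py pyP] : exists p, forall n, (u n).2.1 <= p <= (u n).2.2.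
  apply: nested_segments => n; last by have [[_ []]] := uI n.
  - by have [_ _ _ []] := uN n.
  - by have [_ _ _ []] := uN n.
have wx n : (u n).1.2 - (u n).1.1 = (X2 - X1) / 2 ^+ n.
  elim: n => [|n IH]; first by rewrite expr0 divr1.
  by have [_ _ _ _ [-> _]] := uN n; rewrite IH exprSr invfM mulrA.
have wy n : (u n).2.2 - (u n).2.1 = (Y2 - Y1) / 2 ^+ n.
  elim: n => [|n IH]; first by rewrite expr0 divr1.
  by have [_ _ _ _ [_ ->]] := uN n; rewrite IH exprSr invfM mulrA.
have [d d0 H] := loc (px +i* py) (conj (pxP 0%N) (pyP 0%N)).
have [n nd] := exists_small_half_power ((X2 - X1) + (Y2 - Y1)) d0.
have [[[h1 h2 h3] [h4 h5 h6]] h7] := uI n; apply: h7.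
have P0 : 0 < 2 ^- n :> R by rewrite invr_gt0 exprn_gt0.
apply: H => //.
- by apply: le_lt_trans nd; rewrite wx ler_pM2r//; lra.
- by apply: le_lt_trans nd; rewrite wy ler_pM2r//; lra.
Qed.

End Bisection.

Definition holo (R : realType) (f : R[i] -> R[i]) (z : R[i]) : Prop :=
  exists l, cdiff f z l.

Section Cauchy.
Variable R : realType.
Implicit Types (f g : R[i] -> R[i]) (z l : R[i]).

Lemma holo_ccont f z : holo f z -> ccont f z.
Proof. by case=> l /cdiff_ccont. Qed.

Lemma sub_box (X1 X2 Y1 Y2 x1 x2 y1 y2 : R) : X1 <= x1 -> x2 <= X2 ->
  Y1 <= y1 -> y2 <= Y2 -> box x1 x2 y1 y2 `<=` box X1 X2 Y1 Y2.
Proof. by move=> a b c d z [/andP[e f] /andP[g h]]; split; apply/andP; split; lra. Qed.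

Lemma box_diameter (x1 x2 y1 y2 : R) z w : box x1 x2 y1 y2 z -> box x1 x2 y1 y2 w ->
  modulus (w - z) <= (x2 - x1) + (y2 - y1).
Proof.
move=> [/andP[a b] /andP[c d]] [/andP[a' b'] /andP[c' d']].
apply: le_trans (modulus_le_ReIm _) _; rewrite ReB ImB.
by apply: lerD; rewrite ler_distl; apply/andP; split; lra.
Qed.

(** The affine part of f at a point has a primitive, so it contributes nothing to
a contour integral; the remainder is o(diam) on a contour of length O(diam).
Small rectangles thus contribute o(diam^2), a bound that survives bisection. *)
Theorem goursat f (X1 X2 Y1 Y2 : R) : X1 <= X2 -> Y1 <= Y2 ->
  (forall z, box X1 X2 Y1 Y2 z -> holo f z) -> frame_int f X1 X2 Y1 Y2 = 0.
Proof.
move=> X12 Y12 hf.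
have sf x1 x2 y1 y2 : X1 <= x1 -> x2 <= X2 -> Y1 <= y1 -> y2 <= Y2 ->
    forall z, frame x1 x2 y1 y2 z -> ccont f z.
  move=> a b c d z /frame_box Hz; apply: holo_ccont; apply: hf.
  exact: sub_box Hz.
have K e : 0 < e ->
    modulus (frame_int f X1 X2 Y1 Y2) <= e * ((X2 - X1) ^+ 2 + (Y2 - Y1) ^+ 2).
  move=> e0; pose good (x1 x2 y1 y2 : R) :=
    modulus (frame_int f x1 x2 y1 y2) <= e * ((x2 - x1) ^+ 2 + (y2 - y1) ^+ 2).
  apply: (@rectangle_bisection _ good) => //.
    move=> x1 x2 y1 y2 a1 a2 a3 b1 b2 b3; rewrite /good.
    set c := (x1 + x2) / 2; set d := (y1 + y2) / 2 => g1 g2 g3 g4.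
    have [hc1 hc2 _ _] := midpointP a2; have [hd1 hd2 _ _] := midpointP b2.
    rewrite -/c in hc1 hc2; rewrite -/d in hd1 hd2.
    have hc : x1 <= c <= x2 by rewrite hc1.
    have hd : y1 <= d <= y2 by rewrite hd1.
    rewrite (frame_int_splitx hc)//; last exact: sf.
    rewrite (@frame_int_splity _ f x1 c y1 d y2)//; last by apply: sf => //; exact: le_trans a3.
    rewrite (@frame_int_splity _ f c x2 y1 d y2)//; last by apply: sf => //; exact: le_trans hc1.
    apply: le_trans (ler_modulusD _ _) _.
    apply: le_trans (lerD (ler_modulusD _ _) (ler_modulusD _ _)) _.
    have -> : e * ((x2 - x1) ^+ 2 + (y2 - y1) ^+ 2) =
      e * ((c - x1) ^+ 2 + (d - y1) ^+ 2) + e * ((c - x1) ^+ 2 + (y2 - d) ^+ 2)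
      + (e * ((x2 - c) ^+ 2 + (d - y1) ^+ 2) + e * ((x2 - c) ^+ 2 + (y2 - d) ^+ 2)).
      by rewrite /c /d; field.
    by apply: lerD; apply: lerD.
  (* small rectangles around p: 8 = 4 (bound on the contour integral) * 2 *)
  move=> p Hp; have [l dl] := hf p Hp.
  have e8 : 0 < e / 8 by rewrite divr_gt0.
  have [d d0 H] := dl _ e8; exists (d / 2); first by rewrite divr_gt0.
  move=> x1 x2 y1 y2 a1 a2 b1 b2 px wx wy; rewrite /good.
  have [/andP[p1 p2] /andP[p3 p4]] := px.
  have x12 := le_trans p1 p2; have y12 := le_trans p3 p4.
  have cf := sf _ _ _ _ a1 a2 b1 b2.
  pose A := fun w => (f p - l * p) + l * w.
  have dA w : cdiff A w l.
    have := cdiffD (cdiff_cst (f p - l * p) w) (cdiffZ l (cdiff_id w)).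
    by rewrite add0r mulr1.
  have A0 : frame_int A x1 x2 y1 y2 = 0.
    apply: (@frame_int_primitive _ _ _ _ _ x12 y12 (fun w => (f p - l * p) * w + l / 2 * (w * w))).
      by move=> w _; exact: cdiff_ccont (dA w).
    move=> w _.
    have := cdiffD (cdiffZ (f p - l * p) (cdiff_id w))
       (cdiffZ (l / 2) (cdiffM (cdiff_id w) (cdiff_id w))).
    by congr cdiff; rewrite /A; field.
  have -> : frame_int f x1 x2 y1 y2 = frame_int (fun z => f z - A z) x1 x2 y1 y2.
    by rewrite frame_intB ?A0 ?subr0// => w _; exact: cdiff_ccont (dA w).
  have cB z : frame x1 x2 y1 y2 z -> ccont (fun z => f z - A z) z.
    move=> /frame_box bz; have [m dm] := hf z (sub_box a1 a2 b1 b2 bz).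
    exact: cdiff_ccont (cdiffB dm (dA z)).
  have W0 : 0 <= (x2 - x1) + (y2 - y1) by lra.
  apply: le_trans (frame_int_bound x12 y12 cB (M := e / 8 * ((x2 - x1) + (y2 - y1))) _) _.
    move=> z /frame_box bz; have M := box_diameter px bz.
    have -> : f z - A z = f (p + (z - p)) - f p - l * (z - p).
      by rewrite [p + _]addrC subrK /A; ring.
    apply: le_trans (H _ _) _; first by lra.
    by rewrite ler_wpM2l// ltW.
  have := sqr_ge0 ((x2 - x1) - (y2 - y1)).
  move: e0; set a := x2 - x1; set b := y2 - y1; nra.
apply: modulus0_eq; apply/eqP; rewrite eq_le modulus_ge0 andbT leNgt; apply/negP => m0.
have S : 0 <= (X2 - X1) ^+ 2 + (Y2 - Y1) ^+ 2 by rewrite addr_ge0// sqr_ge0.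
set m := modulus _ in m0 K; set s := _ + _ in S K.
have := K (m / (2 * (s + 1))); rewrite divr_gt0//; last by lra.
move=> /(_ isT); rewrite -mulrA [_^-1 * _]mulrC mulrA ler_pdivlMr; last by lra.
nra.
Qed.

End Cauchy.

(** * Cauchy's formula *)

Section Cauchy.
Variable R : realType.
Implicit Types (f g : R[i] -> R[i]) (z l : R[i]).

(** Cutting the frame along the lines through the sides of a smaller rectangle
leaves four rectangles on which the integrand is differentiable. *)
Lemma frame_int_shrink g z (X1 X2 Y1 Y2 t : R) : 0 < t ->
  X1 <= Re z - t -> Re z + t <= X2 -> Y1 <= Im z - t -> Im z + t <= Y2 ->
  (forall w, box X1 X2 Y1 Y2 w -> w != z -> holo g w) ->
  frame_int g X1 X2 Y1 Y2 =
  frame_int g (Re z - t) (Re z + t) (Im z - t) (Im z + t).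
Proof.
move=> t0; case: z => a b /= h1 h2 h3 h4 hg.
have cg x1 x2 y1 y2 : X1 <= x1 -> x2 <= X2 -> Y1 <= y1 -> y2 <= Y2 ->
    x1 < a -> a < x2 -> y1 < b -> b < y2 ->
    forall w, frame x1 x2 y1 y2 w -> ccont g w.
  move=> a1 a2 b1 b2 n1 n2 n3 n4 w [bw ew]; apply: holo_ccont; apply: hg.
    exact: sub_box bw.
  by apply/eqP => E; move: ew; rewrite E /= => -[] E'; lra.
have G0 x1 x2 y1 y2 : X1 <= x1 -> x1 <= x2 -> x2 <= X2 -> Y1 <= y1 -> y1 <= y2 -> y2 <= Y2 ->
    [\/ a < x1, x2 < a, b < y1 | y2 < b] -> frame_int g x1 x2 y1 y2 = 0.
  move=> a1 a2 a3 b1 b2 b3 out; apply: goursat => // w bw.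
  apply: hg; first exact: sub_box bw.
  by apply/eqP => E; move: bw; rewrite E /box /= => -[/andP[? ?] /andP[? ?]]; case: out; lra.
rewrite (@frame_int_splitx _ g X1 (a - t) X2); [|lra|lra|by apply: cg; lra].
rewrite (G0 X1 (a - t)); [rewrite add0r|lra|lra|lra|lra|lra|lra|by apply: Or42; lra].
rewrite (@frame_int_splitx _ g (a - t) (a + t) X2); [|lra|lra|by apply: cg; lra].
rewrite (G0 (a + t) X2); [rewrite addr0|lra|lra|lra|lra|lra|lra|by apply: Or41; lra].
rewrite (@frame_int_splity _ g _ _ Y1 (b - t) Y2); [|lra|lra|by apply: cg; lra].
rewrite (G0 _ _ Y1 (b - t)); [rewrite add0r|lra|lra|lra|lra|lra|lra|by apply: Or44; lra].
rewrite (@frame_int_splity _ g _ _ (b - t) (b + t) Y2); [|lra|lra|by apply: cg; lra].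
by rewrite (G0 _ _ (b + t) Y2); [rewrite addr0|lra|lra|lra|lra|lra|lra|apply: Or43; lra].
Qed.

End Cauchy.

Section CauchyFormula.
Variable R : realType.
Implicit Types (f g u : R[i] -> R[i]) (z w l : R[i]).

Lemma eq0_of_linear_bound (m C t0 : R) : 0 < t0 -> 0 <= C -> 0 <= m ->
  (forall t, 0 < t -> t <= t0 -> m <= C * t) -> m = 0.
Proof.
move=> t00 C0 m0 H; apply/eqP; rewrite eq_le m0 andbT leNgt; apply/negP => mp.
have D0 : 0 < 2 * (C + 1) by lra.
pose t := Num.min t0 (m / (2 * (C + 1))).
have tp : 0 < t by rewrite lt_min t00 divr_gt0.
have t1 : t <= t0 by rewrite ge_min lexx.
have : t * (2 * (C + 1)) <= m by rewrite -ler_pdivlMr// ge_min lexx orbT.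
have := H t tp t1; nra.
Qed.

Lemma cdiff_shift f z c l : cdiff f (z - c) l -> cdiff (fun w => f (w - c)) z l.
Proof.
move=> df e e0; have [d d0 H] := df e e0; exists d => // h hd.
by rewrite [z + h - c]addrAC; exact: H.
Qed.

Lemma cdiff_comp f g z l m : cdiff g z l -> cdiff f (g z) m ->
  cdiff (fun w => f (g w)) z (m * l).
Proof.
move=> dg df e e0.
have l0 := modulus_ge0 l; have m0 := modulus_ge0 m.
have e1 : 0 < e / (2 * (modulus l + 1)) by rewrite divr_gt0//; lra.
have e2 : 0 < Num.min 1 (e / (2 * (modulus m + 1))).
  by rewrite lt_min ltr01 divr_gt0//; lra.
have [d d0 H] := df _ e1; have [d' d'0 H'] := dg _ e2.
exists (Num.min d' (d / (modulus l + 1))).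
  by rewrite lt_min d'0 divr_gt0//; lra.
move=> h; rewrite lt_min => /andP[hd' hd].
have h0 := modulus_ge0 h.
pose k := g (z + h) - g z.
have A := H' h hd'; rewrite -/k in A.
have B : modulus (k - l * h) <= modulus h.
  by apply: le_trans A _; rewrite -[leRHS]mul1r ler_wpM2r// ge_min lexx.
have D : modulus (k - l * h) <= e / (2 * (modulus m + 1)) * modulus h.
  by apply: le_trans A _; rewrite ler_wpM2r// ge_min lexx orbT.
have kb : modulus k <= (modulus l + 1) * modulus h.
  rewrite -(subrK (l * h) k); apply: le_trans (ler_modulusD _ _) _.
  by rewrite modulusM; lra.
have kd : modulus k < d.
  by apply: le_lt_trans kb _; rewrite mulrC -ltr_pdivlMr//; lra.
have := H k kd; have -> : g z + k = g (z + h) by rewrite addrC subrK.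
move=> E.
have -> : f (g (z + h)) - f (g z) - m * l * h =
  (f (g (z + h)) - f (g z) - m * k) + m * (k - l * h) by ring.
apply: le_trans (ler_modulusD _ _) _; rewrite modulusM.
have T1 : e / (2 * (modulus l + 1)) * modulus k <= e / 2 * modulus h.
  have -> : e / 2 * modulus h = e / (2 * (modulus l + 1)) * ((modulus l + 1) * modulus h).
    by field; rewrite gt_eqF//; lra.
  by rewrite ler_wpM2l// ltW.
have T2 : modulus m * modulus (k - l * h) <= e / 2 * modulus h.
  have -> : e / 2 * modulus h = (modulus m + 1) * (e / (2 * (modulus m + 1)) * modulus h).
    by field; rewrite gt_eqF//; lra.
  by apply: ler_pM => //; rewrite ?modulus_ge0//; lra.
lra.
Qed.

Lemma cdiffV g z l : cdiff g z l -> g z != 0 ->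
  cdiff (fun w => (g w)^-1) z (- (g z) ^- 2 * l).
Proof. by move=> dg g0; apply: cdiff_comp dg _; exact: cdiff_inv. Qed.

Lemma cdiff_inv_sub z w : w != z ->
  cdiff (fun w => (w - z)^-1) w (- (w - z) ^- 2).
Proof.
by move=> wz; apply: (@cdiff_shift (fun w => w^-1)); apply: cdiff_inv; rewrite subr_eq0.
Qed.

Lemma holoB f g z : holo f z -> holo g z -> holo (fun w => f w - g w) z.
Proof. by move=> [l dl] [m dm]; eexists; exact: cdiffB dl dm. Qed.

Lemma holoM f g z : holo f z -> holo g z -> holo (fun w => f w * g w) z.
Proof. by move=> [l dl] [m dm]; eexists; exact: cdiffM dl dm. Qed.

Lemma holo_cst c z : holo (fun=> c) z.
Proof. by eexists; exact: cdiff_cst. Qed.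

Lemma holo_inv_sub z w : w != z -> holo (fun w => (w - z)^-1) w.
Proof. by move=> wz; eexists; exact: cdiff_inv_sub. Qed.

Lemma ccontM f g z : ccont f z -> ccont g z -> ccont (fun w => f w * g w) z.
Proof.
move=> cf cg e e0.
have f0 := modulus_ge0 (f z); have g0 := modulus_ge0 (g z).
pose K := modulus (f z) + modulus (g z) + 1.
have K0 : 0 < K by rewrite /K; lra.
have e1 : 0 < Num.min 1 (e / (2 * K)) by rewrite lt_min ltr01 divr_gt0//; lra.
have [d d0 H] := cf _ e1; have [d' d'0 H'] := cg _ e1.
exists (Num.min d d'); first by rewrite lt_min d0.
move=> h; rewrite lt_min => /andP[/H {}H /H' {}H'].
move: H H'; rewrite !lt_min => /andP[A1 A2] /andP[B1 B2].
have -> : f (z + h) * g (z + h) - f z * g z =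
  (f (z + h) - f z) * (g z + (g (z + h) - g z)) + f z * (g (z + h) - g z) by ring.
apply: le_lt_trans (ler_modulusD _ _) _; rewrite !modulusM.
have := ler_modulusD (g z) (g (z + h) - g z).
have a0 := modulus_ge0 (f (z + h) - f z); have b0 := modulus_ge0 (g (z + h) - g z).
have eK : e / (2 * K) * K = e / 2 by field; rewrite gt_eqF.
move: A1 A2 B1 B2 a0 b0.
set a := modulus (f (z + h) - f z); set b := modulus (g (z + h) - g z).
set E := e / (2 * K) in eK *; set G := modulus (_ + _) => A1 A2 B1 B2 a0 b0 HG.
have T1 : a * G <= E * (modulus (g z) + 1) by apply: ler_pM => //; rewrite ?modulus_ge0//; lra.
have T2 : modulus (f z) * b <= modulus (f z) * E by rewrite ler_wpM2l// ltW.
have E0 : 0 < E by lra.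
rewrite /K in eK; nra.
Qed.

Section Frame.
Variables X1 X2 Y1 Y2 : R.
Local Notation F := (frame X1 X2 Y1 Y2).

Lemma frame_distance z (r : R) w : F w ->
  X1 <= Re z - r -> Re z + r <= X2 -> Y1 <= Im z - r -> Im z + r <= Y2 ->
  r <= modulus (w - z).
Proof.
move=> [bw ew] a b c d.
have Hr := Re_le_modulus (w - z); have Hi := Im_le_modulus (w - z).
move: Hr Hi; rewrite ReB ImB !ler_norml => /andP[? ?] /andP[? ?].
by case: ew => E; rewrite -E in a b c d; lra.
Qed.

Lemma frame_neq z w : F w -> X1 < Re z < X2 -> Y1 < Im z < Y2 -> w != z.
Proof.
move=> [bw ew] /andP[a b] /andP[c d]; apply/eqP => E.
by move: a b c d; rewrite -E; case: ew => ->; rewrite ltxx.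
Qed.

(** The difference quotient (f w - f z) / (w - z) is bounded near z, so its
integral over the frame, which may be shrunk around z, vanishes. *)
Lemma cauchy_formula f z :
  (forall w, box X1 X2 Y1 Y2 w -> holo f w) ->
  X1 < Re z < X2 -> Y1 < Im z < Y2 ->
  frame_int (fun w => f w * (w - z)^-1) X1 X2 Y1 Y2 =
  f z * frame_int (fun w => (w - z)^-1) X1 X2 Y1 Y2.
Proof.
move=> hf zx zy; have [/andP[zx1 zx2] /andP[zy1 zy2]] := (zx, zy).
have bz : box X1 X2 Y1 Y2 z by split; apply/andP; split; lra.
have X12 : X1 <= X2 by lra.
have Y12 : Y1 <= Y2 by lra.
pose G w := (f w - f z) * (w - z)^-1.
have hG w : box X1 X2 Y1 Y2 w -> w != z -> holo G w.
  by move=> bw wz; apply: holoM (holo_inv_sub wz); apply: holoB (holo_cst _ _); exact: hf.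
have [l dl] := hf z bz; have [d d0 H] := dl 1 ltr01.
have l0 := modulus_ge0 l.
pose r := Num.min (Num.min (Re z - X1) (X2 - Re z)) (Num.min (Im z - Y1) (Y2 - Im z)).
have r0 : 0 < r by rewrite !lt_min !subr_gt0 zx1 zx2 zy1.
have G0 : frame_int G X1 X2 Y1 Y2 = 0.
  apply: modulus0_eq.
  apply: (@eq0_of_linear_bound _ (16 * (modulus l + 1)) (Num.min r (d / 8))).
  - by rewrite lt_min r0 divr_gt0.
  - lra.
  - exact: modulus_ge0.
  move=> t t0; rewrite !le_min => /andP[/andP[/andP[? ?] /andP[? ?]] td].
  rewrite (@frame_int_shrink _ G z _ _ _ _ t)//; try lra.
  have int1 : Re z - t < Re z < Re z + t by apply/andP; split; lra.
  have int2 : Im z - t < Im z < Im z + t by apply/andP; split; lra.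
  have ne w : frame (Re z - t) (Re z + t) (Im z - t) (Im z + t) w -> w != z.
    by move=> [bw ew]; apply/eqP => E; move: ew; rewrite E; clear -t0 => -[] E'; lra.
  have sb : box (Re z - t) (Re z + t) (Im z - t) (Im z + t) `<=` box X1 X2 Y1 Y2.
    by apply: sub_box; lra.
  have b1 : Re z - t <= Re z + t by lra.
  have b2 : Im z - t <= Im z + t by lra.
  apply: le_trans (frame_int_bound b1 b2 (M := modulus l + 1) _ _) _; last by lra.
    by move=> w Fw; apply: holo_ccont; apply: hG (ne _ Fw); exact: sb (frame_box Fw).
  move=> w Fw; have wz : 0 < modulus (w - z) by rewrite modulus_gt0// subr_eq0 ne.
  rewrite /G modulusM modulusV ler_pdivrMr//.
  have wd : modulus (w - z) < d.
    have bt : box (Re z - t) (Re z + t) (Im z - t) (Im z + t) z.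
      by case/andP: int1 => ? ?; case/andP: int2 => ? ?; split; apply/andP; split; exact: ltW.
    by apply: le_lt_trans (box_diameter bt (frame_box Fw)) _; lra.
  have := H _ wd; rewrite [z + _]addrC subrK mul1r => H'.
  rewrite -(subrK (l * (w - z)) (f w - f z)).
  by apply: le_trans (ler_modulusD _ _) _; rewrite modulusM; lra.
have cK w : F w -> ccont (fun w => (w - z)^-1) w.
  by move=> Fw; apply: holo_ccont; apply: holo_inv_sub; exact: frame_neq Fw zx zy.
have cf w : F w -> ccont f w by move=> Fw; apply: holo_ccont; apply: hf; exact: frame_box Fw.
apply/eqP; rewrite -subr_eq0 -frame_intZ// -frame_intB//.
- rewrite -G0; apply/eqP; apply: eq_frame_int => // w _.
  by rewrite /G mulrBl.
- by move=> w Fw; apply: ccontM; [exact: cf|exact: cK].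
- move=> w Fw; apply: ccontM; [|exact: cK].
  by apply: holo_ccont; exact: holo_cst.
Qed.

End Frame.
End CauchyFormula.

Section Winding.
Variable R : realType.
Implicit Types (f g u : R[i] -> R[i]) (z w l : R[i]).
Variables X1 X2 Y1 Y2 : R.
Local Notation F := (frame X1 X2 Y1 Y2).

Lemma Im_frame_int u :
  Im (frame_int u X1 X2 Y1 Y2) =
    (\int[mu]_(x in `[X1, X2]) Im (u (x +i* Y1)))
  + (\int[mu]_(y in `[Y1, Y2]) Re (u (X2 +i* y)))
  - (\int[mu]_(x in `[X1, X2]) Im (u (x +i* Y2)))
  - \int[mu]_(y in `[Y1, Y2]) Re (u (X1 +i* y)).
Proof.
rewrite /frame_int !(ImB, ImD) /cint /=.
by rewrite !mul0r !mul1r !add0r.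
Qed.

Lemma Rintegral_ge_cst (a b c : R) (w : R -> R) : a <= b ->
  {in `[a, b], continuous w} -> (forall x, a <= x <= b -> c <= w x) ->
  c * (b - a) <= \int[mu]_(x in `[a, b]) w x.
Proof.
move=> ab cw cle.
have -> : c * (b - a) = \int[mu]_(x in `[a, b]) (fun=> c) x.
  rewrite Rintegral_cst//= lebesgue_measure_itv/= lte_fin.
  case: ifPn => [|]; first by rewrite -EFinD.
  by rewrite -leNgt => ba; have -> : a = b; [apply/eqP; rewrite eq_le ab|rewrite subrr].
apply: le_Rintegral => //.
- by apply: continuous_integrable => x _; exact: cst_continuous.
- exact: continuous_integrable.
Qed.

(** Each of the four sides contributes a positive imaginary part to the winding
integral around an interior point. *)
Lemma frame_int_inv_ge z (m M : R) : 0 < m ->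
  m <= Re z - X1 <= M -> m <= X2 - Re z <= M ->
  m <= Im z - Y1 <= M -> m <= Y2 - Im z <= M ->
  4 * (m / M) ^+ 2 <= Im (frame_int (fun w => (w - z)^-1) X1 X2 Y1 Y2).
Proof.
move=> m0 /andP[h1 h2] /andP[h3 h4] /andP[h5 h6] /andP[h7 h8].
have M0 : 0 < M by lra.
have xx (x : R) : X1 <= x <= X2 -> `|x - Re z| <= M.
  by move=> /andP[? ?]; rewrite ler_norml; apply/andP; split; lra.
have yy (y : R) : Y1 <= y <= Y2 -> `|y - Im z| <= M.
  by move=> /andP[? ?]; rewrite ler_norml; apply/andP; split; lra.
have X12 : X1 <= X2 by lra.
have Y12 : Y1 <= Y2 by lra.
have zx : X1 < Re z < X2 by apply/andP; split; lra.
have zy : Y1 < Im z < Y2 by apply/andP; split; lra.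
have [c1 c2 c3 c4] : [/\ pcont X1 X2 (fun x => (x +i* Y1 - z)^-1),
    pcont Y1 Y2 (fun y => (X2 +i* y - z)^-1),
    pcont X1 X2 (fun x => (x +i* Y2 - z)^-1) &
    pcont Y1 Y2 (fun y => (X1 +i* y - z)^-1)].
  apply: (frame_pcont X12 Y12 (f := fun w => (w - z)^-1)) => w Fw.
  by apply: holo_ccont; apply: holo_inv_sub; exact: frame_neq Fw zx zy.
rewrite Im_frame_int.
have key (s t : R) : m <= s -> s <= M -> `|t| <= M -> m / (2 * M ^+ 2) <= s / (s ^+ 2 + t ^+ 2).
  move=> ms sM tM.
  have D : 0 < s ^+ 2 + t ^+ 2 by have := sqr_ge0 t; nra.
  rewrite ler_pdivrMr; last by have := exprn_gt0 2 M0; lra.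
  rewrite mulrAC ler_pdivlMr//.
  have : t ^+ 2 <= M ^+ 2 by rewrite -(real_normK (num_real t)) ler_pXn2r// ?nnegrE// ltW.
  have : s ^+ 2 <= M ^+ 2 by rewrite ler_pXn2r// ?nnegrE; lra.
  have := sqr_ge0 s; have := sqr_ge0 t; nra.
have ReV (w : R[i]) : Re w^-1 = Re w / (Re w ^+ 2 + Im w ^+ 2) by case: w.
have ImV (w : R[i]) : Im w^-1 = - (Im w / (Re w ^+ 2 + Im w ^+ 2)) by case: w.
have Re_right (p q : R) : Re ((p +i* q - z)^-1) = (p - Re z) / ((p - Re z) ^+ 2 + (q - Im z) ^+ 2).
  by rewrite ReV ReB ImB.
have Re_left (p q : R) : - Re ((p +i* q - z)^-1) = (Re z - p) / ((Re z - p) ^+ 2 + (q - Im z) ^+ 2).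
  by rewrite Re_right -mulNr opprB -[X in _ / (X + _) = _]sqrrN opprB.
have Im_top (p q : R) : - Im ((p +i* q - z)^-1) = (q - Im z) / ((q - Im z) ^+ 2 + (p - Re z) ^+ 2).
  by rewrite [(q - _) ^+ 2 + _]addrC ImV ReB ImB opprK.
have Im_bottom (p q : R) : Im ((p +i* q - z)^-1) = (Im z - q) / ((Im z - q) ^+ 2 + (p - Re z) ^+ 2).
  by rewrite -[LHS]opprK Im_top -mulNr opprB -[X in _ / (X + _) = _]sqrrN opprB.
have E : (m / M) ^+ 2 = m / (2 * M ^+ 2) * (2 * m) by field; rewrite gt_eqF.
have k0 : 0 <= m / (2 * M ^+ 2) by rewrite divr_ge0; [|lra|have := exprn_gt0 2 M0; lra].
have kx : m / (2 * M ^+ 2) * (2 * m) <= m / (2 * M ^+ 2) * (X2 - X1) by rewrite ler_wpM2l//; lra.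
have ky : m / (2 * M ^+ 2) * (2 * m) <= m / (2 * M ^+ 2) * (Y2 - Y1) by rewrite ler_wpM2l//; lra.
have N a b (w : R -> R) : {in `[a, b], continuous w} ->
   - (\int[mu]_(x in `[a, b]) w x) = \int[mu]_(x in `[a, b]) (- w x).
  move=> cw; rewrite -mulN1r -RintegralZl//; last exact: continuous_integrable.
  by apply: eq_Rintegral => x _; rewrite mulN1r.
have CN a b (w : R -> R) : {in `[a, b], continuous w} -> {in `[a, b], continuous (fun x => - w x)}.
  by move=> cw x xab; apply: cvgN; exact: cw.
have B1 := Rintegral_ge_cst (c := m / (2 * M ^+ 2)) X12 (pcontIm c1).
have B2 := Rintegral_ge_cst (c := m / (2 * M ^+ 2)) Y12 (pcontRe c2).
have B3 := Rintegral_ge_cst (c := m / (2 * M ^+ 2)) X12 (CN _ _ _ (pcontIm c3)).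
have B4 := Rintegral_ge_cst (c := m / (2 * M ^+ 2)) Y12 (CN _ _ _ (pcontRe c4)).
rewrite -N in B3; last exact: pcontIm.
rewrite -N in B4; last exact: pcontRe.
have H1 : m / (2 * M ^+ 2) * (X2 - X1) <= \int[mu]_(x in `[X1, X2]) Im ((x +i* Y1 - z)^-1).
  by apply: B1 => x /xx xM; rewrite Im_bottom; apply: key => //; lra.
have H2 : m / (2 * M ^+ 2) * (Y2 - Y1) <= \int[mu]_(y in `[Y1, Y2]) Re ((X2 +i* y - z)^-1).
  by apply: B2 => y /yy yM; rewrite Re_right; apply: key => //; lra.
have H3 : m / (2 * M ^+ 2) * (X2 - X1) <= - (\int[mu]_(x in `[X1, X2]) Im ((x +i* Y2 - z)^-1)).
  by apply: B3 => x /xx xM; rewrite Im_top; apply: key => //; lra.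
have H4 : m / (2 * M ^+ 2) * (Y2 - Y1) <= - (\int[mu]_(y in `[Y1, Y2]) Re ((X1 +i* y - z)^-1)).
  by apply: B4 => y /yy yM; rewrite Re_left; apply: key => //; lra.
rewrite E; move: kx ky H1 H2 H3 H4; clear; lra.
Qed.

End Winding.

(** * The derivative of a holomorphic function is holomorphic *)

Section Regularity.
Variable R : realType.
Implicit Types (f g u k : R[i] -> R[i]) (z w l : R[i]).

Lemma pcont_bounded (a b : R) (u : R -> R[i]) : a <= b -> pcont a b u ->
  exists M : R, forall x, a <= x <= b -> modulus (u x) <= M.
Proof.
move=> ab cu.
have [c _ H] := EVT_max ab (in_continuous_within (pcont_modulus cu)).
by exists (modulus (u c)) => x xab; apply: H; rewrite in_itv.
Qed.

Lemma ccont_shift f z c : ccont f (z - c) -> ccont (fun w => f (w - c)) z.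
Proof.
move=> cf e e0; have [d d0 H] := cf e e0; exists d => // h hd.
by rewrite [z + h - c]addrAC; exact: H.
Qed.

Lemma ccontB f g z : ccont f z -> ccont g z -> ccont (fun w => f w - g w) z.
Proof.
move=> cf cg e e0; have e2 : 0 < e / 2 by lra.
have [d d0 H] := cf _ e2; have [d' d'0 H'] := cg _ e2.
exists (Num.min d d'); first by rewrite lt_min d0.
move=> t; rewrite lt_min => /andP[/H {}H /H' {}H'].
have -> : f (z + t) - g (z + t) - (f z - g z) =
  (f (z + t) - f z) - (g (z + t) - g z) by ring.
by apply: le_lt_trans (ler_modulusB _ _) _; lra.
Qed.

Lemma cdiff_square_bound (N : R[i] -> R[i]) z l (C d : R) : 0 < d -> 0 <= C ->
  (forall h, modulus h < d -> modulus (N (z + h) - N z - l * h) <= C * modulus h ^+ 2) ->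
  cdiff N z l.
Proof.
move=> d0 C0 H e e0; have C1 : 0 < C + 1 by lra.
exists (Num.min d (e / (C + 1))); first by rewrite lt_min d0 divr_gt0.
move=> h; rewrite lt_min => /andP[hd he]; apply: le_trans (H h hd) _.
rewrite expr2 mulrA ler_wpM2r ?modulus_ge0//.
have := modulus_ge0 h; move: he; rewrite ltr_pdivlMr//; lra.
Qed.

Section Kernels.
Variables X1 X2 Y1 Y2 : R.
Hypotheses (X12 : X1 <= X2) (Y12 : Y1 <= Y2).
Local Notation F := (frame X1 X2 Y1 Y2).

Lemma frame_bounded u : (forall z, F z -> ccont u z) ->
  exists2 M : R, 0 <= M & forall z, F z -> modulus (u z) <= M.
Proof.
move=> /(frame_pcont X12 Y12)[c1 c2 c3 c4].
have [M1 H1] := pcont_bounded X12 c1; have [M2 H2] := pcont_bounded Y12 c2.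
have [M3 H3] := pcont_bounded X12 c3; have [M4 H4] := pcont_bounded Y12 c4.
exists (`|M1| + `|M2| + `|M3| + `|M4|); first by rewrite !addr_ge0.
have [n1 n2] := (normr_ge0 M1, normr_ge0 M2); have [n3 n4] := (normr_ge0 M3, normr_ge0 M4).
have [m1 m2] := (ler_norm M1, ler_norm M2); have [m3 m4] := (ler_norm M3, ler_norm M4).
move=> [x y] [[/= hx hy] []/= E]; rewrite E.
- by have := H4 y hy; lra.
- by have := H2 y hy; lra.
- by have := H1 x hx; lra.
- by have := H3 x hx; lra.
Qed.

(** The second-order Taylor bound on the kernel is uniform on the contour, so it
integrates to a second-order bound for the integral. *)
Lemma cdiff_frame_kernel u k k' z (r C : R) : 0 < r -> 0 <= C ->
  X1 <= Re z - r -> Re z + r <= X2 -> Y1 <= Im z - r -> Im z + r <= Y2 ->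
  (forall w, F w -> ccont u w) ->
  (forall a, a != 0 -> ccont k a) -> (forall a, a != 0 -> ccont k' a) ->
  (forall a h, r <= modulus a -> modulus h <= r / 2 ->
     modulus (k (a - h) - k a - k' a * h) <= C * modulus h ^+ 2) ->
  cdiff (fun z => frame_int (fun w => u w * k (w - z)) X1 X2 Y1 Y2) z
        (frame_int (fun w => u w * k' (w - z)) X1 X2 Y1 Y2).
Proof.
move=> r0 C0 a1 a2 a3 a4 cu ck ck' Hk.
have [M M0 uM] := frame_bounded cu.
have dist w : F w -> r <= modulus (w - z) by move=> Fw; apply: frame_distance Fw _ _ _ _.
have cuk kk z' : (forall a, a != 0 -> ccont kk a) -> (forall w, F w -> w != z') ->
    forall w, F w -> ccont (fun w => u w * kk (w - z')) w.
  move=> ckk ne w Fw; apply: ccontM; first exact: cu.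
  by apply: ccont_shift; apply: ckk; rewrite subr_eq0 ne.
apply: (@cdiff_square_bound _ _ _ (4 * (M * C) * ((X2 - X1) + (Y2 - Y1))) (r / 2)).
- by rewrite divr_gt0.
- by rewrite !mulr_ge0//; lra.
move=> h hr.
have ne0 w : F w -> w != z.
  by move=> /dist wz; apply/eqP => E; move: wz; rewrite E subrr modulus0; lra.
have neh w : F w -> w != z + h.
  move=> /dist wz; apply/eqP => E; move: wz; rewrite E addrC addKr.
  by have := modulus_ge0 h; lra.
have c1 := cuk k (z + h) ck neh; have c2 := cuk k z ck ne0; have c3 := cuk k' z ck' ne0.
rewrite [frame_int _ _ _ _ _ * h]mulrC -frame_intZ// -frame_intB// -frame_intB//; first last.
- by move=> w Fw; apply: ccontM; [exact: holo_ccont (holo_cst _ _)|exact: c3].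
- by move=> w Fw; apply: ccontB; [exact: c1|exact: c2].
have -> : 4 * (M * C) * ((X2 - X1) + (Y2 - Y1)) * modulus h ^+ 2 =
  4 * (M * (C * modulus h ^+ 2)) * ((X2 - X1) + (Y2 - Y1)) by ring.
apply: frame_int_bound => //.
  move=> w Fw; apply: ccontB; first by apply: ccontB; [exact: c1|exact: c2].
  by apply: ccontM; [exact: holo_ccont (holo_cst _ _)|exact: c3].
move=> w Fw.
have -> : u w * k (w - (z + h)) - u w * k (w - z) - h * (u w * k' (w - z)) =
  u w * (k ((w - z) - h) - k (w - z) - k' (w - z) * h).
  by rewrite opprD addrA; ring.
rewrite modulusM; apply: ler_pM; rewrite ?modulus_ge0//; first exact: uM.
by apply: Hk; [exact: dist|exact: ltW].
Qed.

Lemma inv_taylor (a h : R[i]) (r : R) : 0 < r -> r <= modulus a -> modulus h <= r / 2 ->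
  modulus ((a - h)^-1 - a^-1 - (a^-1) ^+ 2 * h) <= 2 / r ^+ 3 * modulus h ^+ 2.
Proof.
move=> r0 ra hr.
have a0 : a != 0 by apply/eqP => E; move: ra; rewrite E modulus0; lra.
have b : r / 2 <= modulus (a - h) by have := lerB_modulus a h; lra.
have b0 : a - h != 0 by apply/eqP => E; move: b; rewrite E modulus0; lra.
have -> : (a - h)^-1 - a^-1 - (a^-1) ^+ 2 * h = (a - h)^-1 * (a^-1) ^+ 2 * h ^+ 2.
  by field; rewrite a0 b0.
rewrite !(modulusX, modulusV, modulusM).
apply: ler_wpM2r; first by rewrite sqr_ge0.
have -> : 2 / r ^+ 3 = (r / 2)^-1 * r^-1 ^+ 2 by field; rewrite gt_eqF.
have V1 : (modulus (a - h))^-1 <= (r / 2)^-1 by rewrite lef_pV2// posrE; lra.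
have V2 : (modulus a)^-1 <= r^-1 by rewrite lef_pV2// posrE; lra.
have P1 : 0 <= (modulus (a - h))^-1 by rewrite invr_ge0 modulus_ge0.
have P2 : 0 <= (modulus a)^-1 by rewrite invr_ge0 modulus_ge0.
apply: ler_pM => //; first exact: sqr_ge0.
by rewrite ler_pXn2r// nnegrE// invr_ge0 ltW.
Qed.

Lemma sqr_inv_taylor (a h : R[i]) (r : R) : 0 < r -> r <= modulus a -> modulus h <= r / 2 ->
  modulus (((a - h)^-1) ^+ 2 - (a^-1) ^+ 2 - 2 * (a^-1) ^+ 3 * h) <= 8 / r ^+ 4 * modulus h ^+ 2.
Proof.
move=> r0 ra hr.
have a0 : a != 0 by apply/eqP => E; move: ra; rewrite E modulus0; lra.
have b : r / 2 <= modulus (a - h) by have := lerB_modulus a h; lra.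
have b0 : a - h != 0 by apply/eqP => E; move: b; rewrite E modulus0; lra.
have -> : ((a - h)^-1) ^+ 2 - (a^-1) ^+ 2 - 2 * (a^-1) ^+ 3 * h =
  (((a - h)^-1) ^+ 2 * (a^-1) ^+ 2 + 2 * ((a - h)^-1 * (a^-1) ^+ 3)) * h ^+ 2.
  by field; rewrite a0 b0.
rewrite modulusM [modulus (h ^+ 2)]modulusX; apply: ler_wpM2r; first by rewrite sqr_ge0.
apply: le_trans (ler_modulusD _ _) _.
rewrite !(modulusX, modulusV, modulusM).
have -> : modulus (2 : R[i]) = 2.
  by rewrite -(_ : 2%:R%:C = 2%:R)%C ?modulus_real ?ger0_norm// rmorph_nat.
have -> : 8 / r ^+ 4 = (r / 2)^-1 ^+ 2 * r^-1 ^+ 2 + 2 * ((r / 2)^-1 * r^-1 ^+ 3).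
  by field; rewrite gt_eqF.
have V1 : (modulus (a - h))^-1 <= (r / 2)^-1 by rewrite lef_pV2// posrE; lra.
have V2 : (modulus a)^-1 <= r^-1 by rewrite lef_pV2// posrE; lra.
have P1 : 0 <= (modulus (a - h))^-1 by rewrite invr_ge0 modulus_ge0.
have P2 : 0 <= (modulus a)^-1 by rewrite invr_ge0 modulus_ge0.
have Q1 : 0 <= (r / 2)^-1 by lra.
have Q2 : 0 <= r^-1 by lra.
apply: lerD; first by apply: ler_pM; rewrite ?sqr_ge0// ler_pXn2r.
rewrite ler_wpM2l//; apply: ler_pM => //; first by rewrite exprn_ge0.
by rewrite ler_pXn2r.
Qed.

End Kernels.

(** By Cauchy's formula, f and its derivative are contour integrals of rational
kernels divided by the winding integral; the derivative of the latter vanishes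
since the squared kernel has a primitive. *)
Theorem holo_cderiv f z0 (r : R) : 0 < r ->
  (forall w, box (Re z0 - r) (Re z0 + r) (Im z0 - r) (Im z0 + r) w -> holo f w) ->
  holo (cderiv f) z0.
Proof.
move=> r0 hf.
pose X1 := Re z0 - r; pose X2 := Re z0 + r; pose Y1 := Im z0 - r; pose Y2 := Im z0 + r.
have X12 : X1 <= X2 by rewrite /X1 /X2; lra.
have Y12 : Y1 <= Y2 by rewrite /Y1 /Y2; lra.
pose k1 (a : R[i]) := a^-1; pose k2 (a : R[i]) := a^-1 ^+ 2.
pose k3 (a : R[i]) := 2 * a^-1 ^+ 3.
have ck1 a : a != 0 -> ccont k1 a by move=> a0; exact: cdiff_ccont (cdiff_inv a0).
have ck2 a : a != 0 -> ccont k2 a.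
  by move=> a0; exact: (ccontM (ck1 a a0) (ck1 a a0)).
have ck3 a : a != 0 -> ccont k3 a.
  move=> a0; exact: (ccontM (holo_ccont (holo_cst 2 a)) (ccontM (ck1 a a0) (ck2 a a0))).
pose N u k z := frame_int (fun w => u w * k (w - z)) X1 X2 Y1 Y2.
have inside z : modulus (z - z0) < r / 2 ->
    [/\ X1 <= Re z - r / 2, Re z + r / 2 <= X2, Y1 <= Im z - r / 2 & Im z + r / 2 <= Y2].
  move=> zr; have := Re_le_modulus (z - z0); have := Im_le_modulus (z - z0).
  rewrite ReB ImB !ler_norml /X1 /X2 /Y1 /Y2 => /andP[? ?] /andP[? ?]; split; lra.
have r2 : 0 < r / 2 by lra.
have dN1 u z : (forall w, frame X1 X2 Y1 Y2 w -> ccont u w) -> modulus (z - z0) < r / 2 ->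
    cdiff (N u k1) z (N u k2 z).
  move=> cu /inside[b1 b2 b3 b4].
  apply: (@cdiff_frame_kernel _ _ _ _ X12 Y12 u k1 k2 z (r / 2) (2 / (r / 2) ^+ 3)) => //.
    by rewrite divr_ge0// exprn_ge0// ltW.
  by move=> a h ra hr; exact: inv_taylor.
have dN2 u z : (forall w, frame X1 X2 Y1 Y2 w -> ccont u w) -> modulus (z - z0) < r / 2 ->
    cdiff (N u k2) z (N u k3 z).
  move=> cu /inside[b1 b2 b3 b4].
  apply: (@cdiff_frame_kernel _ _ _ _ X12 Y12 u k2 k3 z (r / 2) (8 / (r / 2) ^+ 4)) => //.
    by rewrite divr_ge0// exprn_ge0// ltW.
  by move=> a h ra hr; exact: sqr_inv_taylor.
pose one (w : R[i]) : R[i] := 1.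
have cone w : frame X1 X2 Y1 Y2 w -> ccont one w by move=> _; exact: holo_ccont (holo_cst _ _).
have cf w : frame X1 X2 Y1 Y2 w -> ccont f w.
  by move=> /frame_box bw; apply: holo_ccont; exact: hf.
have N1one z : N one k1 z = frame_int (fun w => (w - z)^-1) X1 X2 Y1 Y2.
  by apply: eq_frame_int => // w _; rewrite /one /k1 mul1r.
have c0 z : modulus (z - z0) < r / 2 -> N one k1 z != 0.
  move=> /inside[b1 b2 b3 b4]; rewrite N1one; apply/eqP => E.
  have S : 0 < (r / 2 / (2 * r)) ^+ 2 by rewrite exprn_gt0// divr_gt0//; lra.
  have : 4 * (r / 2 / (2 * r)) ^+ 2 <= Im (frame_int (fun w => (w - z)^-1) X1 X2 Y1 Y2).
    by apply: frame_int_inv_ge => //; apply/andP; clear -b1 b2 b3 b4;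
      rewrite /X1 /X2 /Y1 /Y2 in b1 b2 b3 b4 *; split; lra.
  by rewrite E /=; lra.
have N20 z : modulus (z - z0) < r / 2 -> N one k2 z = 0.
  move=> /inside[b1 b2 b3 b4].
  have ne w : frame X1 X2 Y1 Y2 w -> w != z.
    by move=> Fw; apply: frame_neq Fw _ _; apply/andP; split; lra.
  apply: (@frame_int_primitive _ _ _ _ _ X12 Y12 (fun w => - (w - z)^-1)).
    move=> w Fw; apply: ccontM; first exact: cone.
    by apply: ccont_shift; apply: ck2; rewrite subr_eq0 ne.
  move=> w Fw; have := cdiffN (cdiff_inv_sub (ne w Fw)).
  by rewrite opprK /one /k2 mul1r exprVn.
have fE z : modulus (z - z0) < r / 2 -> f z = N f k1 z * (N one k1 z)^-1.
  move=> zr; have [b1 b2 b3 b4] := inside z zr.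
  rewrite N1one /N (@cauchy_formula _ X1 X2 Y1 Y2 f z hf); last 2 first.
  - by apply/andP; split; lra.
  - by apply/andP; split; lra.
  by rewrite -N1one mulfK// c0.
have loc z : modulus (z - z0) < r / 2 -> forall h, modulus h < r / 2 - modulus (z - z0) ->
    modulus (z + h - z0) < r / 2.
  by move=> zr h hr; rewrite addrAC; apply: le_lt_trans (ler_modulusD _ _) _; lra.
have dfE z : modulus (z - z0) < r / 2 -> cderiv f z = N f k2 z * (N one k1 z)^-1.
  move=> zr.
  have := cdiffM (dN1 f z cf zr) (cdiffV (dN1 one z cone zr) (c0 z zr)).
  rewrite N20// !mulr0 addr0 => D.
  have := @eq_cdiff _ _ f z _ (r / 2 - modulus (z - z0)) _ _ D; rewrite subr_gt0.
  move=> /(_ zr) H; apply: (cdiff_derivable (H _)).2 => h hr.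
  by rewrite fE// loc.
have z00 : modulus (z0 - z0) < r / 2 by rewrite subrr modulus0.
have D := cdiffM (dN2 f z0 cf z00) (cdiffV (dN1 one z0 cone z00) (c0 z0 z00)).
eexists; apply: (@eq_cdiff _ _ (cderiv f) z0 _ (r / 2) r2 _ D) => h hr.
by rewrite dfE// addrAC subrr add0r.
Qed.

End Regularity.

(** * Measurability and iterated integrals in the plane *)

Section PlaneMeasurability.
Variable R : realType.

(** Every plane set that is open for the square norm is a countable union of
rational squares, hence measurable for the product sigma-algebra. *)
Lemma measurable_open_plane (A : set (R * R)) :
  (forall w, A w -> exists2 r : R, 0 < r & forall w', `|w'.1 - w.1| < r ->
     `|w'.2 - w.2| < r -> A w') -> measurable A.
Proof.
move=> oA.
pose B (p q : rat) (n : nat) : set (R * R) :=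
  `]ratr p - n.+1%:R^-1, ratr p + n.+1%:R^-1[%classic `*`
  `]ratr q - n.+1%:R^-1, ratr q + n.+1%:R^-1[%classic.
have -> : A = \bigcup_p \bigcup_q \bigcup_n
    (if `[< B p q n `<=` A >] then B p q n else set0).
  apply/seteqP; split => [w Aw|w [p _] [q _] [n _]]; last by case: asboolP => // sub /sub.
  have [r r0 H] := oA w Aw.
  have [n nr] : exists n : nat, n.+1%:R^-1 < r / 2.
    have [n _ /(_ n (leqnn n))] := near_infty_natSinv_lt (PosNum (divr_gt0 r0 (ltr0Sn R 1))).
    by exists n.
  have n0 : 0 < n.+1%:R^-1 :> R by rewrite invr_gt0.
  have near_rat (a : R) : exists p : rat, a - n.+1%:R^-1 < ratr p < a + n.+1%:R^-1.
    have ab : a - n.+1%:R^-1 < a + n.+1%:R^-1 by rewrite ltrBlDr -addrA ltrDl addr_gt0.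
    by have [p + ] := rat_in_itvoo ab; rewrite in_itv /=; exists p.
  have [p /andP[p1 p2]] := near_rat w.1; have [q /andP[q1 q2]] := near_rat w.2.
  exists p => //; exists q => //; exists n => //; rewrite /B; move: nr n0 p1 p2 q1 q2.
  set e : R := n.+1%:R^-1 => nr n0 p1 p2 q1 q2; case: asboolP => [_|nB].
    by split; rewrite /= in_itv /=; apply/andP; split; lra.
  exfalso; apply: nB => w' [/=]; rewrite !in_itv /= => /andP[a1 a2] /andP[b1 b2].
  by apply: H; rewrite ltr_norml; apply/andP; split; lra.
apply: bigcupT_measurable_rat => p; apply: bigcupT_measurable_rat => q.
apply: bigcupT_measurable => n; case: ifP => _ //.
by apply: measurableX; exact: measurable_itv.
Qed.

Lemma measurable_continuous_plane (A : set (R * R)) (u : R[i] -> R) :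
  (forall w, A w -> exists2 r : R, 0 < r & forall w', `|w'.1 - w.1| < r ->
     `|w'.2 - w.2| < r -> A w') ->
  (forall w, A w -> forall e : R, 0 < e -> exists2 d : R, 0 < d & forall h : R[i],
     modulus h < d -> `|u (w.1 +i* w.2 + h) - u (w.1 +i* w.2)| < e) ->
  measurable_fun A (fun w : R * R => u (w.1 +i* w.2)).
Proof.
move=> oA cu; apply: (measurability _ (RGenOInfty.measurableE R)).
move=> _ [_ [c ->] <-]; apply: measurable_open_plane => w [Aw /=].
rewrite in_itv /= andbT => cw.
have [r r0 H] := oA w Aw.
have [d d0 H'] := cu w Aw (u (w.1 +i* w.2) - c) ltac:(lra).
exists (Num.min r (d / 2)); first by rewrite lt_min r0 divr_gt0.
move=> w'; rewrite !lt_min => /andP[a1 a2] /andP[b1 b2]; split; first exact: H.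
rewrite /= in_itv /= andbT.
have := H' ((w'.1 - w.1) +i* (w'.2 - w.2)).
have -> : w.1 +i* w.2 + (w'.1 - w.1) +i* (w'.2 - w.2) = w'.1 +i* w'.2.
  by apply/eqP; rewrite eq_complex /=; apply/andP; split; apply/eqP; ring.
rewrite ltr_norml => /(_ _)/andP[|]; last by lra.
by apply: le_lt_trans (modulus_le_ReIm _) _ => /=; lra.
Qed.

Section Tonelli.
Variables (X Y : set R) (f : R * R -> \bar R).
Hypotheses (mX : measurable X) (mY : measurable Y)
  (mf : measurable_fun (X `*` Y) f) (f0 : forall w, (0 <= f w)%E).

Let g := f \_ (X `*` Y).

Let mg : measurable_fun setT g.
Proof. by apply/(measurable_restrictT f) => //; exact: measurableX. Qed.

Let g0 w : (0 <= g w)%E.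
Proof. by rewrite /g patchE; case: ifP. Qed.

Let gX x : X x -> forall y, g (x, y) = ((fun y => f (x, y)) \_ Y) y.
Proof.
move=> Xx y; rewrite /g !patchE.
by have -> : ((x, y) \in X `*` Y) = (y \in Y) by apply/idP/idP; rewrite !inE //= => -[].
Qed.

Let gY y : Y y -> forall x, g (x, y) = ((fun x => f (x, y)) \_ X) x.
Proof.
move=> Yy x; rewrite /g !patchE.
by have -> : ((x, y) \in X `*` Y) = (x \in X) by apply/idP/idP; rewrite !inE //= => -[].
Qed.

Let gXn x : ~ X x -> forall y, g (x, y) = 0%E.
Proof. by move=> nX y; rewrite /g patchE ifF//; apply/negP; rewrite inE => -[]. Qed.

Let gYn y : ~ Y y -> forall x, g (x, y) = 0%E.
Proof. by move=> nX x; rewrite /g patchE ifF//; apply/negP; rewrite inE => -[]. Qed.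

Lemma measurable_tonelli_rectx :
  measurable_fun X (fun x => \int[mu]_(y in Y) f (x, y))%E.
Proof.
have := measurable_fun_fubini_tonelli_F (m2 := (@mu R)) g mg g0.
move=> /(measurable_funS measurableT (@subsetT _ X)); apply: eq_measurable_fun => x /set_mem Xx.
by rewrite /fubini_F [RHS]integral_mkcond; apply: eq_integral => y _; rewrite gX.
Qed.

Lemma measurable_tonelli_recty :
  measurable_fun Y (fun y => \int[mu]_(x in X) f (x, y))%E.
Proof.
have := measurable_fun_fubini_tonelli_G (m1 := (@mu R)) g mg g0.
move=> /(measurable_funS measurableT (@subsetT _ Y)); apply: eq_measurable_fun => x /set_mem Xx.
by rewrite /fubini_G [RHS]integral_mkcond; apply: eq_integral => y _; rewrite gY.
Qed.

Lemma tonelli_rectx :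
  (\int[mu2]_(w in X `*` Y) f w = \int[mu]_(x in X) \int[mu]_(y in Y) f (x, y))%E.
Proof.
rewrite integral_mkcond -/g (fubini_tonelli1 (m1 := (@mu R)) (m2 := (@mu R)) g mg g0).
rewrite [RHS]integral_mkcond; apply: eq_integral => x _; rewrite /fubini_F patchE.
case: ifPn => [|/negP]; rewrite inE => Xx.
  by rewrite [RHS]integral_mkcond; apply: eq_integral => y _; rewrite gX.
by apply: integral0_eq => y _; rewrite gXn.
Qed.

Lemma tonelli_recty :
  (\int[mu2]_(w in X `*` Y) f w = \int[mu]_(y in Y) \int[mu]_(x in X) f (x, y))%E.
Proof.
rewrite integral_mkcond -/g (fubini_tonelli2 (m1 := (@mu R)) (m2 := (@mu R)) g mg g0).
rewrite [RHS]integral_mkcond; apply: eq_integral => y _; rewrite /fubini_G patchE.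
case: ifPn => [|/negP]; rewrite inE => Xx.
  by rewrite [RHS]integral_mkcond; apply: eq_integral => x _; rewrite gY.
by apply: integral0_eq => x _; rewrite gYn.
Qed.

End Tonelli.
End PlaneMeasurability.

(** * Mean value inequalities *)

Definition square (R : realType) (z : R[i]) (r : R) : set (R * R) :=
  `[Re z - r, Re z + r]%classic `*` `[Im z - r, Im z + r]%classic.

Definition plane_disk (R : realType) : set (R * R) :=
  [set w | disk (w.1 +i* w.2)].

Section MeanValue.
Variable R : realType.
Implicit Types (f F : R[i] -> R[i]) (z w : R[i]).

Lemma plane_disk_open (w : R * R) : @plane_disk R w -> exists2 r : R, 0 < r &
  forall w' : R * R, `|w'.1 - w.1| < r -> `|w'.2 - w.2| < r -> @plane_disk R w'.
Proof.
move=> w1; have {}w1 : modulus (w.1 +i* w.2) < 1 := w1.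
exists ((1 - modulus (w.1 +i* w.2)) / 2).
  by rewrite divr_gt0// subr_gt0.
move=> w' a b; rewrite /plane_disk /disk; change (modulus (w'.1 +i* w'.2) < 1).
have -> : w'.1 +i* w'.2 = w.1 +i* w.2 + (w'.1 - w.1) +i* (w'.2 - w.2).
  by apply/eqP; rewrite eq_complex /=; apply/andP; split; apply/eqP; ring.
apply: le_lt_trans (ler_modulusD _ _) _.
have : modulus ((w'.1 - w.1) +i* (w'.2 - w.2)) <= `|w'.1 - w.1| + `|w'.2 - w.2|.
  exact: modulus_le_ReIm.
lra.
Qed.

Lemma measurable_plane_disk : measurable (@plane_disk R).
Proof. by apply: measurable_open_plane; exact: plane_disk_open. Qed.

Lemma measurable_modulus_disk f : (forall z, disk z -> ccont f z) ->
  measurable_fun (@plane_disk R) (fun w : R * R => modulus (f (w.1 +i* w.2))).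
Proof.
move=> cf; apply: (@measurable_continuous_plane _ _ (fun z => modulus (f z))).
  exact: plane_disk_open.
move=> w Dw e e0; have [d d0 H] := cf _ Dw e e0; exists d => // h /H.
apply: le_lt_trans; rewrite ler_norml lerB_modulus andbT.
by rewrite lerNl opprB modulusBC lerB_modulus.
Qed.

Lemma measurable_square z (r : R) : measurable (square z r).
Proof. by apply: measurableX; exact: measurable_itv. Qed.

Lemma square_box z (r : R) (w : R * R) : square z r w <->
  box (Re z - r) (Re z + r) (Im z - r) (Im z + r) (w.1 +i* w.2).
Proof. by rewrite /square /box /= !in_itv /=. Qed.

(** Otherwise the integral over [c, d] alone would be at least 2 K. *)
Lemma exists_below_mean (I : set R) (A : R -> \bar R) (c d K : R) : measurable I ->
  `[c, d] `<=` I -> c < d -> measurable_fun I A -> (forall x, (0 <= A x)%E) -> 0 < K ->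
  (\int[mu]_(x in I) A x <= K%:E)%E ->
  exists2 x, c <= x <= d & (A x <= (2 * K / (d - c))%:E)%E.
Proof.
move=> mI cdI cd mA A0 K0 AK; apply: contrapT => no.
have big x : `[c, d]%classic x -> ((2 * K / (d - c))%:E <= A x)%E.
  rewrite /= in_itv /= => xcd; apply/ltW; rewrite ltNge; apply/negP => le.
  by apply: no; exists x.
have : ((2 * K)%:E <= \int[mu]_(x in I) A x)%E.
  apply: (@le_trans _ _ (\int[mu]_(x in `[c, d]) A x)%E); last first.
    exact: ge0_subset_integral.
  apply: (@le_trans _ _ (\int[mu]_(x in `[c, d]) (2 * K / (d - c))%:E)%E); last first.
    apply: ge0_le_integral => //; last exact: measurable_funS mA.
    by move=> x _; rewrite lee_fin divr_ge0//; lra.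
  rewrite integral_cst//= lebesgue_measure_itv/= lte_fin cd -EFinD -EFinM lee_fin.
  by rewrite divfK// subr_eq0 gt_eqF.
move=> /le_trans/(_ AK); rewrite lee_fin; lra.
Qed.

Lemma cint_le_weighted (a b x1 x2 k T : R) (u v : R -> R[i]) : a <= x1 -> x2 <= b ->
  pcont x1 x2 u -> measurable_fun `[a, b] (fun x => modulus (v x)) -> 0 <= k ->
  (forall x, x1 <= x <= x2 -> modulus (u x) <= k * modulus (v x)) ->
  (\int[mu]_(x in `[a, b]) (modulus (v x))%:E <= T%:E)%E ->
  modulus (cint x1 x2 u) <= 2 * k * T.
Proof.
move=> ax xb cu mv k0 uv vT; rewrite -lee_fin; apply: le_trans (cint_le_int cu) _.
rewrite -mulrA EFinM lee_pmul2l//.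
have sub : (`[x1, x2]%classic : set R) `<=` `[a, b]%classic.
  by move=> x /=; rewrite !in_itv /= => /andP[? ?]; apply/andP; split; lra.
have mv' : measurable_fun `[x1, x2] (fun x => modulus (v x)) by exact: measurable_funS mv.
apply: (@le_trans _ _ (\int[mu]_(x in `[x1, x2]) (k%:E * (modulus (v x))%:E))%E).
  apply: ge0_le_integral => //.
  - by move=> x _; rewrite lee_fin modulus_ge0.
  - by apply/measurable_EFinP; exact: continuous_measurable_itv (pcont_modulus cu).
  - apply/measurable_EFinP; exact: measurable_funM.
rewrite ge0_integralZl//; [|exact/measurable_EFinP|by move=> x _; rewrite lee_fin modulus_ge0].
rewrite EFinM; apply: lee_wpmul2l; first by rewrite lee_fin.
apply: le_trans vT; apply: ge0_subset_integral => //; first exact/measurable_EFinP.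
by move=> x _; rewrite lee_fin modulus_ge0.
Qed.

Lemma left_side (m r x : R) : 0 < r -> m - r <= x <= m - r / 2 ->
  [/\ x < m, r / 2 <= m - x <= r & m - r <= x <= m + r].
Proof. by move=> r0 /andP[a b]; split; [|apply/andP; split|apply/andP; split]; lra. Qed.

Lemma right_side (m r x : R) : 0 < r -> m + r / 2 <= x <= m + r ->
  [/\ m < x, r / 2 <= x - m <= r & m - r <= x <= m + r].
Proof. by move=> r0 /andP[a b]; split; [|apply/andP; split|apply/andP; split]; lra. Qed.

(** The winding integral around z has modulus at least 1 and |w - z| >= r / 2 on the
frame, so Cauchy's formula bounds F z by line integrals of |F| over the sides. *)
Lemma frame_mean_value F z (r T X1 X2 Y1 Y2 : R) : 0 < r ->
  (forall w, box (Re z - r) (Re z + r) (Im z - r) (Im z + r) w -> holo F w) ->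
  Re z - r <= X1 <= Re z - r / 2 -> Re z + r / 2 <= X2 <= Re z + r ->
  Im z - r <= Y1 <= Im z - r / 2 -> Im z + r / 2 <= Y2 <= Im z + r ->
  (\int[mu]_(y in `[(Im z - r)%R, (Im z + r)%R]) (modulus (F (X1 +i* y)))%:E <= T%:E)%E ->
  (\int[mu]_(y in `[(Im z - r)%R, (Im z + r)%R]) (modulus (F (X2 +i* y)))%:E <= T%:E)%E ->
  (\int[mu]_(x in `[(Re z - r)%R, (Re z + r)%R]) (modulus (F (x +i* Y1)))%:E <= T%:E)%E ->
  (\int[mu]_(x in `[(Re z - r)%R, (Re z + r)%R]) (modulus (F (x +i* Y2)))%:E <= T%:E)%E ->
  modulus (F z) <= 16 * T / r.
Proof.
move=> r0 hbox hX1 hX2 hY1 hY2.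
have half0 : 0 < r / 2 by rewrite divr_gt0.
have [X1z dX1 X1in] := left_side r0 hX1; have [zX2 dX2 X2in] := right_side r0 hX2.
have [Y1z dY1 Y1in] := left_side r0 hY1; have [zY2 dY2 Y2in] := right_side r0 hY2.
have [[p1 p2] [p3 p4]] := (andP hX1, andP hX2).
have [[q1 q2] [q3 q4]] := (andP hY1, andP hY2).
have X12 : X1 <= X2 := ltW (lt_trans X1z zX2).
have Y12 : Y1 <= Y2 := ltW (lt_trans Y1z zY2).
have zx : X1 < Re z < X2 by rewrite X1z.
have zy : Y1 < Im z < Y2 by rewrite Y1z.
have sub := sub_box p1 p4 q1 q4.
have dist w : frame X1 X2 Y1 Y2 w -> r / 2 <= modulus (w - z).
  by move=> Fw; exact: frame_distance Fw p2 p3 q2 q3.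
have CF := @cauchy_formula _ X1 X2 Y1 Y2 F z (fun w bw => hbox w (sub w bw)) zx zy.
have W : 1 <= modulus (frame_int (fun w => (w - z)^-1) X1 X2 Y1 Y2).
  apply: le_trans (le_trans (ler_norm _) (Im_le_modulus _)).
  apply: le_trans (frame_int_inv_ge half0 dX1 dX2 dY1 dY2).
  by rewrite le_eqVlt; apply/orP; left; apply/eqP; field; rewrite gt_eqF.
have ker w : frame X1 X2 Y1 Y2 w -> modulus (F w * (w - z)^-1) <= 2 / r * modulus (F w).
  move=> /dist dw; rewrite modulusM mulrC ler_wpM2r ?modulus_ge0// modulusV.
  have -> : 2 / r = (r / 2)^-1 by field; rewrite gt_eqF.
  by rewrite lef_pV2// posrE (lt_le_trans half0).
have cG w : frame X1 X2 Y1 Y2 w -> ccont (fun w => F w * (w - z)^-1) w.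
  move=> Fw; apply: holo_ccont; apply: holoM; first by apply: hbox; apply: sub; exact: frame_box.
  by apply: holo_inv_sub; exact: frame_neq Fw zx zy.
have [c1 c2 c3 c4] := frame_pcont X12 Y12 cG.
have mh y : Im z - r <= y <= Im z + r ->
    measurable_fun `[Re z - r, Re z + r] (fun x => modulus (F (x +i* y))).
  move=> yb; apply: continuous_measurable_itv; apply: pcont_modulus.
  by apply: ccont_pcont_horizontal => x xa; apply: holo_ccont; apply: hbox.
have mv x : Re z - r <= x <= Re z + r ->
    measurable_fun `[Im z - r, Im z + r] (fun y => modulus (F (x +i* y))).
  move=> yb; apply: continuous_measurable_itv; apply: pcont_modulus.
  by apply: ccont_pcont_vertical => y xa; apply: holo_ccont; apply: hbox.
have [[xl _] [_ xr]] := (andP X1in, andP X2in).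
have [[yl _] [_ yr]] := (andP Y1in, andP Y2in).
have k0 : 0 <= 2 / r by rewrite divr_ge0// ltW.
move=> T1 T2 T3 T4.
have E1 := cint_le_weighted xl xr c1 (mh _ Y1in) k0 (fun x hx => ker _ (frame_bottom Y12 hx)) T3.
have E2 := cint_le_weighted yl yr c2 (mv _ X2in) k0 (fun y hy => ker _ (frame_right X12 hy)) T2.
have E3 := cint_le_weighted xl xr c3 (mh _ Y2in) k0 (fun x hx => ker _ (frame_top Y12 hx)) T4.
have E4 := cint_le_weighted yl yr c4 (mv _ X1in) k0 (fun y hy => ker _ (frame_left X12 hy)) T1.
have -> : 16 * T / r = 2 * (2 / r) * T + 2 * (2 / r) * T + 2 * (2 / r) * T + 2 * (2 / r) * T.
  by field; rewrite gt_eqF.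
apply: (@le_trans _ _ (modulus (F z) * modulus (frame_int (fun w => (w - z)^-1) X1 X2 Y1 Y2))).
  by rewrite ler_peMr// modulus_ge0.
rewrite -modulusM -CF /frame_int.
apply: le_trans (ler_modulusB _ _) _; rewrite modulusM modulus_i mul1r.
apply: lerD E4; apply: le_trans (ler_modulusB _ _) _.
apply: lerD E3; apply: le_trans (ler_modulusD _ _) _; rewrite modulusM modulus_i mul1r.
exact: lerD.
Qed.

(** By averaging, each side of the
rectangle in Cauchy's formula can be placed where the line integral of the
modulus is at most a multiple of the area integral. *)
Theorem mean_value_inequality F z (r K : R) : 0 < r -> 0 < K ->
  (forall w, disk w -> holo F w) -> square z r `<=` @plane_disk R ->
  (\int[mu2]_(w in square z r) (modulus (F (w.1 +i* w.2)))%:E <= K%:E)%E ->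
  modulus (F z) <= 64 * K / r ^+ 2.
Proof.
move=> r0 K0 hF sD.
have hbox w : box (Re z - r) (Re z + r) (Im z - r) (Im z + r) w -> holo F w.
  by move=> bw; apply: hF; case: w bw => x y bw; apply: (sD (x, y)); apply/square_box.
pose T := 4 * K / r.
have TE : 2 * K / (r / 2) = T by rewrite /T; field; rewrite gt_eqF.
have half (m c : R) (A : R -> \bar R) : m - r <= c -> c + r / 2 <= m + r ->
    measurable_fun `[m - r, m + r] A -> (forall x, (0 <= A x)%E) ->
    (\int[mu]_(x in `[(m - r)%R, (m + r)%R]) A x <= K%:E)%E ->
    exists2 x, c <= x <= c + r / 2 & (A x <= T%:E)%E.
  move=> c1 c2 mA A0 AK.
  have cd : c < c + r / 2 by rewrite ltrDl divr_gt0.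
  have sub : (`[c, c + r / 2]%classic : set R) `<=` `[m - r, m + r].
    by move=> x /=; rewrite !in_itv /= => /andP[? ?]; apply/andP; split; lra.
  have [x xc xT] := exists_below_mean (measurable_itv _) sub cd mA A0 K0 AK.
  by exists x => //; rewrite -TE; move: xT; rewrite [c + _ - c]addrC addKr.
have l1 (m : R) : m - r <= m - r by [].
have l2 (m : R) : m - r + r / 2 <= m + r by lra.
have l3 (m : R) : m - r <= m + r / 2 by lra.
have l4 (m : R) : m + r / 2 + r / 2 <= m + r by lra.
have hl (m : R) : m - r + r / 2 = m - r / 2 by lra.
have hr (m : R) : m + r / 2 + r / 2 = m + r by lra.
have mU : measurable_fun (square z r) (fun w : R * R => (modulus (F (w.1 +i* w.2)))%:E).
  apply/measurable_EFinP; apply: measurable_funS (measurable_plane_disk) sD _.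
  by apply: measurable_modulus_disk => w /hF /holo_ccont.
have U0 (w : R * R) : (0 <= (modulus (F (w.1 +i* w.2)))%:E)%E by rewrite lee_fin modulus_ge0.
have mI (c d : R) : measurable `[c, d]%classic by exact: measurable_itv.
have mx := measurable_tonelli_rectx (mI _ _) (mI _ _) mU U0.
have my := measurable_tonelli_recty (mI _ _) (mI _ _) mU U0.
have A0 (x : R) : (0 <= \int[mu]_(y in `[(Im z - r)%R, (Im z + r)%R]) (modulus (F (x +i* y)))%:E)%E.
  by apply: integral_ge0 => y _; rewrite lee_fin modulus_ge0.
have B0 (y : R) : (0 <= \int[mu]_(x in `[(Re z - r)%R, (Re z + r)%R]) (modulus (F (x +i* y)))%:E)%E.
  by apply: integral_ge0 => x _; rewrite lee_fin modulus_ge0.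
move=> IK; have Ix := IK; rewrite (tonelli_rectx (mI _ _) (mI _ _) mU U0) in Ix.
have Iy := IK; rewrite (tonelli_recty (mI _ _) (mI _ _) mU U0) in Iy.
have [X1 X1in T1] := half _ _ _ (l1 (Re z)) (l2 (Re z)) mx A0 Ix; rewrite hl in X1in.
have [X2 X2in T2] := half _ _ _ (l3 (Re z)) (l4 (Re z)) mx A0 Ix; rewrite hr in X2in.
have [Y1 Y1in T3] := half _ _ _ (l1 (Im z)) (l2 (Im z)) my B0 Iy; rewrite hl in Y1in.
have [Y2 Y2in T4] := half _ _ _ (l3 (Im z)) (l4 (Im z)) my B0 Iy; rewrite hr in Y2in.
have -> : 64 * K / r ^+ 2 = 16 * T / r by rewrite /T; field; rewrite gt_eqF.
exact: frame_mean_value r0 hbox X1in X2in Y1in Y2in T1 T2 T3 T4.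
Qed.

End MeanValue.

Section PowerMeanValue.
Variable R : realType.
Implicit Types (f F : R[i] -> R[i]) (z w : R[i]).

Lemma continuous_box_bounded F (X1 X2 Y1 Y2 : R) : X1 <= X2 -> Y1 <= Y2 ->
  (forall w, box X1 X2 Y1 Y2 w -> ccont F w) ->
  exists M : R, forall w, box X1 X2 Y1 Y2 w -> modulus (F w) <= M.
Proof.
move=> X12 Y12 cF.
pose good (x1 x2 y1 y2 : R) := exists M : R, forall w, box x1 x2 y1 y2 w -> modulus (F w) <= M.
apply: (@rectangle_bisection _ good) => //.
  move=> x1 x2 y1 y2 _ _ _ _ _ _ [M1 H1] [M2 H2] [M3 H3] [M4 H4].
  exists (Num.max (Num.max M1 M2) (Num.max M3 M4)) => w [/andP[a b] /andP[c d]].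
  rewrite !le_max.
  have [xl|xl] := leP (Re w) ((x1 + x2) / 2); have [yl|yl] := leP (Im w) ((y1 + y2) / 2).
  - by rewrite H1//; split; apply/andP; split=> //; lra.
  - by rewrite H3 ?orbT//; split; apply/andP; split=> //; lra.
  - by rewrite H2 ?orbT//; split; apply/andP; split=> //; lra.
  - by rewrite H4 ?orbT//; split; apply/andP; split=> //; lra.
move=> p bp; have [d d0 H] := cF p bp 1 ltr01.
exists (d / 2); first by rewrite divr_gt0.
move=> x1 x2 y1 y2 _ _ _ _ bp' wx wy.
exists (modulus (F p) + 1) => w bw.
have md : modulus (w - p) < d by apply: le_lt_trans (box_diameter bp' bw) _; lra.
have := H _ md; rewrite [p + _]addrC subrK => H'.
by have := lerB_modulus (F w) (F p); lra.
Qed.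

Definition inner_distance (z : R[i]) (r : R) (w : R[i]) : R :=
  r - Num.max `|Re w - Re z| `|Im w - Im z|.

(** The supremum M of
|F| delta^(2/p), with delta the distance to the boundary of the square, bounds
itself: on the square of half side rho = delta/2 around a point where the
supremum is nearly reached, |F| is at most y = M rho^(-2/p), so there
|F| <= |F|^p y^(1-p), and the mean value inequality gives M <= C K M^(1-p). *)
Theorem power_mean_value (p r K : R) : 0 < p -> p <= 1 -> 0 < r -> 0 < K ->
  exists2 C : R, 0 <= C & forall F z,
    (forall w, disk w -> holo F w) -> square z r `<=` @plane_disk R ->
    (\int[mu2]_(w in square z r) (modulus (F (w.1 +i* w.2)) `^ p)%:E <= K%:E)%E ->
    modulus (F z) <= C.
Proof.
move=> p0 p1 r0 K0.
pose beta := 2 / p.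
have beta0 : 0 < beta by rewrite divr_gt0.
pose M0 := (128 * 2 `^ beta * K) `^ p^-1.
exists (M0 / r `^ beta); first by rewrite divr_ge0// powR_ge0.
move=> F z hF sD IK.
have hbox w : box (Re z - r) (Re z + r) (Im z - r) (Im z + r) w -> disk w.
  by case: w => x y bw; apply: (sD (x, y)); apply/square_box.
set B := box _ _ _ _ in hbox.
have [B1 HB] : exists M : R, forall w, B w -> modulus (F w) <= M.
  by apply: continuous_box_bounded; [lra|lra|move=> w /hbox /hF /holo_ccont].
pose delta := inner_distance z r.
have deltaE w : B w <-> 0 <= delta w.
  rewrite /delta /inner_distance subr_ge0 ge_max /B /box /= !ler_distl.
  by split=> [[-> ->]|/andP[-> ->]].
have delta_le w : delta w <= r.
  by rewrite /delta /inner_distance gerBl le_max normr_ge0.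
pose S := [set modulus (F w) * delta w `^ beta | w in B].
have Bz : B z by apply/deltaE; rewrite /delta /inner_distance !subrr normr0 maxxx; lra.
have S_ub : has_ubound S.
  exists (B1 * r `^ beta) => _ [w Bw <-].
  apply: ler_pM; rewrite ?modulus_ge0 ?powR_ge0//; first exact: HB.
  by apply: ge0_ler_powR; rewrite ?nnegrE//; [exact: ltW|exact/deltaE|exact: ltW].
have S_sup : has_sup S by split=> //; exists (modulus (F z) * delta z `^ beta); exists z.
pose M := sup S.
have SM w : B w -> modulus (F w) * delta w `^ beta <= M.
  by move=> Bw; apply: ub_le_sup => //; exists w.
have dz : delta z = r by rewrite /delta /inner_distance !subrr normr0 maxxx subr0.
rewrite ler_pdivlMr ?powR_gt0// -{1}dz; apply: le_trans (SM z Bz) _.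
have M_ge0 : 0 <= M by apply: le_trans (SM z Bz); rewrite mulr_ge0 ?modulus_ge0 ?powR_ge0.
have [M_0|Mn0] := eqVneq M 0; first by rewrite M_0 powR_ge0.
have M_gt0 : 0 < M by rewrite lt_neqAle eq_sym Mn0.
have [_ [w Bw <-] wM] := sup_adherent (divr_gt0 M_gt0 (ltr0Sn R 1)) S_sup.
rewrite -/M in wM.
have {}wM : M / 2 < modulus (F w) * delta w `^ beta by lra.
have dw0 : 0 < delta w.
  rewrite lt_neqAle; move/deltaE : (Bw) => ->; rewrite andbT eq_sym; apply/eqP => E.
  by move: wM; rewrite E powR0 ?gt_eqF// mulr0; lra.
pose rho := delta w / 2; have rho0 : 0 < rho by rewrite divr_gt0.
have subB w' : box (Re w - rho) (Re w + rho) (Im w - rho) (Im w + rho) w' -> rho <= delta w'.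
  rewrite /box /= -!ler_distl => -[h1 h2]; rewrite /delta /inner_distance lerBrDl -lerBrDr ge_max.
  have : Num.max `|Re w - Re z| `|Im w - Im z| = r - 2 * rho.
    by rewrite /rho /delta /inner_distance; lra.
  move=> E; have : Num.max `|Re w - Re z| `|Im w - Im z| <= r - 2 * rho by rewrite E.
  rewrite ge_max => /andP[e1 e2]; apply/andP; split.
  - by apply: le_trans (ler_distD (Re w) _ _) _; clear -h1 e1; lra.
  - by apply: le_trans (ler_distD (Im w) _ _) _; clear -h2 e2; lra.
have subsq : square w rho `<=` square z r.
  move=> v /square_box /subB dv; apply/square_box; apply/deltaE.
  by apply: le_trans dv; exact: ltW.
pose y := M / rho `^ beta.
have y0 : 0 < y by rewrite divr_gt0// powR_gt0.
have Fy w' : box (Re w - rho) (Re w + rho) (Im w - rho) (Im w + rho) w' -> modulus (F w') <= y.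
  move=> /subB dv; rewrite ler_pdivlMr ?powR_gt0//.
  have Bw' : B w' by apply/deltaE; apply: le_trans dv; exact: ltW.
  apply: le_trans (SM w' Bw'); rewrite ler_wpM2l ?modulus_ge0//.
  by apply: ge0_ler_powR => //; rewrite ?nnegrE ltW//; exact: lt_le_trans dv.
have mF : measurable_fun (@plane_disk R) (fun w : R * R => modulus (F (w.1 +i* w.2))).
  by apply: measurable_modulus_disk => v /hF /holo_ccont.
have mFp : measurable_fun (square z r) (fun w : R * R => modulus (F (w.1 +i* w.2)) `^ p).
  apply: (measurableT_comp (measurable_powR p)).
  exact: measurable_funS (@measurable_plane_disk R) sD mF.
have mz := measurable_square z r; have mw := measurable_square w rho.
have Ky : (\int[mu2]_(v in square w rho) (modulus (F (v.1 +i* v.2)))%:E <= (y / y `^ p * K)%:E)%E.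
  apply: (@le_trans _ _ (\int[mu2]_(v in square w rho)
     ((y / y `^ p)%:E * (modulus (F (v.1 +i* v.2)) `^ p)%:E))%E).
    apply: ge0_le_integral => //.
    - by move=> v _; rewrite lee_fin modulus_ge0.
    - apply/measurable_EFinP; apply: measurable_funS (@measurable_plane_disk R) _ mF.
      exact: subset_trans subsq sD.
    - apply/measurable_EFinP; apply: measurable_funM => //.
      exact: measurable_funS mFp.
    move=> v /square_box Hv; rewrite -EFinM lee_fin.
    have Fv := Fy _ Hv.
    have [F0|Fn0] := eqVneq (modulus (F (v.1 +i* v.2))) 0.
      by rewrite F0 mulr_ge0 ?powR_ge0// divr_ge0 ?powR_ge0// ltW.
    have Fg0 : 0 < modulus (F (v.1 +i* v.2)) by rewrite lt_neqAle eq_sym Fn0 modulus_ge0.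
    rewrite mulrAC ler_pdivlMr ?powR_gt0//.
    set t := modulus _ in Fv Fg0 *.
    have split_power (x : R) : 0 < x -> x = x `^ p * x `^ (1 - p).
      move=> x0; rewrite -powRD; last by apply/implyP => _; exact: lt0r_neq0.
      by rewrite [p + _]addrC subrK powRr1 ?ltW.
    have tE := split_power t Fg0; have yE := split_power y y0.
    rewrite {1}tE {2}yE.
    rewrite [leRHS](_ : _ = t `^ p * y `^ (1 - p) * y `^ p); last by ring.
    rewrite ler_wpM2r ?powR_ge0// ler_wpM2l ?powR_ge0//.
    by apply: ge0_ler_powR; rewrite ?nnegrE ?subr_ge0// ltW.
  rewrite ge0_integralZl//; last first.
  - by rewrite lee_fin divr_ge0 ?powR_ge0// ltW.
  - by move=> v _; rewrite lee_fin powR_ge0.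
  - by apply/measurable_EFinP; exact: measurable_funS mFp.
  rewrite [leRHS]EFinM; apply: lee_wpmul2l; first by rewrite lee_fin divr_ge0 ?powR_ge0// ltW.
  apply: le_trans IK; apply: ge0_subset_integral => //; first exact/measurable_EFinP.
  by move=> v _; rewrite lee_fin powR_ge0.
have yp0 : 0 < y `^ p by rewrite powR_gt0.
have K'0 : 0 < y / y `^ p * K by rewrite mulr_gt0// divr_gt0.
have MV := mean_value_inequality rho0 K'0 hF (subset_trans subsq sD) Ky.
have two0 : 0 < 2 `^ beta :> R by rewrite powR_gt0.
have rb0 : 0 < rho `^ beta by rewrite powR_gt0.
have dE : delta w `^ beta = 2 `^ beta * rho `^ beta.
  rewrite -powRM ?ltW//; congr (_ `^ _); rewrite /rho; lra.
have ME : M = y * rho `^ beta by rewrite /y divfK// gt_eqF.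
have MpE : M `^ p = y `^ p * rho ^+ 2.
  rewrite ME powRM ?ltW// -powRrM; congr (_ * _).
  by rewrite /beta divfK ?gt_eqF// powR_mulrn// ltW.
have key : M `^ p <= 128 * 2 `^ beta * K.
  move: wM; rewrite dE {1}ME.
  have : modulus (F w) * (2 `^ beta * rho `^ beta) <=
     64 * (y / y `^ p * K) / rho ^+ 2 * (2 `^ beta * rho `^ beta).
    by rewrite ler_wpM2r// mulr_ge0// ltW.
  move=> L1 L2; have {L1 L2}L := lt_le_trans L2 L1.
  rewrite MpE; apply/ltW.
  have r20 : 0 < rho ^+ 2 by rewrite exprn_gt0.
  have E1 : 64 * (y / y `^ p * K) / rho ^+ 2 * (2 `^ beta * rho `^ beta) * (2 * (y `^ p * rho ^+ 2))
     = (128 * 2 `^ beta * K) * (y * rho `^ beta).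
    by field; rewrite !gt_eqF.
  have E2 : y * rho `^ beta / 2 * (2 * (y `^ p * rho ^+ 2)) = (y `^ p * rho ^+ 2) * (y * rho `^ beta).
    by field.
  have P : 0 < 2 * (y `^ p * rho ^+ 2) by rewrite !mulr_gt0.
  move: L; rewrite -(ltr_pM2r P) E1 E2 ltr_pM2r//.
  by rewrite mulr_gt0.
rewrite /M0 -(powRr1 M_ge0) -{1}(mulfV (lt0r_neq0 p0)) powRrM.
apply: ge0_ler_powR => //; rewrite ?nnegrE ?powR_ge0 ?invr_ge0 ?ltW//.
by rewrite !mulr_gt0.
Qed.

End PowerMeanValue.

(** * Point evaluations are bounded *)

Definition Fdensity (R : realType) (p q s : R) (f : R[i] -> R[i]) (a z : R[i]) : R :=
  modulus (cderiv f z) `^ p * (1 - modulus z ^+ 2) `^ q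
      * (1 - modulus (mobius a z) ^+ 2) `^ s.

(** The p-th power of the seminorm. *)
Definition Fsup (R : realType) (p q s : R) (f : R[i] -> R[i]) : \bar R :=
  ereal_sup [set disk_integral (Fdensity p q s f a) | a in @disk R].

Section PointEvaluation.
Variable R : realType.
Implicit Types (f F : R[i] -> R[i]) (z w a : R[i]).

Lemma disk0 : @disk R 0.
Proof. by change (modulus (0 : R[i]) < 1); rewrite modulus0. Qed.

Lemma Fdensity_ge0 (p q s : R) f a z : 0 <= Fdensity p q s f a z.
Proof. by rewrite !mulr_ge0 ?powR_ge0. Qed.

Lemma disk_integral_ge0 (u : R[i] -> R) : (forall z, 0 <= u z) -> (0 <= disk_integral u)%E.
Proof.
move=> u0; rewrite /disk_integral mule_ge0 ?lee_fin ?invr_ge0 ?pi_ge0//.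
by apply: integral_ge0 => w _; rewrite lee_fin.
Qed.

Lemma Fsup_ubound (p q s : R) f a : disk a ->
  (disk_integral (Fdensity p q s f a) <= Fsup p q s f)%E.
Proof. by move=> Da; apply: ereal_sup_ubound; exists a. Qed.

Lemma Fsup_ge0 (p q s : R) f : (0 <= Fsup p q s f)%E.
Proof.
apply: le_trans (Fsup_ubound p q s f disk0).
by apply: disk_integral_ge0; exact: Fdensity_ge0.
Qed.

Lemma Fseminorm_ge0 (p q s : R) f : (0 <= Fseminorm p q s f)%E.
Proof. exact: poweR_ge0. Qed.

Lemma Fseminorm_le (p q s M : R) f : 0 < p -> 0 <= M ->
  (Fseminorm p q s f <= M%:E)%E <-> (Fsup p q s f <= (M `^ p)%:E)%E.
Proof.
move=> p0 M0; rewrite /Fseminorm -/(Fsup p q s f).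
have S0 := Fsup_ge0 p q s f.
have pV0 : 0 <= p^-1 by rewrite invr_ge0 ltW.
have pn : p != 0 by exact: lt0r_neq0.
split=> H.
- have : (poweR (poweR (Fsup p q s f) p^-1) p <= poweR M%:E p)%E.
    by apply: gt0_ler_poweR (ltW p0) _ _ _ _ H; rewrite in_itv /= ?leey ?andbT ?lee_fin ?poweR_ge0.
  by rewrite -poweRrM mulVf// poweRe1// poweR_EFin.
- have : (poweR (Fsup p q s f) p^-1 <= poweR (M `^ p)%:E p^-1)%E.
    by apply: gt0_ler_poweR pV0 _ _ _ _ H; rewrite in_itv /= ?leey ?andbT ?lee_fin ?powR_ge0.
  by rewrite poweR_EFin -powRrM mulfV// powRr1.
Qed.

Lemma box_disk z (r : R) w : modulus z + 2 * r < 1 ->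
  box (Re z - r) (Re z + r) (Im z - r) (Im z + r) w -> modulus w <= modulus z + 2 * r.
Proof.
move=> zr [/andP[a1 a2] /andP[b1 b2]].
rewrite -(subrK z w) addrC; apply: le_trans (ler_modulusD _ _) _; rewrite lerD2l.
apply: le_trans (modulus_le_ReIm _) _; rewrite ReB ImB.
have : `|Re w - Re z| <= r by rewrite ler_norml; apply/andP; split; lra.
have : `|Im w - Im z| <= r by rewrite ler_norml; apply/andP; split; lra.
lra.
Qed.

Lemma analytic_cdiff f z : analytic_disk f -> disk z -> cdiff f z (cderiv f z).
Proof. by move=> hf Dz; apply: derivable_cdiff; exact: hf. Qed.

Lemma analytic_holo f z : analytic_disk f -> disk z -> holo f z.
Proof. by move=> hf Dz; exists (cderiv f z); exact: analytic_cdiff. Qed.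

Lemma analytic_holo_cderiv f z : analytic_disk f -> disk z -> holo (cderiv f) z.
Proof.
move=> hf Dz; have z1 : modulus z < 1 := Dz.
apply: (@holo_cderiv _ f z ((1 - modulus z) / 4)); first by rewrite divr_gt0// subr_gt0.
move=> w bw; apply: analytic_holo => //.
have zr : modulus z + 2 * ((1 - modulus z) / 4) < 1 by lra.
exact: le_lt_trans (box_disk zr bw) zr.
Qed.

Lemma powR_ge_power (m t e : R) : 0 < m -> m <= t -> t <= 1 -> m `^ `|e| <= t `^ e.
Proof.
move=> m0 mt t1; have t0 : 0 < t by exact: lt_le_trans mt.
apply: (@le_trans _ _ (t `^ `|e|)).
  by apply: ge0_ler_powR; rewrite ?nnegrE// ltW.
by apply: ger_powR; rewrite ?t0// ler_norm.
Qed.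

Lemma min1_powR_le (p t : R) : 0 < p -> 0 <= t -> t `^ (Num.min p 1) <= 1 + t `^ p.
Proof.
move=> p0 t0; have [p1|p1] := leP p 1; first by rewrite lerDr.
rewrite powRr1//; have [t1|t1] := leP t 1; first by apply: le_trans t1 _; rewrite lerDl powR_ge0.
by apply: le_trans (le1r_powR (ltW t1) (ltW p1)) _; rewrite lerDr.
Qed.

Lemma mobius0 z : mobius 0 z = - z.
Proof. by rewrite /mobius rmorph0 mul0r subr0 divr1 sub0r. Qed.

Lemma conjE a : (a^*)%R = Re a -i* Im a.
Proof. by case: a. Qed.

Lemma modulus_conj a : modulus (a^*)%R = modulus a.
Proof. by case: a => x y; rewrite conjE /modulus /= sqrrN. Qed.

Lemma mobius_denominator_neq0 a z : disk a -> disk z -> 1 - (a^*)%R * z != 0.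
Proof.
move=> Da Dz; have a1 : modulus a < 1 := Da; have z1 : modulus z < 1 := Dz.
apply/eqP => E; have : modulus ((a^*)%R * z) = 1.
  by move/eqP: E; rewrite subr_eq0 => /eqP <-; rewrite modulus1.
rewrite modulusM modulus_conj.
have := modulus_ge0 a; have := modulus_ge0 z; nra.
Qed.

Lemma holo_mobius a z : disk a -> disk z -> holo (mobius a) z.
Proof.
move=> Da Dz.
have d : cdiff (fun w => 1 - (a^*)%R * w) z (0 - (a^*)%R * 1).
  by apply: cdiffB; [exact: cdiff_cst|exact: cdiffZ (cdiff_id z)].
eexists; apply: cdiffM; first exact: cdiffB (cdiff_cst a z) (cdiff_id z).
exact: cdiffV d (mobius_denominator_neq0 Da Dz).
Qed.

Lemma measurable_Fdensity (p q s : R) f a : analytic_disk f -> disk a ->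
  measurable_fun (@plane_disk R) (fun w : R * R => Fdensity p q s f a (w.1 +i* w.2)).
Proof.
move=> hf Da.
have mF : measurable_fun (@plane_disk R) (fun w : R * R => modulus (cderiv f (w.1 +i* w.2))).
  by apply: measurable_modulus_disk => w Dw; apply: holo_ccont; exact: analytic_holo_cderiv.
have mm g e : (forall z, disk z -> holo g z) -> measurable_fun (@plane_disk R)
    (fun w : R * R => (1 - modulus (g (w.1 +i* w.2)) ^+ 2) `^ e).
  move=> hg; apply: (measurableT_comp (measurable_powR e)).
  apply: measurable_funB => //; apply: measurable_funX.
  by apply: measurable_modulus_disk => w /hg /holo_ccont.
apply: measurable_funM; first apply: measurable_funM.
- exact: (measurableT_comp (measurable_powR p)).
- by apply: (mm id) => z _; exists 1; exact: cdiff_id.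
- by apply: (mm (mobius a)) => z Dz; exact: holo_mobius.
Qed.

Lemma modulus_ray (t k : R) a : modulus a < 1 -> modulus (k%:C * a) <= `|k|.
Proof. by move=> a1; rewrite modulusM modulus_real ler_piMr// ltW. Qed.

(** On the disk of radius rho < 1 the weight of the integral for the parameter 0
is bounded below, so the seminorm controls the area integral of |f'|^p there. The
mean value inequality, for the exponent min p 1 after t^(min p 1) <= 1 + t^p, then
bounds f' on the disk of radius |a|, and integration along the ray from 0 to a
bounds f a. *)
Theorem point_evaluation (p q s : R) a : 0 < p -> disk a ->
  exists2 B : R, 0 <= B & forall f, analytic_disk f ->
    (Fnorm p q s f <= 1%E)%E -> modulus (f a) <= B.
Proof.
move=> p0 Da; have a1 : modulus a < 1 := Da.
have a0 := modulus_ge0 a.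
(* squares of half side r around points of modulus at most |a| lie in the disk
   of radius rho *)
pose r := (1 - modulus a) / 8; have r0 : 0 < r by rewrite divr_gt0// subr_gt0.
pose rho := (1 + modulus a) / 2.
have rho0 : 0 < rho by rewrite /rho; lra.
have rho1 : rho < 1 by rewrite /rho; lra.
pose m := 1 - rho ^+ 2.
have rho2 : rho ^+ 2 < 1 by rewrite expr_lt1// ltW.
have m0 : 0 < m by rewrite /m subr_gt0.
pose c := m `^ `|q| * m `^ `|s|.
have c0 : 0 < c by rewrite mulr_gt0// powR_gt0.
pose p' := Num.min p 1.
have p'0 : 0 < p' by rewrite lt_min p0 ltr01.
have p'1 : p' <= 1 by rewrite ge_min lexx orbT.
pose K := 4 * r ^+ 2 + pi / c + 1.
have K0 : 0 < K.
  have h1 : 0 <= 4 * r ^+ 2 by rewrite mulr_ge0// sqr_ge0.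
  have h2 : 0 <= pi / c by rewrite divr_ge0 ?pi_ge0// ltW.
  by rewrite /K; lra.
have [C C0 HC] := @power_mean_value R p' r K p'0 p'1 r0 K0.
exists (1 + 2 * C); first by rewrite addr_ge0 ?mulr_ge0.
move=> f hf Nf.
have f0 : modulus (f 0) <= 1.
  rewrite -lee_fin; apply: le_trans Nf; rewrite /Fnorm leeDl//; exact: Fseminorm_ge0.
have Sf : (Fsup p q s f <= 1)%E.
  have := (@Fseminorm_le p q s 1 f p0 ler01).1; rewrite powR1; apply.
  by apply: le_trans Nf; rewrite /Fnorm leeDr// lee_fin modulus_ge0.
set F := cderiv f.
have hF w : disk w -> holo F w by move=> Dw; exact: analytic_holo_cderiv.
have cF w : disk w -> ccont F w by move=> /hF /holo_ccont.
have mF := measurable_modulus_disk cF.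
have mFp e : measurable_fun (@plane_disk R) (fun w : R * R => modulus (F (w.1 +i* w.2)) `^ e).
  exact: (measurableT_comp (measurable_powR e)).
have mD := @measurable_plane_disk R.
have weight w : modulus w <= rho -> c * modulus (F w) `^ p <= Fdensity p q s f 0 w.
  move=> wr; rewrite /Fdensity mobius0 modulusN -mulrA mulrC ler_wpM2l ?powR_ge0//.
  have wm : m <= 1 - modulus w ^+ 2.
    by rewrite lerD2l lerN2 ler_pXn2r// ?nnegrE ?modulus_ge0// ltW.
  have w1 : 1 - modulus w ^+ 2 <= 1 by rewrite gerBl sqr_ge0.
  by apply: ler_pM; rewrite ?powR_ge0// powR_ge_power.
have Fbound z : modulus z <= modulus a -> modulus (F z) <= C.
  move=> za; have zr : modulus z + 2 * r < 1 by rewrite /r; lra.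
  have sq_rho (w : R * R) : square z r w -> modulus (w.1 +i* w.2) <= rho.
    by move=> /square_box /(box_disk zr); rewrite /rho /r; lra.
  have sD : square z r `<=` @plane_disk R by move=> w /sq_rho wr; exact: le_lt_trans wr rho1.
  apply: HC => //.
  have mS := measurable_square z r.
  have mFS e := measurable_funS mD sD (mFp e).
  apply: (@le_trans _ _ (\int[mu2]_(w in square z r) (1 + (modulus (F (w.1 +i* w.2)) `^ p)%:E))%E).
    apply: ge0_le_integral => //.
    - by move=> w _; rewrite lee_fin powR_ge0.
    - by apply/measurable_EFinP; exact: mFS.
    - by apply: emeasurable_funD => //; apply/measurable_EFinP; exact: mFS.
    - by move=> w _; rewrite -EFinD lee_fin min1_powR_le ?modulus_ge0.
  rewrite ge0_integralD//; last 2 first.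
  - by move=> w _; rewrite lee_fin powR_ge0.
  - by apply/measurable_EFinP; exact: mFS.
  have area : (\int[mu2]_(w in square z r) 1 = (4 * r ^+ 2)%:E)%E.
    rewrite integral_cst// mul1e.
    have := @product_measure1E _ _ _ _ R (@mu R) (@mu R) `[Re z - r, Re z + r]%classic
      `[Im z - r, Im z + r]%classic (measurable_itv _) (measurable_itv _).
    move=> /= ->.
    rewrite !lebesgue_measure_itv /= !lte_fin.
    have lt1 (x : R) : x - r < x + r by lra.
    by rewrite !lt1 -!EFinD -EFinM; congr EFin; ring.
  rewrite area.
  have A : (\int[mu2]_(w in square z r) (modulus (F (w.1 +i* w.2)) `^ p)%:E <= (pi / c)%:E)%E.
    have I1 : (disk_integral (Fdensity p q s f 0%R) <= 1)%E.
      exact: le_trans (Fsup_ubound p q s f disk0) Sf.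
    have I2 : (\int[mu2]_(w in @plane_disk R) (Fdensity p q s f 0%R (w.1 +i* w.2))%:E <= pi%:E)%E.
      move: I1; rewrite /disk_integral -/(@plane_disk R) => /(lee_wpmul2l (ltW (pi_gt0 R) : (0 <= (pi : R)%:E)%E)).
      by rewrite muleA -EFinM mulfV ?gt_eqF ?pi_gt0// mul1e mule1.
    have mFd := measurable_Fdensity p q s hf disk0.
    have c0' : c != 0 by exact: lt0r_neq0.
    have cV0 : 0 < c^-1 by rewrite invr_gt0.
    rewrite mulrC EFinM; apply: le_trans (lee_wpmul2l (ltW cV0 : (0 <= c^-1%:E)%E) I2).
    have J : (c%:E * \int[mu2]_(w in square z r) (modulus (F (w.1 +i* w.2)) `^ p)%:E <=
      \int[mu2]_(w in @plane_disk R) (Fdensity p q s f 0%R (w.1 +i* w.2))%:E)%E.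
      rewrite -ge0_integralZl//; last 3 first.
      - by apply/measurable_EFinP; exact: mFS.
      - by move=> w _; rewrite lee_fin powR_ge0.
      - by rewrite lee_fin ltW.
      apply: (@le_trans _ _ (\int[mu2]_(w in square z r) (Fdensity p q s f 0%R (w.1 +i* w.2))%:E)%E).
        apply: ge0_le_integral => //.
        - by move=> w _; rewrite -EFinM lee_fin mulr_ge0 ?powR_ge0// ltW.
        - by apply/measurable_EFinP; apply: measurable_funM => //; exact: mFS.
        - by apply/measurable_EFinP; exact: measurable_funS mFd.
        - by move=> w /sq_rho wr; rewrite -EFinM lee_fin weight.
      apply: ge0_subset_integral => //; first exact/measurable_EFinP.
      by move=> w _; rewrite lee_fin Fdensity_ge0.
    apply: le_trans (lee_wpmul2l (ltW cV0 : (0 <= c^-1%:E)%E) J).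
    by rewrite muleA -EFinM mulVf// mul1e.
  apply: le_trans (leeD2l _ A) _; rewrite -EFinD lee_fin /K.
  lra.
pose u (t : R) := F (t%:C * a) * a.
have ray_disk (t : R) : 0 <= t <= 1 -> modulus (t%:C * a) <= modulus a.
  move=> /andP[t0 t1]; rewrite modulusM modulus_real ger0_norm//.
  by rewrite ler_piMl.
have shift (t k : R) : (t + k)%:C * a = t%:C * a + k%:C * a by rewrite rmorphD mulrDl.
have cu : pcont 0 1 u.
  move=> t t01 e e0.
  have [d d0 H] := cF _ (le_lt_trans (ray_disk t t01) a1) e e0.
  exists d => // k kd; rewrite /u shift -mulrBl modulusM.
  apply: le_lt_trans (H (k%:C * a) _); first by rewrite ler_piMr ?modulus_ge0// ltW.
  by apply: le_lt_trans kd; exact: modulus_ray.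
have E : cint 0 1 u = f a - f 0.
  rewrite (@cint_FTC _ _ _ _ (fun t : R => f (t%:C * a)))//; first by rewrite mul1r mul0r.
  move=> t t01 e e0.
  have [d d0 H] := analytic_cdiff hf (le_lt_trans (ray_disk t t01) a1) e0.
  exists d => // k kd; rewrite shift /u.
  have ka : modulus (k%:C * a) <= `|k| by exact: modulus_ray.
  have := H (k%:C * a) (le_lt_trans ka kd).
  rewrite -[_ * a * k%:C]mulrA [a * k%:C]mulrC; move=> /le_trans; apply.
  by rewrite ler_wpM2l// ltW.
have B : modulus (cint 0 1 u) <= 2 * C * (1 - 0).
  apply: cint_bound => // t t01; rewrite modulusM.
  apply: le_trans (Fbound _ (ray_disk t t01)).
  by rewrite ler_piMr ?modulus_ge0// ltW.
have -> : f a = f 0 + (f a - f 0) by rewrite addrC subrK.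
by apply: le_trans (ler_modulusD _ _) _; rewrite -E; lra.
Qed.

End PointEvaluation.

(** * A uniform bound for the integral of the weight *)

(** A measurable majorant of |v - c|^(-sigma), sigma < 1, with an integral that
is bounded independently of the centre: a sum over dyadic intervals. Being
+oo at the centre, it dominates m^(-sigma) whenever |v - c| <= m <= 2. *)
Definition dyadic_kernel (R : realType) (sigma c v : R) : \bar R :=
  (\sum_(0 <= n <oo) ((2 `^ sigma) ^+ n *
      \1_(`[(c - 2 / 2 ^+ n)%R, (c + 2 / 2 ^+ n)%R]%classic) v)%:E)%E.

Section DyadicKernel.
Variable R : realType.
Implicit Types (sigma c v m : R).

Lemma dyadic_term_ge0 sigma c v n : (0 <= ((2 `^ sigma) ^+ n *
      \1_(`[(c - 2 / 2 ^+ n)%R, (c + 2 / 2 ^+ n)%R]%classic) v)%:E)%E.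
Proof. by rewrite lee_fin mulr_ge0// exprn_ge0// powR_ge0. Qed.

Lemma dyadic_kernel_ge0 sigma c v : (0 <= dyadic_kernel sigma c v)%E.
Proof. by apply: nneseries_ge0 => n _ _; exact: dyadic_term_ge0. Qed.

Lemma measurable_dyadic_term sigma c n : measurable_fun setT (fun v => ((2 `^ sigma) ^+ n *
      \1_(`[(c - 2 / 2 ^+ n)%R, (c + 2 / 2 ^+ n)%R]%classic) v)%:E).
Proof.
by apply/measurable_EFinP; apply: measurable_funM => //; exact: measurable_indic.
Qed.

Lemma measurable_dyadic_kernel sigma c : measurable_fun setT (dyadic_kernel sigma c).
Proof.
apply: ge0_emeasurable_sum => [n v _ _|n _]; first exact: dyadic_term_ge0.
exact: measurable_dyadic_term.
Qed.

Lemma dyadic_kernel_ge sigma c v m : 0 <= sigma -> 0 < m -> m <= 2 -> `|v - c| <= m ->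
  ((m `^ (- sigma))%:E <= dyadic_kernel sigma c v)%E.
Proof.
move=> s0 m0 m2 vm.
have ex : exists n, 1 / 2 ^+ n < m by exact: exists_small_half_power.
(* n is such that 2^-n < m <= 2^(1-n) *)
pose P n := 1 / 2 ^+ n < m.
case: (ex_minnP (P := P) ex) => n Pn nmin.
have mn : m <= 2 / 2 ^+ n.
  case: n Pn nmin => [|k] Pk kmin; first by rewrite expr0 divr1.
  rewrite leNgt; apply/negP => lt; have := kmin k; rewrite ltnn => H; apply: (notF (H _)).
  by rewrite /P; move: lt; rewrite exprS invfM mulrA divff.
apply: (@le_trans _ _ ((2 `^ sigma) ^+ n *
      \1_(`[(c - 2 / 2 ^+ n)%R, (c + 2 / 2 ^+ n)%R]%classic) v)%:E).
  rewrite lee_fin indicE mem_set /=; last first.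
    move: vm; rewrite in_itv /= ler_norml => /andP[a b]; apply/andP; split; lra.
  rewrite mulr1 -powR_mulrn ?powR_ge0// -powRrM mulrC powRrM powR_mulrn//.
  have p2 : 0 < 2 ^+ n :> R by rewrite exprn_gt0.
  rewrite powRN -[leRHS]invrK lef_pV2 ?posrE ?powR_gt0// ?invr_gt0 ?powR_gt0//.
  rewrite -powR_inv1 ?powR_ge0// -powRrM mulrN1 powRN -powR_inv1 ?powR_ge0//.
  rewrite powRAC powR_inv1 ?exprn_ge0//.
  apply: ge0_ler_powR => //; rewrite ?nnegrE ?invr_ge0 ?exprn_ge0// ?ltW//.
  by move: Pn; rewrite /P div1r.
rewrite /dyadic_kernel.
apply: le_trans (nneseries_lim_ge n.+1 _) => [|k _ _]; last exact: dyadic_term_ge0.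
rewrite big_nat_recr//= leeDr//; apply: sume_ge0 => k _; exact: dyadic_term_ge0.
Qed.

Lemma geometric_sum_le (x : R) n : 0 <= x -> x < 1 -> \sum_(0 <= k < n) x ^+ k <= (1 - x)^-1.
Proof.
move=> x0 x1; have y0 : 0 < 1 - x by rewrite subr_gt0.
rewrite -[leRHS]mul1r ler_pdivlMr//.
have -> : (\sum_(0 <= k < n) x ^+ k) * (1 - x) = 1 - x ^+ n.
  elim: n => [|n IH]; first by rewrite big_geq// mul0r expr0 subrr.
  by rewrite big_nat_recr//= mulrDl IH exprS; ring.
by rewrite gerBl exprn_ge0.
Qed.

Lemma integral_dyadic_kernel sigma : sigma < 1 ->
  exists2 C : R, 0 <= C & forall c, (\int[mu]_v dyadic_kernel sigma c v <= C%:E)%E.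
Proof.
move=> s1; pose x : R := 2 `^ sigma / 2.
have x0 : 0 <= x by rewrite divr_ge0// powR_ge0.
have x1 : x < 1.
  rewrite /x ltr_pdivrMr// mul1r -[ltRHS]powRr1//.
  rewrite /powR (_ : (2 == 0 :> R) = false); last by rewrite gt_eqF.
  by rewrite ltr_expR ltr_pM2r// ln_gt0// ltr1n.
exists (4 * (1 - x)^-1); first by rewrite mulr_ge0// invr_ge0 subr_ge0 ltW.
move=> c; rewrite /dyadic_kernel integral_nneseries; [|exact: measurableT
  |by move=> n; exact: measurable_dyadic_term|by move=> n v _; exact: dyadic_term_ge0].
have E n : (\int[mu]_v ((2 `^ sigma) ^+ n *
      \1_(`[(c - 2 / 2 ^+ n)%R, (c + 2 / 2 ^+ n)%R]%classic) v)%:E = (4 * x ^+ n)%:E)%E.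
  under eq_integral do rewrite EFinM.
  rewrite ge0_integralZl; [|exact: measurableT
    |by apply/measurable_EFinP; exact: measurable_indic|by move=> v _; rewrite lee_fin
    |by rewrite lee_fin exprn_ge0// powR_ge0].
  rewrite integral_indic//= setIT lebesgue_measure_itv/= lte_fin.
  have p2 : 0 < 2 / 2 ^+ n :> R by rewrite divr_gt0// exprn_gt0.
  have -> : c - 2 / 2 ^+ n < c + 2 / 2 ^+ n by lra.
  rewrite -EFinD -EFinM; congr EFin; rewrite /x expr_div_n.
  by field; rewrite expf_neq0.
under eq_eseriesr do rewrite E.
apply: lime_le; first by apply: is_cvg_nneseries => n _ _; rewrite lee_fin mulr_ge0// exprn_ge0.
apply: nearW => n; rewrite sumEFin lee_fin -mulr_sumr ler_wpM2l//.
exact: geometric_sum_le.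
Qed.

End DyadicKernel.

Section WeightMajorant.
Variable R : realType.
Implicit Types (b x y m : R).

Definition outer_kernel (sigma tau b y : R) : \bar R :=
  (10%:E * (dyadic_kernel (tau / 2) 1 y + dyadic_kernel (tau / 2) (-1) y)
   + 3%:E * dyadic_kernel sigma b y)%E.

Definition inner_kernel (tau y x : R) : \bar R :=
  (dyadic_kernel tau (Num.sqrt (1 - y ^+ 2)) x
   + dyadic_kernel tau (- Num.sqrt (1 - y ^+ 2)) x)%E.

Lemma outer_kernel_ge0 sigma tau b y : (0 <= outer_kernel sigma tau b y)%E.
Proof. by rewrite adde_ge0// mule_ge0// ?adde_ge0// ?dyadic_kernel_ge0// lee_fin. Qed.

Lemma inner_kernel_ge0 tau y x : (0 <= inner_kernel tau y x)%E.
Proof. by rewrite adde_ge0// dyadic_kernel_ge0. Qed.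

Lemma powRN_le (c m e : R) : 0 < c -> c <= m -> 0 <= e -> m `^ (- e) <= c `^ (- e).
Proof.
move=> c0 cm e0; have m0 := lt_le_trans c0 cm.
rewrite !powRN lef_pV2 ?posrE ?powR_gt0//.
by apply: ge0_ler_powR => //; rewrite nnegrE ltW.
Qed.

Lemma kernel_pair_ge tau (c v : R) : 0 <= tau -> 0 < c -> c <= 1 -> `|v| < c ->
  (((c - `|v|) `^ (- tau))%:E <= dyadic_kernel tau c v + dyadic_kernel tau (- c) v)%E.
Proof.
move=> t0 c0 c1 vc; have v0 := normr_ge0 v.
have [v_ge|v_lt] := leP 0 v.
- apply: le_trans (leeDl _ (dyadic_kernel_ge0 _ _ _)); apply: dyadic_kernel_ge => //; try lra.
  by rewrite (ger0_norm v_ge) in vc *; rewrite ler_norml; apply/andP; split; lra.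
- apply: le_trans (leeDr _ (dyadic_kernel_ge0 _ _ _)); apply: dyadic_kernel_ge => //; try lra.
  by rewrite (ltr0_norm v_lt) in vc *; rewrite ler_norml; apply/andP; split; lra.
Qed.

(** The singularity along the circle and the one at the boundary point near a
separate once the height b stays away from the poles +1 and -1: for |y| near 1
the factor m is bounded below, and for the other y the circle is transverse to
the horizontal line. *)
Lemma weight_le_kernels sigma tau b x y m : 0 <= sigma -> sigma < 1 ->
  0 <= tau -> tau < 1 -> `|b| <= 4 / 5 -> x ^+ 2 + y ^+ 2 < 1 ->
  0 < m -> m <= 2 -> `|y - b| <= m ->
  (((1 - (x ^+ 2 + y ^+ 2)) `^ (- tau) * m `^ (- sigma))%:E <=
   outer_kernel sigma tau b y * inner_kernel tau y x)%E.
Proof.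
move=> s0 s1 t0 t1 b1 xy m0 m2 ym.
have x2 := sqr_ge0 x; have y2 := sqr_ge0 y.
pose r := Num.sqrt (1 - y ^+ 2).
have rE : r ^+ 2 = 1 - y ^+ 2 by rewrite sqr_sqrtr//; lra.
have r0 : 0 < r by rewrite sqrtr_gt0; lra.
have r1 : r <= 1 by rewrite -(ler_pXn2r (n:=2))// ?nnegrE ?(ltW r0)// rE expr1n; lra.
have xr : `|x| < r.
  by rewrite -(ltr_pXn2r (n:=2))// ?nnegrE ?(ltW r0)// real_normK ?num_real// rE; lra.
have D0 : 0 < 1 - (x ^+ 2 + y ^+ 2) by lra.
have P : (1 - (x ^+ 2 + y ^+ 2)) `^ (- tau) <= r `^ (- tau) * (r - `|x|) `^ (- tau).
  rewrite -powRM ?subr_ge0 ?(ltW r0) ?(ltW xr)//; apply: powRN_le => //.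
    by rewrite mulr_gt0// subr_gt0.
  have -> : 1 - (x ^+ 2 + y ^+ 2) = r ^+ 2 - `|x| ^+ 2.
    by rewrite rE real_normK ?num_real//; ring.
  have := normr_ge0 x; nra.
have O : ((r `^ (- tau) * m `^ (- sigma))%:E <= outer_kernel sigma tau b y)%E.
  have y1 : `|y| < 1.
    by rewrite -(ltr_pXn2r (n:=2))// ?nnegrE// real_normK ?num_real// expr1n; lra.
  have [yb|ys] := leP (9 / 10) `|y|.
  - (* here m is at least 1 / 10 *)
    apply: le_trans (leeDl _ _); last by rewrite mule_ge0 ?dyadic_kernel_ge0 ?lee_fin.
    apply: (@le_trans _ _ (10 * (1 - `|y|) `^ (- (tau / 2)))%:E).
      rewrite lee_fin mulrC; apply: ler_pM; rewrite ?powR_ge0//.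
        have m10 : 10^-1 <= m.
          apply: le_trans ym; have := lerB_dist y b; rewrite distrC.
          have := ler_dist_dist y b; have := lerB_normD y (- b); rewrite normrN; lra.
        apply: (@le_trans _ _ ((10^-1) `^ (- sigma))); first by apply: powRN_le => //; rewrite invr_gt0.
        rewrite -powR_inv1// -powRrM mulN1r opprK.
        by apply: le_trans (ler1_powR _ (ltW s1)) _ => //; rewrite ler1n.
      have -> : r `^ (- tau) = (r ^+ 2) `^ (- (tau / 2)).
        by rewrite -powR_mulrn ?ltW// -powRrM; congr (_ `^ _); field.
      apply: powRN_le; [by rewrite subr_gt0| |by rewrite divr_ge0].
      by rewrite rE -(real_normK (num_real y)); have := normr_ge0 y; nra.
    rewrite EFinM; apply: lee_wpmul2l; first by rewrite lee_fin.
    by apply: kernel_pair_ge => //; rewrite divr_ge0.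
  - (* here the half chord r is at least 1 / 3 *)
    apply: le_trans (leeDr _ _); last first.
      by rewrite mule_ge0 ?adde_ge0 ?dyadic_kernel_ge0 ?lee_fin.
    rewrite EFinM; apply: lee_pmul; rewrite ?lee_fin ?powR_ge0//; last exact: dyadic_kernel_ge.
    have r3 : 3^-1 <= r.
      rewrite -(ler_pXn2r (n:=2))// ?nnegrE ?invr_ge0 ?(ltW r0)// rE -(real_normK (num_real y)).
      by have := normr_ge0 y; nra.
    apply: (@le_trans _ _ ((3^-1) `^ (- tau))); first by apply: powRN_le => //; rewrite invr_gt0.
    rewrite -powR_inv1// -powRrM mulN1r opprK.
    by apply: le_trans (ler1_powR _ (ltW t1)) _ => //; rewrite ler1n.
have I : (((r - `|x|) `^ (- tau))%:E <= inner_kernel tau y x)%E by exact: kernel_pair_ge.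
apply: (@le_trans _ _ ((r `^ (- tau) * m `^ (- sigma))%:E * ((r - `|x|) `^ (- tau))%:E)%E).
  by rewrite -EFinM lee_fin mulrAC ler_wpM2r ?powR_ge0.
by apply: lee_pmul; rewrite ?lee_fin ?mulr_ge0 ?powR_ge0.
Qed.

(** The inner kernel of each line has an integral bounded by a constant, and the
outer kernel is integrable with a bound independent of b. *)
Lemma iterated_kernel_bound sigma tau : 0 <= sigma -> sigma < 1 -> 0 <= tau -> tau < 1 ->
  exists2 C : R, 0 <= C & forall b (W : R -> R -> \bar R),
    (forall y, measurable_fun setT (W y)) ->
    measurable_fun setT (fun y => \int[mu]_x W y x)%E ->
    (forall y x, (0 <= W y x)%E) ->
    (forall y x, (W y x <= outer_kernel sigma tau b y * inner_kernel tau y x)%E) ->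
    (\int[mu]_y \int[mu]_x W y x <= C%:E)%E.
Proof.
move=> s0 s1 t0 t1.
have [Ct Ct0 Ht] := @integral_dyadic_kernel R tau t1.
have [Cs Cs0 Hs] := @integral_dyadic_kernel R sigma s1.
have t21 : tau / 2 < 1 by lra.
have [C2 C20 H2] := @integral_dyadic_kernel R (tau / 2) t21.
exists ((10 * (C2 + C2) + 3 * Cs) * (Ct + Ct)).
  by rewrite mulr_ge0// addr_ge0// ?mulr_ge0// ?addr_ge0.
move=> b W mW mIW W0 WK.
have mk := @measurable_dyadic_kernel R.
have k0 := @dyadic_kernel_ge0 R.
have mO : measurable_fun setT (outer_kernel sigma tau b).
  apply: emeasurable_funD; apply: measurable_funeM => //.
  by apply: emeasurable_funD.
have mI y : measurable_fun setT (inner_kernel tau y) by apply: emeasurable_funD.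
have two_kernels (e C c c' : R) : (forall c, (\int[mu]_v dyadic_kernel e c v <= C%:E)%E) ->
    (\int[mu]_v (dyadic_kernel e c v + dyadic_kernel e c' v) <= (C + C)%:E)%E.
  move=> H; rewrite ge0_integralD; [|exact: measurableT|by move=> v _; exact: k0
    |exact: mk|by move=> v _; exact: k0|exact: mk].
  by rewrite EFinD; apply: leeD.
have I y : (\int[mu]_x W y x <= outer_kernel sigma tau b y * (Ct + Ct)%:E)%E.
  apply: (@le_trans _ _ (\int[mu]_x (outer_kernel sigma tau b y * inner_kernel tau y x))%E).
    apply: ge0_le_integral => //.
    - exact: mW.
    - by apply: measurable_funeM; exact: mI.
  rewrite ge0_integralZl; [|exact: measurableT|exact: mI
    |by move=> x _; exact: inner_kernel_ge0|exact: outer_kernel_ge0].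
  by apply: lee_wpmul2l; [exact: outer_kernel_ge0|exact: two_kernels].
apply: (@le_trans _ _ (\int[mu]_y (outer_kernel sigma tau b y * (Ct + Ct)%:E))%E).
  apply: ge0_le_integral => //.
  - by move=> y _; apply: integral_ge0.
  - by apply: emeasurable_funM => //; exact: mO.
rewrite ge0_integralZr; [|exact: measurableT|exact: mO
  |by move=> y _; exact: outer_kernel_ge0|by rewrite lee_fin addr_ge0].
rewrite [leRHS]EFinM; apply: lee_wpmul2r; first by rewrite lee_fin addr_ge0.
rewrite ge0_integralD; [|exact: measurableT
  |by move=> y _; rewrite mule_ge0 ?adde_ge0 ?k0// lee_fin
  |by apply: measurable_funeM; apply: emeasurable_funD; exact: mk
  |by move=> y _; rewrite mule_ge0 ?k0// lee_fin
  |by apply: measurable_funeM; exact: mk].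
rewrite [leRHS]EFinD; apply: leeD.
- rewrite ge0_integralZl; [|exact: measurableT|by apply: emeasurable_funD; exact: mk
    |by move=> y _; rewrite adde_ge0 ?k0|by rewrite lee_fin].
  by rewrite [leRHS]EFinM; apply: lee_wpmul2l; [rewrite lee_fin|exact: two_kernels].
- rewrite ge0_integralZl; [|exact: measurableT|exact: mk
    |by move=> y _; exact: k0|by rewrite lee_fin].
  by rewrite [leRHS]EFinM; apply: lee_wpmul2l; rewrite ?lee_fin.
Qed.

End WeightMajorant.

Definition Fweight (R : realType) (q s : R) (a z : R[i]) : R :=
  (1 - modulus z ^+ 2) `^ q * (1 - modulus (mobius a z) ^+ 2) `^ s.

Section WeightBound.
Variable R : realType.
Implicit Types (f g : R[i] -> R[i]) (z w a : R[i]).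

Lemma cderiv_id z : cderiv (fun w : R[i] => w) z = 1.
Proof. exact: (cdiff_derivable (cdiff_id z)).2. Qed.

Lemma Fdensity_weight (p q s : R) f a z :
  Fdensity p q s f a z = modulus (cderiv f z) `^ p * Fweight q s a z.
Proof. by rewrite /Fdensity /Fweight mulrA. Qed.

Lemma measurable_Fweight (q s : R) a : disk a ->
  measurable_fun (@plane_disk R) (fun w : R * R => Fweight q s a (w.1 +i* w.2)).
Proof.
move=> Da.
have hid : analytic_disk (fun w : R[i] => w).
  by move=> z _; exact: (cdiff_derivable (cdiff_id z)).1.
apply: eq_measurable_fun (measurable_Fdensity 1 q s hid Da) => w _.
by rewrite Fdensity_weight cderiv_id modulus1 powR1 mul1r.
Qed.

Lemma Fweight_ge0 (q s : R) a z : 0 <= Fweight q s a z.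
Proof. by rewrite mulr_ge0 ?powR_ge0. Qed.

Lemma mobius_identity a z : modulus (1 - (a^*)%R * z) ^+ 2 - modulus (a - z) ^+ 2 =
  (1 - modulus a ^+ 2) * (1 - modulus z ^+ 2).
Proof. by rewrite !sqr_modulus conjE; case: a z => x y [u v] /=; ring. Qed.

Lemma sqr_modulus_lt1 z : disk z -> 0 < 1 - modulus z ^+ 2 <= 1.
Proof.
move=> Dz; have z1 : modulus z < 1 := Dz.
by rewrite subr_gt0 expr_lt1// ?modulus_ge0// z1 gerBl sqr_ge0.
Qed.

Lemma one_sub_mobius a z : disk a -> disk z -> 1 - modulus (mobius a z) ^+ 2 =
  (1 - modulus z ^+ 2) * ((1 - modulus a ^+ 2) / modulus (1 - (a^*)%R * z) ^+ 2).
Proof.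
move=> Da Dz; have m0 := modulus_gt0 (mobius_denominator_neq0 Da Dz).
rewrite mulrA [_ * (1 - modulus a ^+ 2)]mulrC -mobius_identity mulrBl divff ?expf_neq0 ?gt_eqF//.
by rewrite /mobius modulusM modulusV expr_div_n.
Qed.

(** Lowering the exponent s to sigma < 1 is harmless because the factor is at
most 1, and it makes the pole at the boundary integrable. *)
Lemma Fweight_le (q s sigma tau : R) a z : disk a -> disk z ->
  0 <= sigma -> sigma <= 1 -> sigma <= s -> - tau <= q + sigma ->
  Fweight q s a z <= 2 * ((1 - modulus z ^+ 2) `^ (- tau) *
     modulus (1 - (a^*)%R * z) `^ (- sigma)).
Proof.
move=> Da Dz s0 s1 ss tq.
have m0 := modulus_gt0 (mobius_denominator_neq0 Da Dz).
have /andP[u0 u1] := sqr_modulus_lt1 Dz.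
have /andP[A0 A1] := sqr_modulus_lt1 Da.
have m2 : 1 - modulus a ^+ 2 <= 2 * modulus (1 - (a^*)%R * z).
  have := lerB_modulus 1 ((a^*)%R * z); rewrite modulus1 modulusM modulus_conj.
  have a1 : modulus a < 1 := Da; have z1 : modulus z < 1 := Dz.
  have := modulus_ge0 a; have := modulus_ge0 z; nra.
rewrite /Fweight (one_sub_mobius Da Dz).
have := one_sub_mobius Da Dz.
set m := modulus (1 - _) in m0 m2 *; set u := 1 - modulus z ^+ 2 in u0 u1 *.
set A := 1 - modulus a ^+ 2 in A0 A1 m2 *; move=> vE.
have k0 : 0 < A / m ^+ 2 by rewrite divr_gt0// exprn_gt0.
have v1 : u * (A / m ^+ 2) <= 1 by rewrite -vE gerBl sqr_ge0.
have v0 : 0 < u * (A / m ^+ 2) by rewrite mulr_gt0.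
apply: (@le_trans _ _ (u `^ q * (u * (A / m ^+ 2)) `^ sigma)).
  by rewrite ler_wpM2l ?powR_ge0//; apply: ger_powR; rewrite ?v0.
rewrite powRM ?(ltW u0) ?(ltW k0)// mulrA -powRD; last by rewrite (gt_eqF u0) implybT.
rewrite mulrCA; apply: ler_pM; rewrite ?powR_ge0//.
  by apply: ger_powR; rewrite ?u0.
apply: (@le_trans _ _ ((2 / m) `^ sigma)).
  apply: ge0_ler_powR; rewrite ?nnegrE ?(ltW k0) ?divr_ge0// ?(ltW m0)//.
  rewrite ler_pdivrMr ?exprn_gt0// expr2 mulrA divfK ?gt_eqF//.
rewrite powRM ?invr_ge0 ?(ltW m0)// -powR_inv1 ?(ltW m0)// -powRrM mulN1r ler_wpM2r ?powR_ge0//.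
by apply: ler1_powR; rewrite ?ler1n.
Qed.

(** Since |1 - conj(a) z| >= |a - z|, the pole can be measured along either
coordinate; one of the coordinates of a is at most 4/5 in absolute value, and
integrating first along the other one keeps the two singularities apart. *)
Lemma integral_Fweight (q s : R) : -2 < q -> 0 < s -> -1 < q + s ->
  exists2 C : R, 0 <= C & forall a, disk a ->
    (\int[mu2]_(w in @plane_disk R) (Fweight q s a (w.1 +i* w.2))%:E <= C%:E)%E.
Proof.
move=> q2 s0 qs.
(* sigma < 1 with q + sigma > -1; it is close to 1 when q is close to -2. *)
pose sigma := Num.min s (Num.max (1 / 2) (- q / 2)).
have sigma0 : 0 <= sigma by rewrite le_min (ltW s0) le_max; apply/orP; left; lra.
have sigma1 : sigma < 1 by rewrite gt_min gt_max; apply/orP; right; apply/andP; split; lra.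
have sigmas : sigma <= s by rewrite ge_min lexx.
have qsigma : -1 < q + sigma.
  rewrite -ltrBlDl lt_min lt_max; apply/andP; split; first lra.
  by apply/orP; right; lra.
pose tau := Num.max 0 (- (q + sigma)).
have tau0 : 0 <= tau by rewrite le_max lexx.
have tau1 : tau < 1 by rewrite gt_max; apply/andP; split; lra.
have tauq : - tau <= q + sigma by rewrite lerNl le_max lexx orbT.
have [C C0 HC] := @iterated_kernel_bound R sigma tau sigma0 sigma1 tau0 tau1.
exists (2 * C); first by rewrite mulr_ge0.
move=> a Da.
have mD := @measurable_plane_disk R.
have mw := measurable_Fweight q s Da.
pose h (w : R * R) := (2^-1 * Fweight q s a (w.1 +i* w.2))%:E.
pose g := h \_ (@plane_disk R).
have mh : measurable_fun (@plane_disk R) h by apply/measurable_EFinP; exact: measurable_funM.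
have mg : measurable_fun setT g by apply/(measurable_restrictT h).
have g0 (v : R * R) : (0 <= g v)%E.
  by rewrite /g patchE; case: ifP => // _; rewrite lee_fin mulr_ge0 ?Fweight_ge0.
have bound (b x y : R) : `|b| <= 4 / 5 ->
    (`|y - b| <= modulus (1 - (a^*)%R * (x +i* y)) ->
       (g (x, y) <= outer_kernel sigma tau b y * inner_kernel tau y x)%E) /\
    (`|x - b| <= modulus (1 - (a^*)%R * (x +i* y)) ->
       (g (x, y) <= outer_kernel sigma tau b x * inner_kernel tau x y)%E).
  move=> b1; rewrite /g patchE; case: ifPn => [|_]; last first.
    by split=> _; rewrite mule_ge0 ?outer_kernel_ge0 ?inner_kernel_ge0.
  rewrite inE => Dz; have {}Dz : disk (x +i* y) := Dz.
  have m0 := modulus_gt0 (mobius_denominator_neq0 Da Dz).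
  have m2 : modulus (1 - (a^*)%R * (x +i* y)) <= 2.
    apply: le_trans (ler_modulusB _ _) _; rewrite modulus1 modulusM modulus_conj.
    have a1 : modulus a < 1 := Da; have z1 : modulus (x +i* y) < 1 := Dz.
    have := modulus_ge0 a; have := modulus_ge0 (x +i* y); nra.
  have := Fweight_le Da Dz sigma0 (ltW sigma1) sigmas tauq.
  have /andP[u0 _] := sqr_modulus_lt1 Dz.
  rewrite sqr_modulus /= in u0 *.
  move=> FW; split => ym.
  - apply: le_trans (weight_le_kernels sigma0 sigma1 tau0 tau1 b1 _ m0 m2 ym); last by lra.
    by rewrite /h lee_fin ler_pdivrMl//.
  - apply: le_trans (@weight_le_kernels R sigma tau b y x _ sigma0 sigma1 tau0 tau1 b1 _ m0 m2 ym); last by lra.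
    by rewrite /h lee_fin ler_pdivrMl// [y ^+ 2 + _]addrC.
have dist z : disk z -> modulus (a - z) <= modulus (1 - (a^*)%R * z).
  move=> Dz; rewrite -(ler_pXn2r (n:=2))// ?nnegrE ?modulus_ge0// -subr_ge0 mobius_identity.
  have /andP[u0 _] := sqr_modulus_lt1 Dz; have /andP[A0 _] := sqr_modulus_lt1 Da.
  by rewrite mulr_ge0 ?ltW.
have half : (\int[mu2]_w g w <= C%:E)%E.
  have a1 : (Re a) ^+ 2 + (Im a) ^+ 2 < 1.
    by rewrite -sqr_modulus; have /andP[A0 _] := sqr_modulus_lt1 Da; lra.
  have gmod z : `|Im z - Im a| <= modulus (a - z) /\ `|Re z - Re a| <= modulus (a - z).
    by rewrite modulusBC -ImB -ReB Im_le_modulus Re_le_modulus.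
  have out (x y : R) : ~ disk (x +i* y) -> g (x, y) = 0%E.
    by move=> nD; rewrite /g patchE ifF//; apply/negP; rewrite inE.
  have [Ima|Ima] := leP `|Im a| (4 / 5).
  - rewrite (fubini_tonelli2 (m1 := (@mu R)) (m2 := (@mu R)) g mg g0).
    apply: (HC (Im a) (fun y x => g (x, y))) => //.
    + by move=> y; exact: measurableT_comp.
    + exact: measurable_fun_fubini_tonelli_G.
    + move=> y x; have [Dz|nDz] := pselect (disk (x +i* y)).
        apply: (bound (Im a) x y Ima).1; apply: le_trans (dist _ Dz).
        exact: (gmod (x +i* y)).1.
      by rewrite out// mule_ge0 ?outer_kernel_ge0 ?inner_kernel_ge0.
  - have Rea : `|Re a| <= 4 / 5.
      rewrite leNgt; apply/negP => Rea; move: a1.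
      rewrite -(real_normK (num_real (Re a))) -(real_normK (num_real (Im a))); nra.
    rewrite (fubini_tonelli1 (m1 := (@mu R)) (m2 := (@mu R)) g mg g0).
    apply: (HC (Re a) (fun x y => g (x, y))) => //.
    + by move=> y; exact: measurableT_comp.
    + exact: measurable_fun_fubini_tonelli_F.
    + move=> x y; have [Dz|nDz] := pselect (disk (x +i* y)).
        apply: (bound (Re a) x y Rea).2; apply: le_trans (dist _ Dz).
        exact: (gmod (x +i* y)).2.
      by rewrite out// mule_ge0 ?outer_kernel_ge0 ?inner_kernel_ge0.
have -> : (\int[mu2]_(w in @plane_disk R) (Fweight q s a (w.1 +i* w.2))%:E = 2%:E * \int[mu2]_w g w)%E.
  rewrite /g -integral_mkcond -ge0_integralZl//.
  - by apply: eq_integral => w _; rewrite /h -EFinM mulrA divff ?mul1r.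
  - by move=> w _; rewrite lee_fin mulr_ge0 ?Fweight_ge0.
by rewrite EFinM; apply: lee_wpmul2l; rewrite ?lee_fin.
Qed.

End WeightBound.

(** * The space and its quasi-norm *)

Section SpaceF.
Variable R : realType.
Implicit Types (f g : R[i] -> R[i]) (z w a c : R[i]).

Lemma analyticP f (l : R[i] -> R[i]) : (forall z, disk z -> cdiff f z (l z)) ->
  analytic_disk f /\ forall z, disk z -> cderiv f z = l z.
Proof. by move=> H; split=> z /H /cdiff_derivable[]. Qed.

Lemma analyticD f g : analytic_disk f -> analytic_disk g ->
  analytic_disk (fun z => f z + g z) /\
  forall z, disk z -> cderiv (fun z => f z + g z) z = cderiv f z + cderiv g z.
Proof.
move=> hf hg; apply: (analyticP (l := fun z => cderiv f z + cderiv g z)) => z Dz.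
by apply: cdiffD; exact: analytic_cdiff.
Qed.

Lemma analyticZ c f : analytic_disk f -> analytic_disk (fun z => c * f z) /\
  forall z, disk z -> cderiv (fun z => c * f z) z = c * cderiv f z.
Proof.
move=> hf; apply: (analyticP (l := fun z => c * cderiv f z)) => z Dz.
by apply: cdiffZ; exact: analytic_cdiff.
Qed.

Lemma analyticM f g : analytic_disk f -> analytic_disk g ->
  analytic_disk (fun z => f z * g z) /\
  forall z, disk z -> cderiv (fun z => f z * g z) z = cderiv f z * g z + f z * cderiv g z.
Proof.
move=> hf hg; apply: (analyticP (l := fun z => cderiv f z * g z + f z * cderiv g z)) => z Dz.
by apply: cdiffM; exact: analytic_cdiff.
Qed.

Lemma analytic_eq0 f : (forall z, disk z -> f z = 0) ->
  analytic_disk f /\ forall z, disk z -> cderiv f z = 0.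
Proof.
move=> f0; apply: (analyticP (l := fun=> 0)) => z Dz; have z1 : modulus z < 1 := Dz.
apply: (@eq_cdiff _ (fun=> 0) f z 0 (1 - modulus z)); [lra| |exact: cdiff_cst].
move=> h hz; rewrite f0//; change (modulus (z + h) < 1).
by apply: le_lt_trans (ler_modulusD _ _) _; lra.
Qed.

Section QuasiNorm.
Variables p q s : R.
Hypothesis p0 : 0 < p.
Local Notation X := (Fspace p q s).
Local Notation N := (Fnorm p q s).

Lemma disk_integral_le (u v : R[i] -> R) (k : R) : 0 <= k -> (forall z, 0 <= u z) ->
  (forall z, 0 <= v z) ->
  measurable_fun (@plane_disk R) (fun w : R * R => u (w.1 +i* w.2)) ->
  measurable_fun (@plane_disk R) (fun w : R * R => v (w.1 +i* w.2)) ->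
  (forall z, disk z -> u z <= k * v z) -> (disk_integral u <= k%:E * disk_integral v)%E.
Proof.
move=> k0 u0 v0 mu' mv uv; rewrite /disk_integral muleCA; apply: lee_wpmul2l.
  by rewrite lee_fin invr_ge0 pi_ge0.
have mD := @measurable_plane_disk R.
rewrite -ge0_integralZl; [|exact: mD|exact/measurable_EFinP
  |by move=> w _; rewrite lee_fin|by rewrite lee_fin].
apply: ge0_le_integral => //.
- by move=> w _; rewrite lee_fin.
- exact/measurable_EFinP.
- by apply/measurable_EFinP; exact: measurable_funM.
- by move=> w Dw; rewrite -EFinM lee_fin; exact: uv.
Qed.

Lemma disk_integralD (u v : R[i] -> R) : (forall z, 0 <= u z) -> (forall z, 0 <= v z) ->
  measurable_fun (@plane_disk R) (fun w : R * R => u (w.1 +i* w.2)) ->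
  measurable_fun (@plane_disk R) (fun w : R * R => v (w.1 +i* w.2)) ->
  disk_integral (fun z => u z + v z) = (disk_integral u + disk_integral v)%E.
Proof.
move=> u0 v0 mu' mv; rewrite /disk_integral -muleDr//; last first.
  by apply: ge0_adde_def; rewrite inE; apply: integral_ge0 => w _; rewrite lee_fin.
by congr (_ * _)%E; rewrite -ge0_integralD; [|exact: measurable_plane_disk
  |by move=> w _; rewrite lee_fin|exact/measurable_EFinP
  |by move=> w _; rewrite lee_fin|exact/measurable_EFinP].
Qed.

Lemma Fsup_le f (M : \bar R) :
  (forall a, disk a -> (disk_integral (Fdensity p q s f a) <= M)%E) -> (Fsup p q s f <= M)%E.
Proof. by move=> H; apply: ge_ereal_sup => _ [a Da <-]; exact: H. Qed.

Lemma powR_add_le (x y : R) : 0 <= x -> 0 <= y -> (x + y) `^ p <= 2 `^ p * (x `^ p + y `^ p).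
Proof.
move=> x0 y0.
have [xy|yx] := leP x y.
- apply: (@le_trans _ _ ((2 * y) `^ p)).
    by apply: ge0_ler_powR; rewrite ?nnegrE ?(ltW p0) ?addr_ge0 ?mulr_ge0//; lra.
  by rewrite powRM// ler_wpM2l ?powR_ge0// lerDr powR_ge0.
- apply: (@le_trans _ _ ((2 * x) `^ p)).
    by apply: ge0_ler_powR; rewrite ?nnegrE ?(ltW p0) ?addr_ge0 ?mulr_ge0//; lra.
  by rewrite powRM// ler_wpM2l ?powR_ge0// lerDl powR_ge0.
Qed.

Lemma FsupD f g : analytic_disk f -> analytic_disk g ->
  (Fsup p q s (fun z => (f z + g z)%R) <= (2 `^ p)%:E * (Fsup p q s f + Fsup p q s g))%E.
Proof.
move=> hf hg; have [hD dD] := analyticD hf hg.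
apply: Fsup_le => a Da.
apply: (@le_trans _ _ ((2 `^ p)%:E * disk_integral (fun z => Fdensity p q s f a z + Fdensity p q s g a z)%R)%E).
  apply: disk_integral_le; rewrite ?powR_ge0//.
  - exact: Fdensity_ge0.
  - by move=> z; rewrite addr_ge0 ?Fdensity_ge0.
  - exact: measurable_Fdensity.
  - by apply: measurable_funD; exact: measurable_Fdensity.
  move=> z Dz; rewrite !Fdensity_weight dD// -mulrDl mulrA ler_wpM2r ?Fweight_ge0//.
  apply: le_trans (powR_add_le (modulus_ge0 _) (modulus_ge0 _)).
  apply: ge0_ler_powR; rewrite ?nnegrE ?modulus_ge0 ?(ltW p0) ?addr_ge0 ?modulus_ge0//.
  exact: ler_modulusD.
apply: lee_wpmul2l; first by rewrite lee_fin powR_ge0.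
rewrite disk_integralD.
- by apply: leeD; exact: Fsup_ubound.
- exact: Fdensity_ge0.
- exact: Fdensity_ge0.
- exact: measurable_Fdensity.
- exact: measurable_Fdensity.
Qed.

Lemma FsupZ c f : analytic_disk f ->
  (Fsup p q s (fun z => (c * f z)%R) <= (modulus c `^ p)%:E * Fsup p q s f)%E.
Proof.
move=> hf; have [hZ dZ] := analyticZ c hf.
apply: Fsup_le => a Da.
apply: (@le_trans _ _ ((modulus c `^ p)%:E * disk_integral (Fdensity p q s f a))%E).
  apply: disk_integral_le; rewrite ?powR_ge0//.
  - exact: Fdensity_ge0.
  - exact: Fdensity_ge0.
  - exact: measurable_Fdensity.
  - exact: measurable_Fdensity.
  move=> z Dz; rewrite !Fdensity_weight dZ// modulusM powRM ?modulus_ge0//.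
  by rewrite mulrA.
by apply: lee_wpmul2l; [rewrite lee_fin powR_ge0|exact: Fsup_ubound].
Qed.

Lemma Fspace_Fsup f : X f <-> analytic_disk f /\ (Fsup p q s f < +oo)%E.
Proof.
split=> -[hf Sf]; split=> //.
- by apply: lty_poweRy Sf; rewrite invr_neq0// gt_eqF.
- exact: poweR_lty.
Qed.

Lemma FnormP f (x : R) : (N f <= x%:E)%E <-> exists2 t : R, 0 <= t &
  (Fseminorm p q s f <= t%:E)%E /\ modulus (f 0) + t <= x.
Proof.
split=> [|[t t0 [St tx]]]; rewrite /Fnorm; last first.
  by apply: le_trans (leeD2l _ St) _; rewrite -EFinD lee_fin.
have := Fseminorm_ge0 p q s f; case: (Fseminorm p q s f) => [t| |]//.
by rewrite lee_fin => t0; rewrite -EFinD lee_fin => H; exists t.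
Qed.

Lemma Fnorm_ge0 f : (0 <= N f)%E.
Proof. by rewrite /Fnorm adde_ge0 ?lee_fin ?modulus_ge0 ?Fseminorm_ge0. Qed.

Lemma Fnorm_fin f : X f -> exists2 x : R, 0 <= x & N f = x%:E.
Proof.
move=> [_]; have := Fnorm_ge0 f; rewrite /Fnorm; have := Fseminorm_ge0 p q s f.
case: (Fseminorm p q s f) => [t| |]// _.
by rewrite -EFinD lee_fin => x0 _; exists (modulus (f 0) + t).
Qed.

Lemma FnormZ c f (x : R) : X f -> (N f <= x%:E)%E -> (N (fun z => (c * f z)%R) <= (modulus c * x)%:E)%E.
Proof.
move=> [hf _] /FnormP[t t0 [St tx]]; apply/FnormP; exists (modulus c * t).
  by rewrite mulr_ge0 ?modulus_ge0.
split; last by rewrite modulusM -mulrDr ler_wpM2l ?modulus_ge0.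
apply/(Fseminorm_le q s _ p0); first by rewrite mulr_ge0 ?modulus_ge0.
move/(Fseminorm_le q s f p0 t0) : St => St.
apply: le_trans (FsupZ c hf) _; rewrite powRM ?modulus_ge0// EFinM.
by apply: lee_wpmul2l; rewrite ?lee_fin ?powR_ge0.
Qed.

Lemma FnormD f g (x y : R) : X f -> X g -> (N f <= x%:E)%E -> (N g <= y%:E)%E ->
  (N (fun z => (f z + g z)%R) <= ((1 + 2 * 2 `^ p^-1) * (x + y))%:E)%E.
Proof.
move=> [hf _] [hg _] /FnormP[t t0 [St tx]] /FnormP[u u0 [Su uy]].
have f0 := modulus_ge0 (f 0); have g0 := modulus_ge0 (g 0).
apply/FnormP; exists (2 * 2 `^ p^-1 * (t + u)).
  by rewrite mulr_ge0 ?addr_ge0// mulr_ge0 ?powR_ge0.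
split; last first.
  have P0 : 0 <= 2 * 2 `^ p^-1 :> R by rewrite mulr_ge0 ?powR_ge0.
  have := ler_modulusD (f 0) (g 0); nra.
apply/(Fseminorm_le q s _ p0); first by rewrite mulr_ge0 ?addr_ge0// mulr_ge0 ?powR_ge0.
move/(Fseminorm_le q s f p0 t0) : St => St; move/(Fseminorm_le q s g p0 u0) : Su => Su.
apply: le_trans (FsupD hf hg) _.
apply: (@le_trans _ _ ((2 `^ p)%:E * (t `^ p + u `^ p)%:E)%E).
  by apply: lee_wpmul2l; [rewrite lee_fin powR_ge0|rewrite EFinD leeD].
rewrite -EFinM lee_fin !powRM ?mulr_ge0 ?powR_ge0 ?addr_ge0//.
rewrite -powRrM mulVf ?gt_eqF// powRr1// -mulrA ler_wpM2l ?powR_ge0//.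
have T : t `^ p <= (t + u) `^ p by apply: ge0_ler_powR; rewrite ?nnegrE ?(ltW p0) ?addr_ge0//; lra.
have U : u `^ p <= (t + u) `^ p by apply: ge0_ler_powR; rewrite ?nnegrE ?(ltW p0) ?addr_ge0//; lra.
lra.
Qed.

Lemma FspaceZ c f : X f -> X (fun z => c * f z).
Proof.
move=> /Fspace_Fsup[hf Sf]; apply/Fspace_Fsup; split; first exact: (analyticZ c hf).1.
by apply: le_lt_trans (FsupZ c hf) _; rewrite lte_mul_pinfty// lee_fin powR_ge0.
Qed.

Lemma FspaceD f g : X f -> X g -> X (fun z => f z + g z).
Proof.
move=> /Fspace_Fsup[hf Sf] /Fspace_Fsup[hg Sg]; apply/Fspace_Fsup; split.
  exact: (analyticD hf hg).1.
apply: le_lt_trans (FsupD hf hg) _.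
have S : (Fsup p q s f + Fsup p q s g < +oo)%E by exact: (lte_add_pinfty Sf Sg).
by apply: lte_mul_pinfty S; rewrite ?lee_fin ?powR_ge0.
Qed.

Lemma Fspace_bounded_deriv f (B : R) : -2 < q -> 0 < s -> -1 < q + s ->
  analytic_disk f -> (forall z, disk z -> modulus (cderiv f z) <= B) -> X f.
Proof.
move=> q2 s0 qs hf fB; have [C C0 HC] := integral_Fweight q2 s0 qs.
apply/Fspace_Fsup; split=> //.
apply: (@le_lt_trans _ _ ((B `^ p)%:E * ((pi^-1)%:E * C%:E))%E); last first.
  by rewrite -!EFinM ltry.
apply: Fsup_le => a Da.
apply: (@le_trans _ _ ((B `^ p)%:E * disk_integral (Fweight q s a))%E).
  apply: disk_integral_le; rewrite ?powR_ge0//.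
  - exact: Fdensity_ge0.
  - exact: Fweight_ge0.
  - exact: measurable_Fdensity.
  - exact: measurable_Fweight.
  move=> z Dz; rewrite Fdensity_weight ler_wpM2r ?Fweight_ge0//.
  have b := fB z Dz; apply: ge0_ler_powR; rewrite ?nnegrE ?modulus_ge0 ?(ltW p0)//.
  exact: le_trans (modulus_ge0 _) b.
apply: lee_wpmul2l; first by rewrite lee_fin powR_ge0.
apply: lee_wpmul2l; first by rewrite lee_fin invr_ge0 pi_ge0.
exact: HC.
Qed.

Lemma Fspace_prod (t : seq R[i]) : -2 < q -> 0 < s -> -1 < q + s ->
  X (fun z => \prod_(b <- t) (z - b)).
Proof.
move=> q2 s0 qs.
suff [hf [B HB]] : analytic_disk (fun z => \prod_(b <- t) (z - b)) /\
    exists B : R, forall z, disk z -> modulus (\prod_(b <- t) (z - b)) <= B /\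
      modulus (cderiv (fun z => \prod_(b <- t) (z - b)) z) <= B.
  by apply: (Fspace_bounded_deriv (B := B)) => // z /HB[].
elim: t => [|b t [hf [B HB]]].
  under eq_fun do rewrite big_nil.
  have [h1 h2] := @analyticP (fun=> 1) (fun=> 0) (fun z _ => cdiff_cst 1 z).
  split=> //; exists 1 => z Dz; rewrite big_nil h2// modulus1 modulus0; split; lra.
have E : (fun z : R[i] => \prod_(j <- b :: t) (z - j)) = (fun z => (z - b) * \prod_(j <- t) (z - j)).
  by apply/funext => z; rewrite big_cons.
have [l1 l2] : analytic_disk (fun z : R[i] => z - b) /\
    forall z, disk z -> cderiv (fun z : R[i] => z - b) z = 1.
  apply: (analyticP (l := fun=> 1)) => z _.
  by rewrite -[X in cdiff _ _ X]subr0; apply: cdiffB; [exact: cdiff_id|exact: cdiff_cst].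
rewrite E; have [m1 m2] := analyticM l1 hf; split=> //.
exists ((1 + modulus b) * B + B) => z Dz; have z1 : modulus z < 1 := Dz.
rewrite big_cons m2// l2// mul1r; have [B1 B2] := HB z Dz.
have zb : modulus (z - b) <= 1 + modulus b.
  by apply: le_trans (ler_modulusB _ _) _; lra.
have T1 : modulus ((z - b) * \prod_(j <- t) (z - j)) <= (1 + modulus b) * B.
  by rewrite modulusM; apply: ler_pM; rewrite ?modulus_ge0.
have T2 : modulus ((z - b) * cderiv (fun z => \prod_(j <- t) (z - j)) z) <= (1 + modulus b) * B.
  by rewrite modulusM; apply: ler_pM; rewrite ?modulus_ge0.
have B0 : 0 <= B := le_trans (modulus_ge0 _) B1.
split; first by lra.
by apply: le_trans (ler_modulusD _ _) _; lra.
Qed.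

End QuasiNorm.
End SpaceF.

(** * Riesz's argument *)

Section RieszArgument.
Variable R : realType.
Implicit Types (f g h u v w : R[i] -> R[i]) (z a c : R[i]).
Variables (X : set (R[i] -> R[i])) (N : (R[i] -> R[i]) -> \bar R) (K : R).
Hypotheses (XD : forall f h, X f -> X h -> X (fun z => f z + h z))
  (XZ : forall c f, X f -> X (fun z => c * f z))
  (Xprod : forall t : seq R[i], X (fun z => \prod_(b <- t) (z - b)))
  (N_fin : forall f, X f -> exists2 x : R, 0 <= x & N f = x%:E)
  (NZ : forall c f (x : R), X f -> (N f <= x%:E)%E ->
     (N (fun z => (c * f z)%R) <= (modulus c * x)%:E)%E)
  (K0 : 0 < K)
  (ND : forall f h (x y : R), X f -> X h -> (N f <= x%:E)%E -> (N h <= y%:E)%E ->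
     (N (fun z => (f z + h z)%R) <= (K * (x + y))%:E)%E)
  (evN : forall a, disk a -> exists2 B : R, 0 <= B & forall f, X f ->
     (N f <= 1%E)%E -> modulus (f a) <= B).

Let XB f h : X f -> X h -> X (fun z => f z - h z).
Proof.
move=> Xf Xh; have := XD Xf (XZ (-1) Xh).
by congr X; apply/funext => z; rewrite mulN1r.
Qed.

Definition vanishing (b : nat -> R[i]) (n : nat) : set (R[i] -> R[i]) :=
  [set f | X f /\ forall i, (i < n)%N -> f (b i) = 0].

(** Riesz's lemma for the chain of subspaces of functions vanishing at the
first n points: evaluation at the next point is a bounded functional, so each
subspace is closed and proper in the preceding one. *)
Lemma riesz_vanishing (b : nat -> R[i]) n : (forall i, disk (b i)) -> injective b ->
  exists y, [/\ vanishing b n y, (N y <= 1%E)%E &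
    forall w, vanishing b n.+1 w -> ((1 / 2)%:E <= N (fun z => (y z - w z)%R))%E].
Proof.
move=> Db injb.
pose v z := \prod_(c <- [seq b i | i <- iota 0 n]) (z - c).
have Xv : X v by exact: Xprod.
have v0 i : (i < n)%N -> v (b i) = 0.
  move=> lt_in; rewrite /v big_map (big_rem i) ?mem_iota//=.
  by rewrite subrr mul0r.
have vn : v (b n) != 0.
  rewrite /v big_map prodf_seq_neq0; apply/allP => i; rewrite mem_iota => /= lt_in.
  by rewrite subr_eq0; apply/eqP => /injb E; move: lt_in; rewrite E ltnn.
have [B B0 HB] := evN (Db n).
(* a lower bound for the distance of v to the next subspace; B may be 0 *)
pose eta := modulus (v (b n)) / (B + 1).
have eta0 : 0 < eta by rewrite divr_gt0 ?modulus_gt0// ltr_wpDl.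
pose S := [set t : R | exists2 w, vanishing b n.+1 w & N (fun z => (v z - w z)%R) = t%:E].
have X0 : X (fun=> 0).
  by have := XZ 0 Xv; congr X; apply/funext => z; rewrite mul0r.
have S0 : S !=set0.
  have [t _ Et] := N_fin (XB Xv X0).
  by exists t; exists (fun=> 0).
have Sge t : S t -> eta <= t.
  move=> [w [Xw w0] Nt]; rewrite leNgt; apply/negP => lt.
  have [t1 t1_ge Nt1] := N_fin (XB Xv Xw).
  have t_ge : 0 <= t by move: Nt; rewrite Nt1 => -[<-].
  pose t' := (t + eta) / 2.
  have t'0 : 0 < t' by rewrite /t'; lra.
  have t't : t <= t' by rewrite /t'; lra.
  have t'eta : t' < eta by rewrite /t'; lra.
  have := HB _ (XZ (t'^-1)%:C (XB Xv Xw)).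
  rewrite w0// subr0 modulusM modulus_real ger0_norm ?invr_ge0 ?(ltW t'0)// => H.
  have : t'^-1 * modulus (v (b n)) <= B.
    apply: H; apply: le_trans (NZ _ (XB Xv Xw) _) _; first by rewrite Nt.
    rewrite lee_fin modulus_real ger0_norm ?invr_ge0 ?(ltW t'0)// mulrC ler_pdivrMr// mul1r//.
  rewrite mulrC ler_pdivrMr// => H'.
  have : modulus (v (b n)) = eta * (B + 1) by rewrite /eta divfK// gt_eqF// ltr_wpDl.
  nra.
have Sinf : has_inf S by split=> //; exists eta => t /Sge.
pose d := inf S.
have d0 : 0 < d by apply: lt_le_trans eta0 _; apply: lb_le_inf => // t /Sge.
have [t St td] := inf_adherent d0 Sinf.
have td0 : d <= t by apply: ge_inf => //; case: Sinf.
rewrite -/d in td.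
have t0 : 0 < t by lra.
have [w [Xw w0] Nt] := St.
pose y z := (t^-1)%:C * (v z - w z).
have Xy : X y by exact: XZ (XB Xv Xw).
exists y; split.
- split=> // i lt_in; rewrite /y v0// w0 ?subrr ?mulr0//.
  exact: leq_trans lt_in _.
- apply: le_trans (NZ _ (XB Xv Xw) _) _; first by rewrite Nt.
  by rewrite lee_fin modulus_real ger0_norm ?invr_ge0 ?(ltW t0)// mulVf ?gt_eqF.
move=> w' [Xw' w'0]; rewrite leNgt; apply/negP => lt.
have [x x0 Nx] := N_fin (XB Xy Xw'); move: lt; rewrite Nx lte_fin => lt.
have Xs : X (fun z => w z + t%:C * w' z) by exact: XD (XZ _ Xw').
have vs : vanishing b n.+1 (fun z => w z + t%:C * w' z).
  by split=> // i lt_in; rewrite w0// w'0// mulr0 addr0.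
have [r r0 Nr] := N_fin (XB Xv Xs).
have dr : d <= r by apply: ge_inf; [case: Sinf|exists (fun z => w z + t%:C * w' z)].
have tC : t%:C != 0 :> R[i] by rewrite -(rmorph0 (real_complex R)) (inj_eq (@complexI R)) gt_eqF.
have E : (fun z => v z - (w z + t%:C * w' z)) = (fun z => t%:C * (y z - w' z)).
  apply/funext => z; rewrite /y mulrBr mulrA -rmorphM divff ?gt_eqF// mul1r.
  by rewrite opprD addrA.
have : (N (fun z => (t%:C * (y z - w' z))%R) <= (modulus t%:C * x)%:E)%E.
  by apply: NZ; [exact: XB|rewrite Nx].
rewrite -E Nr lee_fin modulus_real ger0_norm ?(ltW t0)// => rt.
nra.
Qed.

(** If g z0 <> 0, then |g| >= delta at a sequence of distinct points near z0.
For the Riesz vectors y_n of these points, M_g y_n - M_g y_m with n < m is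
g(b_n) times the difference of y_n and a function vanishing at b_0, ..., b_n,
hence of size at least delta / 2: no subsequence of M_g y_n converges. *)
Theorem compact_multiplier_eq0 g : (forall z, disk z -> ccont g z) ->
  compact_on X N (mulop g) -> forall z0, disk z0 -> g z0 = 0.
Proof.
move=> cg [MX Mc] z0 Dz0; apply/eqP; apply: contrapT => /negP gz0.
have z01 : modulus z0 < 1 := Dz0.
have g0 := modulus_gt0 gz0; pose delta := modulus (g z0) / 2.
have delta0 : 0 < delta by rewrite divr_gt0.
have [e e0 He] := cg z0 Dz0 delta delta0.
pose e' := Num.min e (1 - modulus z0).
have e'0 : 0 < e' by rewrite lt_min e0 subr_gt0.
pose b (n : nat) := z0 + (e' / n.+2%:R)%:C.
have bm n : modulus (e' / n.+2%:R)%:C < e'.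
  by rewrite modulus_real ger0_norm ?divr_ge0 ?ltW// ltr_pdivrMr// ltr_pMr// ltr1n.
have Db n : disk (b n).
  change (modulus (b n) < 1); apply: le_lt_trans (ler_modulusD _ _) _.
  have : e' <= 1 - modulus z0 by rewrite ge_min lexx orbT.
  by have := bm n; lra.
have injb : injective b.
  move=> n m /addrI /complexI /(mulfI (lt0r_neq0 e'0)) /invr_inj /eqP.
  by rewrite eqr_nat => /eqP [].
have gb n : delta <= modulus (g (b n)).
  have /He : modulus (e' / n.+2%:R)%:C < e by apply: lt_le_trans (bm n) _; rewrite ge_min lexx.
  rewrite -/(b n) modulusBC => H; have := lerB_modulus (g z0) (g z0 - g (b n)).
  by rewrite subKr /delta in H *; lra.
have [y yP] := choice (fun n => riesz_vanishing n Db injb).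
have Xy n : X (y n) by have [[]] := yP n.
have [|k [h [kinc Xh cv]]] := Mc y Xy.
  by exists 1 => n; have [] := yP n.
pose eps := delta / (8 * K).
have eps0 : 0 < eps by rewrite divr_gt0// mulr_gt0.
have [n0 close] : exists n0, forall n, (n0 <= n)%N ->
    (N (fun z => (mulop g (y (k n)) z - h z)%R) <= eps%:E)%E.
  move/fine_cvgP : cv => [fin_near /cvgrPdist_le/(_ eps eps0) near_eps].
  have [n0 _ H] : \forall n \near \oo, N (mulop g (y (k n)) - h) \is a fin_num /\
      `|0 - fine (N (mulop g (y (k n)) - h))| <= eps.
    by near=> n; split; near: n.
  exists n0 => n n0n; have [fin le] := H n n0n.
  rewrite (_ : (fun z => mulop g (y (k n)) z - h z) = mulop g (y (k n)) - h)//.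
  rewrite -(fineK fin) lee_fin; apply: le_trans le.
  by rewrite sub0r normrN ler_norm.
have far n m : (n < m)%N ->
    ((delta / 2)%:E <= N (fun z => (mulop g (y n) z - mulop g (y m) z)%R))%E.
  move=> nm; have [[_ yn0] _ yn] := yP n; have [[_ ym0] _ _] := yP m.
  have gn0 : g (b n) != 0.
    by apply/eqP => E; have := gb n; rewrite E modulus0; lra.
  pose w z := y n z - (g (b n))^-1 * (mulop g (y n) z - mulop g (y m) z).
  have XM : X (fun z => mulop g (y n) z - mulop g (y m) z) by apply: XB; exact: MX.
  have vw : vanishing b n.+1 w.
    split; first by apply: XB => //; exact: XZ.
    move=> i; rewrite ltnS leq_eqVlt => /orP[/eqP ->|lt_in].
    - by rewrite /w /mulop (ym0 n nm) mul0r subr0 mulrCA mulVf// mulr1 subrr.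
    - by rewrite /w /mulop yn0// ym0 ?(ltn_trans lt_in)// !mul0r subrr mulr0 subrr.
  have := yn w vw.
  have -> : (fun z => y n z - w z) =
     (fun z => (g (b n))^-1 * (mulop g (y n) z - mulop g (y m) z)).
    by apply/funext => z; rewrite /w subKr.
  have [x x0 Nx] := N_fin XM; rewrite Nx lee_fin => H.
  have : (N (fun z => ((g (b n))^-1 * (mulop g (y n) z - mulop g (y m) z))%R) <=
     (modulus (g (b n))^-1 * x)%:E)%E by apply: NZ => //; rewrite Nx.
  move=> /(le_trans H); rewrite lee_fin modulusV [_^-1 * x]mulrC ler_pdivlMr; last first.
    exact: lt_le_trans delta0 (gb n).
  by have := gb n; lra.
have := far (k n0) (k n0.+1) (kinc _ _ (ltnSn n0)).
have c1 := close n0 (leqnn _); have c2 := close n0.+1 (leqnSn _).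
have X1 : X (fun z => mulop g (y (k n0)) z - h z) by apply: XB => //; exact: MX.
have X2 : X (fun z => mulop g (y (k n0.+1)) z - h z) by apply: XB => //; exact: MX.
have c3 := NZ (-1) X2 c2.
have := ND X1 (XZ (-1) X2) c1 c3.
have -> : (fun z => mulop g (y (k n0)) z - h z + -1 * (mulop g (y (k n0.+1)) z - h z)) =
  (fun z => mulop g (y (k n0)) z - mulop g (y (k n0.+1)) z).
  by apply/funext => z; ring.
move=> le1 le2; have := le_trans le2 le1.
rewrite lee_fin modulusN modulus1 mul1r.
have -> : K * (eps + eps) = delta / 4 by rewrite /eps; field; rewrite gt_eqF.
lra.
Unshelve. all: by end_near. Qed.

End RieszArgument.

Local Close Scope complex_scope.

Theorem theorem6p3 (R : realType) (alpha s p : R)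
    (halpha : 0 < alpha) (hs : 0 < s) (hp : 0 < p)
    (hsum : 1 < s + p * alpha) :
  M0 (Fspace p (p * alpha - 2) s) (Fnorm p (p * alpha - 2) s) =
  [set g : R[i] -> R[i] | forall z, disk z -> g z = 0].
Proof.
have q2 : -2 < p * alpha - 2 by have := mulr_gt0 hp halpha; lra.
have qs : -1 < p * alpha - 2 + s by lra.
set q := p * alpha - 2 in q2 qs *.
apply/seteqP; split => [g [hg cg] z Dz|g g0].
- have K0 : 0 < 1 + 2 * 2 `^ p^-1 :> R by rewrite ltr_pwDl// mulr_ge0 ?powR_ge0.
  have cgD w : disk w -> ccont g w by move=> Dw; apply: holo_ccont; exact: analytic_holo.
  have ev a : disk a -> exists2 B : R, 0 <= B & forall f, Fspace p q s f ->
      (Fnorm p q s f <= 1%E)%E -> modulus (f a) <= B.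
    move=> Da; have [B B0 HB] := point_evaluation q s hp Da.
    by exists B => // f [hf _]; exact: HB.
  exact: (compact_multiplier_eq0 (@FspaceD _ p q s hp) (@FspaceZ _ p q s hp)
    (fun t => Fspace_prod hp t q2 hs qs) (@Fnorm_fin _ p q s) (@FnormZ _ p q s hp) K0
    (@FnormD _ p q s hp) ev cgD cg Dz).
have null f : (forall z, disk z -> f z = 0) -> Fspace p q s f /\ Fnorm p q s f = 0%E.
  move=> f0; have [hf df] := analytic_eq0 f0.
  have S0 : Fsup p q s f = 0%E.
    apply/eqP; rewrite eq_le Fsup_ge0 andbT; apply: Fsup_le => a Da.
    rewrite /disk_integral integral0_eq ?mule0// => w Dw.
    by rewrite Fdensity_weight df// modulus0 powR0 ?gt_eqF// mul0r.
  have Sem : Fseminorm p q s f = 0%E.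
    by rewrite /Fseminorm -/(Fsup p q s f) S0 poweR0r// invr_neq0// gt_eqF.
  split; first by split; rewrite // Sem.
  by rewrite /Fnorm Sem f0 ?modulus0 ?adde0//; exact: disk0.
split; first exact: (analytic_eq0 g0).1.
have Mg f : forall z, disk z -> mulop g f z = 0.
  by move=> z Dz; rewrite /mulop g0// mulr0.
split; first by move=> f _; exact: (null _ (Mg f)).1.
move=> f _ _; exists id, (fun=> 0); split => //.
- exact: (null _ (fun z _ => erefl)).1.
- rewrite (_ : (fun n => _) = fun=> 0%E); first exact: cvg_cst.
  by apply/funext => n; apply: (null _ _).2 => z Dz; rewrite fctE Mg// subr0.
Qed.
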